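(* Let $k$ be a commutative ring and let $A,B,C$ be $k$-algebras together with a recollement of $\mathcal{D}(\mathrm{Mod}\,A)$ by $\mathcal{D}(\mathrm{Mod}\,B)$ and $\mathcal{D}(\mathrm{Mod}\,C)$, with functors $i^*,i_*=i_!,i^!$ and $j_!,j^!=j^*,j_*$. The following are equivalent: (i) the recollement restricts to a recollement of $K^b(\mathrm{proj}\,A)$ by $K^b(\mathrm{proj}\,B)$ and $K^b(\mathrm{proj}\,C)$; (ii) $i_*(B)\in K^b(\mathrm{proj}\,A)$ and $i^!(A)\in K^b(\mathrm{proj}\,B)$; (iii) $j^*(A)\in K^b(\mathrm{proj}\,C)$ and $j_*(C)\in K^b(\mathrm{proj}\,A)$.
   Context: $\mathcal{D}(\mathrm{Mod}\,A)$ is the unbounded derived category of right $A$-modules; $K^b(\mathrm{proj}\,A)$ is the homotopy category of bounded complexes of finitely generated projective right $A$-modules, identified with its essential image in $\mathcal{D}(\mathrm{Mod}\,A)$. All functors are $k$-linear. A recollement of a triangulated category $\mathcal{C}$ by $\mathcal{C}'$ and $\mathcal{C}''$ consists of triangle functors $i^*,i^!:\mathcal{C}\to\mathcal{C}'$, $i_*=i_!:\mathcal{C}'\to\mathcal{C}$, $j_!,j_*:\mathcal{C}''\to\mathcal{C}$, $j^!=j^*:\mathcal{C}\to\mathcal{C}''$ such that (1) $(i^*,i_* )$, $(i_!,i^!)$, $(j_!,j^!)$, $(j^*,j_* )$ are adjoint pairs; (2) $i_*,j_*,j_!$ are fully faithful; (3) $i^!\circ j_*=0$; (4) for each $X\in\mathcal{C}$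 there are triangles $i_!i^!(X)\to X\to j_*j^*(X)\to i_!i^!(X)[1]$ and $j_!j^!(X)\to X\to i_*i^*(X)\to j_!j^!(X)[1]$ whose first two maps are given by the adjunctions. The recollement restricts to $K^b(\mathrm{proj})$ if all six functors send the subcategories $K^b(\mathrm{proj})$ to each other and the restricted functors form a recollement. *)

(* Defs.v *)
From HB Require Import structures.
From mathcomp Require Import all_boot all_algebra boolp.

Set Implicit Arguments.
Unset Strict Implicit.
Unset Printing Implicit Defensive.

Import GRing.Theory.
Local Open Scope ring_scope.

Declare Scope lincat_scope.
Delimit Scope lincat_scope with lincat.

(* The Hom sets are k-modules.  They are not [lmodType]s because the Hom sets
   of a localization live in a larger universe than the modules it is built
   from.  The opposite of [f] is [hscale (-1) f]. *)
Record lincat (k : comPzRingType) := LinCat {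
  obj :> Type;
  hom : obj -> obj -> Type;
  idm : forall X, hom X X;
  compm : forall X Y Z, hom Y Z -> hom X Y -> hom X Z;
  hzero : forall X Y, hom X Y;
  hadd : forall X Y, hom X Y -> hom X Y -> hom X Y;
  hscale : forall X Y, k -> hom X Y -> hom X Y;
  compA : forall X Y Z T (f : hom X Y) (g : hom Y Z) (h : hom Z T),
    compm h (compm g f) = compm (compm h g) f;
  comp1m : forall X Y (f : hom X Y), compm (idm Y) f = f;
  compm1 : forall X Y (f : hom X Y), compm f (idm X) = f;
  haddA : forall X Y (f g h : hom X Y), hadd f (hadd g h) = hadd (hadd f g) h;
  haddC : forall X Y (f g : hom X Y), hadd f g = hadd g f;
  hadd0 : forall X Y (f : hom X Y), hadd (hzero X Y) f = f;
  hscale0 : forall X Y (f : hom X Y), hscale 0 f = hzero X Y;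
  hscale1 : forall X Y (f : hom X Y), hscale 1 f = f;
  hscaleA : forall X Y a b (f : hom X Y),
    hscale a (hscale b f) = hscale (a * b) f;
  hscaleDl : forall X Y a b (f : hom X Y),
    hscale (a + b) f = hadd (hscale a f) (hscale b f);
  hscaleDr : forall X Y a (f g : hom X Y),
    hscale a (hadd f g) = hadd (hscale a f) (hscale a g);
  compDl : forall X Y Z (f g : hom Y Z) (h : hom X Y),
    compm (hadd f g) h = hadd (compm f h) (compm g h);
  compDr : forall X Y Z (h : hom Y Z) (f g : hom X Y),
    compm h (hadd f g) = hadd (compm h f) (compm h g);
  compZl : forall X Y Z a (f : hom Y Z) (g : hom X Y),
    compm (hscale a f) g = hscale a (compm f g);
  compZr : forall X Y Z a (f : hom Y Z) (g : hom X Y),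
    compm f (hscale a g) = hscale a (compm f g)
}.
Arguments hom {k C} : rename.
Arguments idm {k C} X : rename.
Arguments compm {k C X Y Z} : rename.
Arguments hzero {k C} X Y : rename.
Arguments hadd {k C X Y} : rename.
Arguments hscale {k C X Y} : rename.

Notation "g ∘ f" := (compm g f) (at level 40, left associativity)
  : lincat_scope.
Local Open Scope lincat_scope.

Section CategoryTheory.
Context {k : comPzRingType}.
Implicit Types C D : lincat k.

Definition is_iso C (X Y : C) (f : hom X Y) : Prop :=
  exists g : hom Y X, g ∘ f = idm X /\ f ∘ g = idm Y.

Definition isomorphic C (X Y : C) : Prop := exists f : hom X Y, is_iso f.

Definition is_zero C (X : C) : Prop := idm X = hzero X X.

Record linfunctor C D := LinFunctor {
  fobj :> C -> D;
  fmap : forall X Y : C, hom X Y -> hom (fobj X) (fobj Y);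
  fmap1 : forall X : C, fmap (idm X) = idm (fobj X);
  fmapM : forall (X Y Z : C) (g : hom Y Z) (f : hom X Y),
    fmap (g ∘ f) = fmap g ∘ fmap f;
  fmapD : forall (X Y : C) (f g : hom X Y),
    fmap (hadd f g) = hadd (fmap f) (fmap g);
  fmapZ : forall (X Y : C) a (f : hom X Y),
    fmap (hscale a f) = hscale a (fmap f)
}.

Definition fully_faithful C D (F : linfunctor C D) : Prop :=
  forall X Y : C, bijective (@fmap C D F X Y).

(* L is the left adjoint. *)
Record adjunction C D (L : linfunctor C D) (R : linfunctor D C) := Adjunction {
  adj_unit : forall X : C, hom X (R (L X));
  adj_counit : forall Y : D, hom (L (R Y)) Y;
  unit_nat : forall (X X' : C) (f : hom X X'),
    adj_unit X' ∘ f = fmap R (fmap L f) ∘ adj_unit X;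
  counit_nat : forall (Y Y' : D) (g : hom Y Y'),
    g ∘ adj_counit Y = adj_counit Y' ∘ fmap L (fmap R g);
  triangleL : forall X : C, adj_counit (L X) ∘ fmap L (adj_unit X) = idm (L X);
  triangleR : forall Y : D, fmap R (adj_counit Y) ∘ adj_unit (R Y) = idm (R Y)
}.

End CategoryTheory.

(* The structure of a triangulated category: a shift [1] and a class of
   distinguished triangles X -> Y -> Z -> X[1].  Being triangulated is a
   property of this structure.  It is a theorem for the two families of
   categories used below, and the notions defined here refer to the structure
   only, so the axioms are not bundled. *)
Record tricat (k : comPzRingType) := TriCat {
  tri_lincat :> lincat k;
  shift : linfunctor tri_lincat tri_lincat;
  dist : forall X Y Z : tri_lincat,
    hom X Y -> hom Y Z -> hom Z (shift X) -> Prop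
}.
Arguments shift {k T} : rename.
Arguments dist {k T X Y Z} : rename.

Section Triangulated.
Context {k : comPzRingType}.
Implicit Types S T : tricat k.

Record trifunctor S T := TriFunctor {
  tri_functor :> linfunctor S T;
  fshift : forall X : S, hom (tri_functor (shift X)) (shift (tri_functor X));
  fshift_iso : forall X : S, is_iso (fshift X);
  fshift_nat : forall (X Y : S) (f : hom X Y),
    fshift Y ∘ fmap tri_functor (fmap shift f)
      = fmap shift (fmap tri_functor f) ∘ fshift X;
  fdist : forall (X Y Z : S) (f : hom X Y) (g : hom Y Z) (h : hom Z (shift X)),
    dist f g h ->
    dist (fmap tri_functor f) (fmap tri_functor g)
         (fshift X ∘ fmap tri_functor h)
}.

(* The functors of a recollement of T by T' and T'':
     i_* = i_! is [i_low],  i^* is [i_up],  i^! is [i_shriek],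
     j^! = j^* is [j_up],  j_! is [j_shriek],  j_* is [j_low]. *)
Record six_functors (T' T T'' : tricat k) := SixFunctors {
  i_up : trifunctor T T';
  i_low : trifunctor T' T;
  i_shriek : trifunctor T T';
  j_shriek : trifunctor T'' T;
  j_up : trifunctor T T'';
  j_low : trifunctor T'' T
}.

Definition is_recollement (T' T T'' : tricat k)
    (R : six_functors T' T T'') : Prop :=
  exists (ad_iup : adjunction (i_up R) (i_low R))
         (ad_ilow : adjunction (i_low R) (i_shriek R))
         (ad_jshriek : adjunction (j_shriek R) (j_up R))
         (ad_jup : adjunction (j_up R) (j_low R)),
  [/\ [/\ fully_faithful (i_low R), fully_faithful (j_low R)
        & fully_faithful (j_shriek R)],
      forall X : T'', is_zero (i_shriek R (j_low R X)),
      forall X : T, exists h : hom (j_low R (j_up R X))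
                                   (shift (i_low R (i_shriek R X))),
        dist (adj_counit ad_ilow X) (adj_unit ad_jup X) h
    & forall X : T, exists h : hom (i_low R (i_up R X))
                                   (shift (j_shriek R (j_up R X))),
        dist (adj_counit ad_jshriek X) (adj_unit ad_iup X) h].

End Triangulated.

Section FullSubcategory.
Context {k : comPzRingType}.

Section Object.
Variables (T : tricat k) (P : T -> Prop).
Hypothesis Pshift : forall X, P X -> P (shift X).

Definition full_lincat : lincat k :=
  @LinCat k {X : T | P X} (fun X Y => hom (sval X) (sval Y))
    (fun X => idm (sval X)) (fun X Y Z g f => g ∘ f)
    (fun X Y => hzero (sval X) (sval Y)) (fun X Y f g => hadd f g)
    (fun X Y a f => hscale a f)
    (fun X Y Z U f g h => compA f g h)
    (fun X Y f => comp1m f) (fun X Y f => compm1 f)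
    (fun X Y f g h => haddA f g h) (fun X Y f g => haddC f g)
    (fun X Y f => hadd0 f) (fun X Y f => hscale0 f) (fun X Y f => hscale1 f)
    (fun X Y a b f => hscaleA a b f) (fun X Y a b f => hscaleDl a b f)
    (fun X Y a f g => hscaleDr a f g)
    (fun X Y Z f g h => compDl f g h) (fun X Y Z h f g => compDr h f g)
    (fun X Y Z a f g => compZl a f g) (fun X Y Z a f g => compZr a f g).

Definition full_shift : linfunctor full_lincat full_lincat :=
  @LinFunctor k full_lincat full_lincat
    (fun X => exist P (shift (sval X)) (Pshift (svalP X)))
    (fun X Y f => fmap (@shift k T) (X := sval X) (Y := sval Y) f)
    (fun X => fmap1 shift (sval X))
    (fun X Y Z g f => fmapM (@shift k T) g f)
    (fun X Y f g => fmapD (@shift k T) f g)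
    (fun X Y a f => fmapZ (@shift k T) a f).

Definition full_tricat : tricat k :=
  @TriCat k full_lincat full_shift
    (fun X Y Z f g h => @dist k T (sval X) (sval Y) (sval Z) f g h).

End Object.

Section Functor.
Variables (S T : tricat k) (P : S -> Prop) (Q : T -> Prop).
Hypothesis Pshift : forall X, P X -> P (shift X).
Hypothesis Qshift : forall X, Q X -> Q (shift X).
Variable F : trifunctor S T.

Definition preserves : Prop := forall X, P X -> Q (F X).

Hypothesis FPQ : preserves.

Definition full_linfunctor :
    linfunctor (full_tricat Pshift) (full_tricat Qshift) :=
  @LinFunctor k (full_tricat Pshift) (full_tricat Qshift)
    (fun X => exist Q (F (sval X)) (FPQ (svalP X)))
    (fun X Y f => fmap F (X := sval X) (Y := sval Y) f)
    (fun X => fmap1 F (sval X))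
    (fun X Y Z g f => fmapM F g f)
    (fun X Y f g => fmapD F f g)
    (fun X Y a f => fmapZ F a f).

Definition full_trifunctor :
    trifunctor (full_tricat Pshift) (full_tricat Qshift) :=
  @TriFunctor k (full_tricat Pshift) (full_tricat Qshift)
    full_linfunctor (fun X => fshift F (sval X))
    (fun X => fshift_iso F (sval X))
    (fun X Y f => @fshift_nat k S T F (sval X) (sval Y) f)
    (fun X Y Z f g h =>
       @fdist k S T F (sval X) (sval Y) (sval Z) f g h).

End Functor.

Section Recollement.
Variables (T' T T'' : tricat k).
Variables (P' : T' -> Prop) (P : T -> Prop) (P'' : T'' -> Prop).
Hypothesis Pshift' : forall X, P' X -> P' (shift X).
Hypothesis Pshift : forall X, P X -> P (shift X).
Hypothesis Pshift'' : forall X, P'' X -> P'' (shift X).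
Variable R : six_functors T' T T''.

Definition restricts : Prop :=
  exists (p_iup : preserves P P' (i_up R))
         (p_ilow : preserves P' P (i_low R))
         (p_ishriek : preserves P P' (i_shriek R))
         (p_jshriek : preserves P'' P (j_shriek R))
         (p_jup : preserves P P'' (j_up R))
         (p_jlow : preserves P'' P (j_low R)),
  is_recollement (SixFunctors
    (full_trifunctor Pshift Pshift' p_iup)
    (full_trifunctor Pshift' Pshift p_ilow)
    (full_trifunctor Pshift Pshift' p_ishriek)
    (full_trifunctor Pshift'' Pshift p_jshriek)
    (full_trifunctor Pshift Pshift'' p_jup)
    (full_trifunctor Pshift'' Pshift p_jlow)).

End Recollement.

End FullSubcategory.

(* [algType k] would exclude the zero algebra. *)
Record kalg (k : comPzRingType) := KAlg {
  kalg_ring :> pzRingType;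
  kalg_map : {rmorphism k -> kalg_ring};
  kalg_central : forall (a : k) (x : kalg_ring),
    kalg_map a * x = x * kalg_map a
}.

(* Right A-modules are left modules over the opposite ring A^c. *)
Notation rmodType A := (lmodType A^c).

Section Projective.
Variable A : pzRingType.

Definition fin_gen (M : rmodType A) : Prop :=
  exists n (e : 'I_n -> M), forall x, exists c : 'I_n -> A^c,
    x = \sum_i c i *: e i.

Definition projective (P : rmodType A) : Prop :=
  forall (M N : rmodType A) (p : {linear M -> N}) (f : {linear P -> N}),
    (forall y, exists x, p x = y) ->
    exists g : {linear P -> M}, forall x, p (g x) = f x.

End Projective.

Section Complexes.
Context {k : comPzRingType}.
Variable A : kalg k.

Record complex := Complex {
  cobj :> int -> rmodType A;
  cdiff : forall n, {linear cobj n -> cobj (n + 1)};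
  cdiffK : forall n x, cdiff (n + 1) (cdiff n x) = 0
}.

Record chmap (X Y : complex) := ChMap {
  cmap :> forall n, {linear X n -> Y n};
  cmapE : forall n x, cmap (n + 1) (cdiff X n x) = cdiff Y n (cmap n x)
}.

Section Action.
Variables (a : k) (M : rmodType A).

(* Right multiplication by the central element a of A. *)
Definition kact (x : M) : M := (kalg_map A a : A^c) *: x.

Fact kact_linear : linear kact.
Proof.
move=> b x y; rewrite /kact scalerDr !scalerA; congr (_ *: _ + _).
by rewrite /GRing.mul /= kalg_central.
Qed.

HB.instance Definition _ := GRing.isLinear.Build A^c M M *:%R kact kact_linear.

End Action.
Arguments kact a {M} x.

Section ChainMaps.
Variables X Y Z : complex.

Fact chid_subproof n (x : X n) :
  (idfun : {linear _ -> _}) (cdiff X n x)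
    = cdiff X n ((idfun : {linear _ -> _}) x).
Proof. by []. Qed.
Definition chid : chmap X X := ChMap chid_subproof.

Fact chcomp_subproof (g : chmap Y Z) (f : chmap X Y) n x :
  (g (n + 1) \o f (n + 1)) (cdiff X n x) = cdiff Z n ((g n \o f n) x).
Proof. by rewrite /= !cmapE. Qed.
Definition chcomp g f : chmap X Z := ChMap (chcomp_subproof g f).

Fact chzero_subproof n (x : X n) :
  (\0 : {linear X (n + 1) -> Y (n + 1)}) (cdiff X n x)
    = cdiff Y n ((\0 : {linear X n -> Y n}) x).
Proof. by rewrite /= linear0. Qed.
Definition chzero : chmap X Y := ChMap chzero_subproof.

Fact chadd_subproof (f g : chmap X Y) n x :
  (f (n + 1) \+ g (n + 1)) (cdiff X n x) = cdiff Y n ((f n \+ g n) x).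
Proof. by rewrite /= linearD !cmapE. Qed.
Definition chadd f g : chmap X Y := ChMap (chadd_subproof f g).

Fact chscale_subproof a (f : chmap X Y) n x :
  (kact a \o f (n + 1)) (cdiff X n x) = cdiff Y n ((kact a \o f n) x).
Proof. by rewrite /= cmapE /kact linearZ. Qed.
Definition chscale a f : chmap X Y := ChMap (chscale_subproof a f).

End ChainMaps.

(* X[1]^n = X^(n+1), with differential -d. *)
Fact cshift_subproof (X : complex) n (x : X (n + 1)) :
  (\- cdiff X (n + 1 + 1)) ((\- cdiff X (n + 1)) x) = 0.
Proof. by rewrite /= linearN /= opprK cdiffK. Qed.
Definition cshift (X : complex) : complex :=
  @Complex (fun n => X (n + 1)) (fun n => \- cdiff X (n + 1))
    (@cshift_subproof X).

Fact chshift_subproof X Y (f : chmap X Y) n (x : X (n + 1)) :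
  f (n + 1 + 1) (cdiff (cshift X) n x) = cdiff (cshift Y) n (f (n + 1) x).
Proof. by rewrite /= linearN /= cmapE. Qed.
Definition chshift X Y (f : chmap X Y) : chmap (cshift X) (cshift Y) :=
  @ChMap (cshift X) (cshift Y) (fun n => f (n + 1)) (@chshift_subproof X Y f).

(* cone(u)^n = X^(n+1) (+) Y^n, with differential (x, y) |-> (-dx, ux + dy). *)
Section Cone.
Variables (X Y : complex) (u : chmap X Y).

Definition cone_obj (n : int) : rmodType A := (X (n + 1)%R * Y n)%type.

Definition cone_diff n (p : cone_obj n) : cone_obj (n + 1) :=
  (- cdiff X (n + 1) p.1, u (n + 1) p.1 + cdiff Y n p.2).

Fact cone_diff_linear n : linear (@cone_diff n).
Proof.
move=> a p q; rewrite /cone_diff /= !linearP /=; congr pair.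
by rewrite /= scalerDr addrACA.
Qed.

HB.instance Definition _ n :=
  GRing.isLinear.Build A^c (cone_obj n) (cone_obj (n + 1)) *:%R (@cone_diff n)
    (@cone_diff_linear n).

Fact cone_diffK n (p : cone_obj n) : cone_diff (cone_diff p) = 0.
Proof.
rewrite /cone_diff /= !(linearN, linearD) /= !cdiffK cmapE addr0 oppr0.
by congr pair; rewrite /= ?oppr0 ?addNr.
Qed.

Definition cone : complex :=
  @Complex cone_obj (fun n => @cone_diff n) cone_diffK.

Definition cone_inl_fun n (y : Y n) : cone n := (0, y).
Fact cone_inl_linear n : linear (@cone_inl_fun n).
Proof.
by move=> a x y; rewrite /cone_inl_fun; congr pair; rewrite /= scaler0 addr0.
Qed.
HB.instance Definition _ n :=
  GRing.isLinear.Build A^c (Y n) (cone n) *:%R (@cone_inl_fun n)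
    (@cone_inl_linear n).

Definition cone_proj_fun n (p : cone n) : cshift X n := p.1.
Fact cone_proj_linear n : linear (@cone_proj_fun n).
Proof. by []. Qed.
HB.instance Definition _ n :=
  GRing.isLinear.Build A^c (cone n) (cshift X n) *:%R (@cone_proj_fun n)
    (@cone_proj_linear n).

Fact cone_inl_subproof n (y : Y n) :
  cone_inl_fun (cdiff Y n y) = cdiff cone n (cone_inl_fun y).
Proof.
by rewrite /= /cone_diff /cone_inl_fun /= !linear0 add0r; congr pair; rewrite ?oppr0.
Qed.
Definition cone_inl : chmap Y cone :=
  @ChMap Y cone (fun n => @cone_inl_fun n) cone_inl_subproof.

Fact cone_proj_subproof n (p : cone n) :
  cone_proj_fun (cdiff cone n p) = cdiff (cshift X) n (cone_proj_fun p).
Proof. by []. Qed.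
Definition cone_proj : chmap cone (cshift X) :=
  @ChMap cone (cshift X) (fun n => @cone_proj_fun n) cone_proj_subproof.

End Cone.

(* f induces an injective, resp. surjective, map on H^(n+1) for every n. *)
Definition quasi_iso X Y (f : chmap X Y) : Prop :=
  (forall n (x : X (n + 1)), cdiff X (n + 1) x = 0 ->
     (exists y : Y n, f (n + 1) x = cdiff Y n y) ->
     exists x' : X n, x = cdiff X n x') /\
  (forall n (y : Y (n + 1)), cdiff Y (n + 1) y = 0 ->
     exists x : X (n + 1), cdiff X (n + 1) x = 0 /\
       exists y' : Y n, y - f (n + 1) x = cdiff Y n y').

Lemma quasi_iso_shift X Y (f : chmap X Y) :
  quasi_iso f -> quasi_iso (chshift f).
Proof.
move=> [inj_f surj_f]; split=> [n x /= /eqP|n y /= /eqP]; rewrite oppr_eq0.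
  move=> /eqP dx [y fx]; have [|x' xE] := inj_f _ _ dx.
    by exists (- y); rewrite linearN.
  by exists (- x'); rewrite linearN opprK.
move=> /eqP /surj_f [x [dx [y' yE]]]; exists x; split; first by rewrite dx oppr0.
by exists (- y'); rewrite linearN opprK.
Qed.

(* In degree 0, a in A acts on (A^c)^o by x |-> x * a in A. *)
Definition regular_obj (n : int) : rmodType A :=
  match n with Posz 0 => (A^c)^o | _ => 'rV[A^c]_0 end.
Definition regular : complex :=
  @Complex regular_obj (fun n => \0) (fun n x => erefl).

Definition bounded (X : complex) : Prop :=
  exists m : nat, forall n : int, (m < `|n|)%N -> forall x : X n, x = 0.

(* D(Mod A) is the localization of the k-linear category of complexes at the
   quasi-isomorphisms.  [dterm] and [deq] present it by generators and
   relations: chain maps and formal inverses of quasi-isomorphisms, modulo the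
   axioms of k-linear categories, the k-linear functoriality of [tmap] and the
   equations of inverses.  Quasi-isomorphisms are stable under finite direct
   sums, so this is also the localization in the sense of plain categories. *)
Inductive dterm : complex -> complex -> Type :=
| tmap X Y of chmap X Y : dterm X Y
| tinv X Y (s : chmap X Y) of quasi_iso s : dterm Y X
| tcomp X Y Z of dterm Y Z & dterm X Y : dterm X Z
| tadd X Y of dterm X Y & dterm X Y : dterm X Y
| tscale X Y of k & dterm X Y : dterm X Y.

Inductive deq : forall X Y, dterm X Y -> dterm X Y -> Prop :=
| deq_refl X Y (f : dterm X Y) : deq f f
| deq_sym X Y (f g : dterm X Y) : deq f g -> deq g f
| deq_trans X Y (f g h : dterm X Y) : deq f g -> deq g h -> deq f h
| deq_comp X Y Z (g g' : dterm Y Z) (f f' : dterm X Y) :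
    deq g g' -> deq f f' -> deq (tcomp g f) (tcomp g' f')
| deq_add X Y (f f' g g' : dterm X Y) :
    deq f f' -> deq g g' -> deq (tadd f g) (tadd f' g')
| deq_scale X Y a (f f' : dterm X Y) :
    deq f f' -> deq (tscale a f) (tscale a f')
| deq_compA X Y Z T (f : dterm X Y) (g : dterm Y Z) (h : dterm Z T) :
    deq (tcomp h (tcomp g f)) (tcomp (tcomp h g) f)
| deq_comp1m X Y (f : dterm X Y) : deq (tcomp (tmap (chid Y)) f) f
| deq_compm1 X Y (f : dterm X Y) : deq (tcomp f (tmap (chid X))) f
| deq_addA X Y (f g h : dterm X Y) :
    deq (tadd f (tadd g h)) (tadd (tadd f g) h)
| deq_addC X Y (f g : dterm X Y) : deq (tadd f g) (tadd g f)
| deq_add0 X Y (f : dterm X Y) : deq (tadd (tmap (chzero X Y)) f) f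
| deq_scale0 X Y (f : dterm X Y) : deq (tscale 0 f) (tmap (chzero X Y))
| deq_scale1 X Y (f : dterm X Y) : deq (tscale 1 f) f
| deq_scaleA X Y a b (f : dterm X Y) :
    deq (tscale a (tscale b f)) (tscale (a * b) f)
| deq_scaleDl X Y a b (f : dterm X Y) :
    deq (tscale (a + b) f) (tadd (tscale a f) (tscale b f))
| deq_scaleDr X Y a (f g : dterm X Y) :
    deq (tscale a (tadd f g)) (tadd (tscale a f) (tscale a g))
| deq_compDl X Y Z (f g : dterm Y Z) (h : dterm X Y) :
    deq (tcomp (tadd f g) h) (tadd (tcomp f h) (tcomp g h))
| deq_compDr X Y Z (h : dterm Y Z) (f g : dterm X Y) :
    deq (tcomp h (tadd f g)) (tadd (tcomp h f) (tcomp h g))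
| deq_compZl X Y Z a (f : dterm Y Z) (g : dterm X Y) :
    deq (tcomp (tscale a f) g) (tscale a (tcomp f g))
| deq_compZr X Y Z a (f : dterm Y Z) (g : dterm X Y) :
    deq (tcomp f (tscale a g)) (tscale a (tcomp f g))
| deq_map_ext X Y (f g : chmap X Y) :
    (forall n x, f n x = g n x) -> deq (tmap f) (tmap g)
| deq_mapM X Y Z (g : chmap Y Z) (f : chmap X Y) :
    deq (tmap (chcomp g f)) (tcomp (tmap g) (tmap f))
| deq_mapD X Y (f g : chmap X Y) :
    deq (tmap (chadd f g)) (tadd (tmap f) (tmap g))
| deq_mapZ X Y a (f : chmap X Y) :
    deq (tmap (chscale a f)) (tscale a (tmap f))
| deq_invl X Y (s : chmap X Y) (qs : quasi_iso s) :
    deq (tcomp (tinv qs) (tmap s)) (tmap (chid X))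
| deq_invr X Y (s : chmap X Y) (qs : quasi_iso s) :
    deq (tcomp (tmap s) (tinv qs)) (tmap (chid Y)).

Definition dhom (X Y : complex) : Type :=
  {c : dterm X Y -> Prop | exists f, c = deq f}.

Definition dclass X Y (f : dterm X Y) : dhom X Y :=
  exist _ (deq f) (ex_intro _ f erefl).

Definition drepr X Y (c : dhom X Y) : dterm X Y := sval (cid (svalP c)).

Lemma dreprK X Y (c : dhom X Y) : dclass (drepr c) = c.
Proof.
case: c => c cP; apply: eq_exist; rewrite /drepr /=.
by case: cid => f /= fE; rewrite fE.
Qed.

Lemma dclassP X Y (f g : dterm X Y) : dclass f = dclass g <-> deq f g.
Proof.
split=> [/(congr1 sval) /= ->|fg]; first exact: deq_refl.
apply: eq_exist; apply/funext => h; apply/propext; split; apply: deq_trans.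
  exact: deq_sym.
exact: fg.
Qed.

Lemma drepr_class X Y (f : dterm X Y) : deq (drepr (dclass f)) f.
Proof. by apply/dclassP; rewrite dreprK. Qed.

Definition dcomp X Y Z (g : dhom Y Z) (f : dhom X Y) : dhom X Z :=
  dclass (tcomp (drepr g) (drepr f)).
Definition dadd X Y (f g : dhom X Y) : dhom X Y :=
  dclass (tadd (drepr f) (drepr g)).
Definition dscale X Y (a : k) (f : dhom X Y) : dhom X Y :=
  dclass (tscale a (drepr f)).

Lemma dcompE X Y Z (g : dterm Y Z) (f : dterm X Y) :
  dcomp (dclass g) (dclass f) = dclass (tcomp g f).
Proof. by apply/dclassP; apply: deq_comp; exact: drepr_class. Qed.

Lemma daddE X Y (f g : dterm X Y) :
  dadd (dclass f) (dclass g) = dclass (tadd f g).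
Proof. by apply/dclassP; apply: deq_add; exact: drepr_class. Qed.

Lemma dscaleE X Y a (f : dterm X Y) :
  dscale a (dclass f) = dclass (tscale a f).
Proof. by apply/dclassP; apply: deq_scale; exact: drepr_class. Qed.

Lemma dhomP X Y (P : dhom X Y -> Prop) :
  (forall f, P (dclass f)) -> forall c, P c.
Proof. by move=> Pclass c; rewrite -(dreprK c). Qed.

Let dE := (dcompE, daddE, dscaleE).

Definition derived_lincat : lincat k.
Proof.
refine (@LinCat k complex dhom (fun X => dclass (tmap (chid X))) dcomp
  (fun X Y => dclass (tmap (chzero X Y))) dadd dscale
  _ _ _ _ _ _ _ _ _ _ _ _ _ _ _).
- move=> X Y Z T; do 3!elim/dhomP=> ?.
  by rewrite !dE; apply/dclassP; exact: deq_compA.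
- by move=> X Y; elim/dhomP=> ?; rewrite !dE; apply/dclassP; exact: deq_comp1m.
- by move=> X Y; elim/dhomP=> ?; rewrite !dE; apply/dclassP; exact: deq_compm1.
- move=> X Y; do 3!elim/dhomP=> ?.
  by rewrite !dE; apply/dclassP; exact: deq_addA.
- move=> X Y; do 2!elim/dhomP=> ?.
  by rewrite !dE; apply/dclassP; exact: deq_addC.
- by move=> X Y; elim/dhomP=> ?; rewrite !dE; apply/dclassP; exact: deq_add0.
- by move=> X Y; elim/dhomP=> ?; rewrite !dE; apply/dclassP; exact: deq_scale0.
- by move=> X Y; elim/dhomP=> ?; rewrite !dE; apply/dclassP; exact: deq_scale1.
- move=> X Y a b; elim/dhomP=> ?.
  by rewrite !dE; apply/dclassP; exact: deq_scaleA.
- move=> X Y a b; elim/dhomP=> ?.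
  by rewrite !dE; apply/dclassP; exact: deq_scaleDl.
- move=> X Y a; do 2!elim/dhomP=> ?.
  by rewrite !dE; apply/dclassP; exact: deq_scaleDr.
- move=> X Y Z; do 3!elim/dhomP=> ?.
  by rewrite !dE; apply/dclassP; exact: deq_compDl.
- move=> X Y Z; do 3!elim/dhomP=> ?.
  by rewrite !dE; apply/dclassP; exact: deq_compDr.
- move=> X Y Z a; do 2!elim/dhomP=> ?.
  by rewrite !dE; apply/dclassP; exact: deq_compZl.
- move=> X Y Z a; do 2!elim/dhomP=> ?.
  by rewrite !dE; apply/dclassP; exact: deq_compZr.
Defined.

Definition dmap X Y (f : chmap X Y) : @hom k derived_lincat X Y :=
  dclass (tmap f).

Fixpoint tshift X Y (f : dterm X Y) : dterm (cshift X) (cshift Y) :=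
  match f with
  | tmap _ _ f => tmap (chshift f)
  | tinv _ _ _ qs => tinv (quasi_iso_shift qs)
  | tcomp _ _ _ g f => tcomp (tshift g) (tshift f)
  | tadd _ _ f g => tadd (tshift f) (tshift g)
  | tscale _ _ a f => tscale a (tshift f)
  end.

Lemma deq_shift X Y (f g : dterm X Y) : deq f g -> deq (tshift f) (tshift g).
Proof.
have id_shift Z : deq (tmap (chid (cshift Z))) (tmap (chshift (chid Z))).
  exact: deq_map_ext.
have zero_shift Z T :
    deq (tmap (chzero (cshift Z) (cshift T))) (tmap (chshift (chzero Z T))).
  exact: deq_map_ext.
elim=> {X Y f g}; try by move=> *; econstructor; eauto.
- move=> X Y f /=; apply: deq_trans; last exact: deq_comp1m.
  by apply: deq_comp; [exact/deq_sym|exact: deq_refl].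
- move=> X Y f /=; apply: deq_trans; last exact: deq_compm1.
  by apply: deq_comp; [exact: deq_refl|exact/deq_sym].
- move=> X Y f /=; apply: deq_trans; last exact: deq_add0.
  by apply: deq_add; [exact/deq_sym|exact: deq_refl].
- by move=> X Y f /=; apply: deq_trans; first exact: deq_scale0.
- by move=> X Y f g fg; apply: deq_map_ext => n x; exact: fg.
- move=> X Y Z g f /=; apply: deq_trans; last exact: deq_mapM.
  exact: deq_map_ext.
- move=> X Y f g /=; apply: deq_trans; last exact: deq_mapD.
  exact: deq_map_ext.
- move=> X Y a f /=; apply: deq_trans; last exact: deq_mapZ.
  exact: deq_map_ext.
- by move=> X Y s qs /=; apply: deq_trans; first exact: deq_invl.
- by move=> X Y s qs /=; apply: deq_trans; first exact: deq_invr.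
Qed.

Definition dshift_map X Y (f : dhom X Y) : dhom (cshift X) (cshift Y) :=
  dclass (tshift (drepr f)).

Lemma dshift_mapE X Y (f : dterm X Y) :
  dshift_map (dclass f) = dclass (tshift f).
Proof. by apply/dclassP; apply: deq_shift; exact: drepr_class. Qed.

Definition derived_shift : linfunctor derived_lincat derived_lincat.
Proof.
refine (@LinFunctor k derived_lincat derived_lincat cshift dshift_map _ _ _ _).
- by move=> X; rewrite /= dshift_mapE; apply/dclassP; exact: deq_map_ext.
- by move=> X Y Z; do 2!elim/dhomP=> ?; rewrite /= !(dE, dshift_mapE).
- by move=> X Y; do 2!elim/dhomP=> ?; rewrite /= !(dE, dshift_mapE).
- by move=> X Y a; elim/dhomP=> ?; rewrite /= !(dE, dshift_mapE).
Defined.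

(* The distinguished triangles are those isomorphic to the triangle
   X -> Y -> cone u -> X[1] of a chain map u. *)
Definition derived_dist (X Y Z : derived_lincat)
    (f : hom X Y) (g : hom Y Z) (h : hom Z (derived_shift X)) : Prop :=
  exists (X' Y' : complex) (u : chmap X' Y')
    (a : @hom k derived_lincat X X') (b : @hom k derived_lincat Y Y')
    (c : @hom k derived_lincat Z (cone u)),
  [/\ [/\ is_iso a, is_iso b & is_iso c],
      b ∘ f = dmap u ∘ a,
      c ∘ g = dmap (cone_inl u) ∘ b
    & fmap derived_shift a ∘ h = dmap (cone_proj u) ∘ c].

Definition derived : tricat k := TriCat derived_dist.

(* The essential image of K^b(proj A) in D(Mod A).  K^b(proj A) -> D(Mod A) is
   fully faithful, so K^b(proj A) is identified with the full subcategory on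
   these objects. *)
Definition Kbproj (X : derived) : Prop :=
  exists P : complex,
    [/\ bounded P, forall n, fin_gen (P n) /\ projective (P n)
      & isomorphic (P : derived) X].

Lemma Kbproj_shift (X : derived) : Kbproj X -> Kbproj (shift X).
Proof.
move=> [P [[m bP] fgpP [f [g [gf fg]]]]]; exists (cshift P); split.
- exists m.+1 => n ltmn x; apply: bP.
  case: n ltmn {x} => [n|[|n]] //= mn; last by rewrite subn1.
  by rewrite addn1 ltnS; do 2!apply: ltnW.
- by move=> n; exact: fgpP.
- exists (fmap shift f); exists (fmap shift g); split.
    by rewrite -[LHS](fmapM shift g f) gf fmap1.
  by rewrite -[LHS](fmapM shift f g) fg fmap1.
Qed.

End Complexes.

(* Main.v *)
From HB Require Import structures.
From mathcomp Require Import all_boot all_order all_algebra boolp.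
From mathcomp Require Import zify.
Require Import Defs.

(** The category D(Mod A) is compactly generated, and the image of K^b(proj A)
    in it consists of the compact objects.  Granting this, the theorem is an
    argument about adjoint functors.  A left adjoint preserves compact objects
    as soon as its right adjoint preserves coproducts, and functors that have a
    right adjoint do preserve them; so i^* and j_! always restrict.  Conversely,
    if L preserves compact objects then its right adjoint preserves coproducts,
    because this can be tested on morphisms out of shifts of A.

    Suppose i_*(B) and i^!(A) are compact.  Then i_* and i^! preserve compact
    objects by devissage.  The triangle j_! j^* X -> X -> i_* i^* X makes
    j_! j^* X compact for X compact, and j_!, being fully faithful and
    compatible with coproducts, reflects compactness; so j^* restricts.  The
    triangle i_* i^! -> 1 -> j_* j^* at j_! X then makes j_* X compact, since
    j^* j_! X = X.

    Suppose j^*(A) and j_*(C) are compact.  Then j^* and j_* restrict, and j_*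
    preserves coproducts.  Given a morphism from i_* Y to a coproduct of objects
    Z_k, the coproduct of the triangles of the Z_k has its third term in the
    image of j_*, which receives no nonzero morphism from i_* Y; so the morphism
    lifts to the coproduct of the i_* i^! Z_k, hence comes from a morphism of Y
    to the coproduct of the i^! Z_k, and is a finite sum when Y is compact
    ([image_compact]).  So i_* restricts, and i^! does by the triangle at X and
    reflection along i_*.

    The bulk of the file proves that compact and perfect are the same.  Every
    complex has a resolution by a complex of free modules with the lifting
    property against surjective quasi-isomorphisms ([resolution],
    [res_cofibrant]), and morphisms of D(Mod A) out of such a complex are chain
    maps modulo those that factor through an acyclic complex ([dhom_chain],
    [dmap_inj]); everything is then computed with chain maps.  Perfect complexes
    are compact because a finitely generated module meets finitely many summands
    of a direct sum ([perfect_compact]).  For the converse, let P be a compact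
    resolution.  Testing compactness on the map from P to the direct sum of its
    cokernels P^n/B^n, one for each degree n, shows that P is split exact in
    high and low degrees, so P is a bounded complex of projectives
    ([compact_bounded]).  Testing it on a map from the bottom term into a direct
    sum of copies of A gives a finitely generated projective module G and an extension
    of P by a shift of G that is a shorter complex of projectives ([ext]); an
    induction on the length concludes ([devissage]).  The same induction shows
    that a triangle functor preserves perfect complexes once it maps A to one
    ([trifunctor_Kbproj]). *)

Set Implicit Arguments.
Unset Strict Implicit.
Unset Printing Implicit Defensive.

Import Order.TTheory GRing.Theory Num.Theory.
Local Open Scope ring_scope.
Local Open Scope lincat_scope.
#[local] Obligation Tactic := idtac.

(** * Submodules, quotients and direct sums *)

Lemma eq_sval T (P : T -> Prop) (u v : {x | P x}) : sval u = sval v -> u = v.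
Proof. by case: u v => x Px [y Py] /= xy; apply: eq_exist. Qed.

Definition mklin (R : pzRingType) (M N : lmodType R) (f : M -> N)
    (fL : linear f) : {linear M -> N} :=
  HB.pack f (GRing.isLinear.Build R M N *:%R f fL).
Arguments mklin : simpl never.

Lemma mklinE (R : pzRingType) (M N : lmodType R) (f : M -> N) (fL : linear f) x :
  mklin fL x = f x.
Proof. by []. Qed.

(** Membership is a proposition because boundaries, kernels and supports are not
    decidable; choice makes the subtype a module all the same. *)
Record submodule (R : pzRingType) (M : lmodType R) := Submodule {
  smem :> M -> Prop;
  smem0 : smem 0;
  smem_lin : forall a x y, smem x -> smem y -> smem (a *: x + y)
}.

Section SubModule.
Variables (R : pzRingType) (M : lmodType R).
Implicit Types N : submodule M.

Lemma smemD N x y : N x -> N y -> N (x + y).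
Proof. by move=> Nx Ny; rewrite -(scale1r x); apply: smem_lin. Qed.

Lemma smemZ N a x : N x -> N (a *: x).
Proof. by move=> Nx; rewrite -(addr0 (a *: x)); apply: smem_lin => //; apply: smem0. Qed.

Lemma smemN N x : N x -> N (- x).
Proof. by move=> Nx; rewrite -scaleN1r; apply: smemZ. Qed.

Variable N : submodule M.

Definition submod := {x : M | N x}.

HB.instance Definition _ := gen_eqMixin submod.
HB.instance Definition _ := gen_choiceMixin submod.

Definition submk x (Nx : N x) : submod := exist _ x Nx.

Lemma submod_inj (x y : submod) : sval x = sval y -> x = y.
Proof. exact: eq_sval. Qed.

Program Definition submod_zmod := GRing.isZmodule.Build submod
  (zero := submk (smem0 N)) (opp := fun x => submk (smemN (svalP x)))
  (add := fun x y => submk (smemD (svalP x) (svalP y))) _ _ _ _.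
Next Obligation. by move=> x y z; apply: submod_inj; rewrite /= addrA. Qed.
Next Obligation. by move=> x y; apply: submod_inj; rewrite /= addrC. Qed.
Next Obligation. by move=> x; apply: submod_inj; rewrite /= add0r. Qed.
Next Obligation. by move=> x; apply: submod_inj; rewrite /= addNr. Qed.
HB.instance Definition _ := submod_zmod.

Program Definition submod_lmod := GRing.Zmodule_isLmodule.Build R submod
  (scale := fun a x => submk (smemZ a (svalP x))) _ _ _ _.
Next Obligation. by move=> a b x; apply: submod_inj; rewrite /= scalerA. Qed.
Next Obligation. by move=> x; apply: submod_inj; rewrite /= scale1r. Qed.
Next Obligation. by move=> a x y; apply: submod_inj; rewrite /= scalerDr. Qed.
Next Obligation. by move=> x a b; apply: submod_inj; rewrite /= scalerDl. Qed.
HB.instance Definition _ := submod_lmod.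

Definition subval_fun (x : submod) : M := sval x.
Fact subval_linear : linear subval_fun. Proof. by []. Qed.
Definition subval : {linear submod -> M} := mklin subval_linear.

Section Corestriction.
Variables (L : lmodType R) (f : {linear L -> M}).
Hypothesis fN : forall x, N (f x).

Definition corestr_fun (x : L) : submod := submk (fN x).
Fact corestr_linear : linear corestr_fun.
Proof. by move=> a x y; apply: submod_inj; rewrite /= linearP. Qed.
Definition corestr : {linear L -> submod} := mklin corestr_linear.
End Corestriction.

End SubModule.

Section QuotientModule.
Variables (R : pzRingType) (M : lmodType R) (N : submodule M).

(** Cosets are sets, so that congruent elements have equal classes. *)
Definition quomod := {c : M -> Prop | exists x, c = fun y => N (y - x)}.

HB.instance Definition _ := gen_eqMixin quomod.
HB.instance Definition _ := gen_choiceMixin quomod.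

Definition quo_fun (x : M) : quomod := exist _ (fun y => N (y - x)) (ex_intro _ x erefl).
Definition quorepr (c : quomod) : M := sval (cid (svalP c)).

Lemma quo_eq x y : N (x - y) -> quo_fun x = quo_fun y.
Proof.
move=> Nxy; apply: eq_exist; apply/funext => z; apply/propext; split=> Nz.
  by rewrite -(subrK x z) -addrA; apply: smemD.
by rewrite -(subrK y z) -addrA; apply: smemD => //; rewrite -opprB; apply: smemN.
Qed.

Lemma quo_eqP x y : quo_fun x = quo_fun y -> N (x - y).
Proof. by move=> /(congr1 sval) /(congr1 (@^~ x)) /= <-; rewrite subrr; apply: smem0. Qed.

Lemma quoreprK c : quo_fun (quorepr c) = c.
Proof. by apply: eq_sval; rewrite /quorepr; case: cid => x /= ->. Qed.

Lemma quorepr_quo x : N (quorepr (quo_fun x) - x).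
Proof. by apply: quo_eqP; rewrite quoreprK. Qed.

Lemma quoP (P : quomod -> Prop) : (forall x, P (quo_fun x)) -> forall c, P c.
Proof. by move=> Px c; rewrite -(quoreprK c). Qed.

Definition quo_add c d := quo_fun (quorepr c + quorepr d).
Definition quo_opp c := quo_fun (- quorepr c).
Definition quo_scale a c := quo_fun (a *: quorepr c).

Lemma quo_addE x y : quo_add (quo_fun x) (quo_fun y) = quo_fun (x + y).
Proof. by apply: quo_eq; rewrite opprD addrACA; apply: smemD; apply: quorepr_quo. Qed.
Lemma quo_oppE x : quo_opp (quo_fun x) = quo_fun (- x).
Proof. by apply: quo_eq; rewrite -opprD; apply: smemN; apply: quorepr_quo. Qed.
Lemma quo_scaleE a x : quo_scale a (quo_fun x) = quo_fun (a *: x).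
Proof. by apply: quo_eq; rewrite -scalerBr; apply: smemZ; apply: quorepr_quo. Qed.
Let quoE := (quo_addE, quo_oppE, quo_scaleE).

Program Definition quo_zmod := GRing.isZmodule.Build quomod
  (zero := quo_fun 0) (opp := quo_opp) (add := quo_add) _ _ _ _.
Next Obligation. by do 3!elim/quoP=> ?; rewrite !quoE addrA. Qed.
Next Obligation. by do 2!elim/quoP=> ?; rewrite !quoE addrC. Qed.
Next Obligation. by elim/quoP=> ?; rewrite !quoE add0r. Qed.
Next Obligation. by elim/quoP=> ?; rewrite !quoE addNr. Qed.
HB.instance Definition _ := quo_zmod.

Lemma quo_DE x y : quo_fun x + quo_fun y = quo_fun (x + y).
Proof. exact: quo_addE. Qed.

Program Definition quo_lmod := GRing.Zmodule_isLmodule.Build R quomod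
  (scale := quo_scale) _ _ _ _.
Next Obligation. by move=> a b; elim/quoP=> ?; rewrite !quoE scalerA. Qed.
Next Obligation. by elim/quoP=> ?; rewrite !quoE scale1r. Qed.
Next Obligation. by move=> a c d; elim/quoP: c => x; elim/quoP: d => y; rewrite quo_DE !quo_scaleE quo_DE scalerDr. Qed.
Next Obligation. by move=> v a b; elim/quoP: v => x; rewrite !quo_scaleE quo_DE scalerDl. Qed.
HB.instance Definition _ := quo_lmod.

Fact quo_linear : linear quo_fun.
Proof. by move=> a x y; rewrite -quo_DE; congr (_ + _); exact/esym/quo_scaleE. Qed.
Definition quo : {linear M -> quomod} := mklin quo_linear.

Lemma quo_surj c : exists x, quo x = c.
Proof. by exists (quorepr c); apply: quoreprK. Qed.

Lemma quo_eq0 x : quo x = 0 <-> N x.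
Proof.
by split=> [/quo_eqP|Nx]; rewrite ?subr0 //; apply: quo_eq; rewrite subr0.
Qed.

End QuotientModule.

Section DirectSum.
Variables (R : pzRingType) (I : eqType) (M : I -> lmodType R).

Definition dsum :=
  {f : forall i, M i | exists s : seq I, forall i, f i != 0 -> i \in s}.

Definition dsmk (f : forall i, M i)
  (fs : exists s : seq I, forall i, f i != 0 -> i \in s) : dsum := exist _ f fs.

HB.instance Definition _ := gen_eqMixin dsum.
HB.instance Definition _ := gen_choiceMixin dsum.

Lemma dsum_inj (f g : dsum) : (forall i, sval f i = sval g i) -> f = g.
Proof. by move=> fg; apply: eq_sval; apply: functional_extensionality_dep. Qed.

Lemma dsum_bin (h : forall i, M i -> M i -> M i) (f g : dsum) : (forall i, h i 0 0 = 0) ->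
  exists s : seq I, forall i, h i (sval f i) (sval g i) != 0 -> i \in s.
Proof.
case: f g => f [s fs] [g [t gs]] h0 /=; exists (s ++ t) => i; rewrite mem_cat.
have [fi|/fs -> //] := eqVneq (f i) 0; have [gi|/gs ->] := eqVneq (g i) 0.
  by rewrite fi gi h0 eqxx.
by rewrite orbT.
Qed.

Definition ds0 : dsum := exist _ (fun i => 0)
  (ex_intro _ [::] (fun i (n : 0 != 0) => False_ind _ (negP n (eqxx _)))).
Definition ds_add (f g : dsum) : dsum := exist _ (fun i => sval f i + sval g i)
  (dsum_bin (h := fun i x y => x + y) f g (fun i => addr0 0)).
Definition ds_opp (f : dsum) : dsum := exist _ (fun i => - sval f i)
  (dsum_bin (h := fun i x y => - x) f f (fun i => oppr0 _)).
Definition ds_scale (a : R) (f : dsum) : dsum := exist _ (fun i => a *: sval f i)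
  (dsum_bin (h := fun i x y => a *: x) f f (fun i => scaler0 _ _)).

Program Definition ds_zmod := GRing.isZmodule.Build dsum
  (zero := ds0) (opp := ds_opp) (add := ds_add) _ _ _ _.
Next Obligation. by move=> f g h; apply: dsum_inj => i /=; rewrite addrA. Qed.
Next Obligation. by move=> f g; apply: dsum_inj => i /=; rewrite addrC. Qed.
Next Obligation. by move=> f; apply: dsum_inj => i /=; rewrite add0r. Qed.
Next Obligation. by move=> f; apply: dsum_inj => i /=; rewrite addNr. Qed.
HB.instance Definition _ := ds_zmod.

Program Definition ds_lmod := GRing.Zmodule_isLmodule.Build R dsum
  (scale := ds_scale) _ _ _ _.
Next Obligation. by move=> a b f; apply: dsum_inj => i /=; rewrite scalerA. Qed.
Next Obligation. by move=> f; apply: dsum_inj => i /=; rewrite scale1r. Qed.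
Next Obligation. by move=> a f g; apply: dsum_inj => i /=; rewrite scalerDr. Qed.
Next Obligation. by move=> f a b; apply: dsum_inj => i /=; rewrite scalerDl. Qed.
HB.instance Definition _ := ds_lmod.

Definition dsproj_fun i (f : dsum) : M i := sval f i.
Fact dsproj_linear i : linear (@dsproj_fun i). Proof. by []. Qed.
Definition dsproj i : {linear dsum -> M i} := mklin (@dsproj_linear i).

Lemma dsumP (f g : dsum) : (forall i, dsproj i f = dsproj i g) -> f = g.
Proof. exact: dsum_inj. Qed.

Lemma dsin_subproof i (x : M i) :
  exists s : seq I, forall j, dfwith (fun k => 0 : M k) x j != 0 -> j \in s.
Proof.
by exists [:: i] => j; rewrite inE; case: dfwithP => [|k ik]; rewrite ?eqxx.
Qed.
Definition dsin_fun i (x : M i) : dsum := exist _ _ (dsin_subproof x).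
Fact dsin_linear i : linear (@dsin_fun i).
Proof.
move=> a x y; apply: dsum_inj => j /=; have [<-|ij] := eqVneq i j.
  by rewrite !dfwith_in.
by rewrite !dfwith_out // scaler0 addr0.
Qed.
Definition dsin i : {linear M i -> dsum} := mklin (@dsin_linear i).

Lemma dsproj_in i (x : M i) : dsproj i (dsin i x) = x.
Proof. exact: dfwith_in. Qed.
Lemma dsproj_out i j (x : M i) : i != j -> dsproj j (dsin i x) = 0.
Proof. exact: dfwith_out. Qed.

Definition supports (s : seq I) (f : dsum) :=
  uniq s /\ forall i, dsproj i f != 0 -> i \in s.

Lemma supportsP (f : dsum) : exists s, supports s f.
Proof.
case: f => f [s fs]; exists (undup s); split; first exact: undup_uniq.
by move=> i /fs; rewrite mem_undup.
Qed.

Section Copair.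
Variables (L : lmodType R) (phi : forall i, {linear M i -> L}).

(** The sum runs over an arbitrary duplicate-free list that contains the support
    of [f]; by [copairE] the choice is immaterial. *)
Definition copair_fun (f : dsum) : L :=
  \sum_(i <- sval (cid (supportsP f))) phi i (dsproj i f).

Lemma copairE s f : supports s f -> copair_fun f = \sum_(i <- s) phi i (dsproj i f).
Proof.
rewrite /copair_fun; case: cid => t /= [tu ft] [su fs].
have red (r : seq I) : \sum_(i <- r) phi i (dsproj i f)
    = \sum_(i <- [seq i <- r | dsproj i f != 0]) phi i (dsproj i f).
  rewrite big_filter [in RHS]big_mkcond; apply: eq_bigr => i _.
  by case: eqP => //= ->; rewrite linear0.
rewrite red [RHS]red; apply: perm_big; apply: uniq_perm; rewrite ?filter_uniq //.
move=> i; rewrite !mem_filter; case: (boolP (dsproj i f == 0)) => //= fi.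
by rewrite ft // fs.
Qed.

Lemma supports_sub s t f : supports s f -> uniq t -> {subset s <= t} -> supports t f.
Proof. by move=> [_ fs] tu st; split=> // i /fs /st. Qed.

Fact copair_linear : linear copair_fun.
Proof.
move=> a f g; have [s sf] := supportsP f; have [t tg] := supportsP g.
have uu := undup_uniq (s ++ t).
have sf' : supports (undup (s ++ t)) f.
  by apply: supports_sub sf uu _ => i si; rewrite mem_undup mem_cat si.
have tg' : supports (undup (s ++ t)) g.
  by apply: supports_sub tg uu _ => i si; rewrite mem_undup mem_cat si orbT.
rewrite (copairE sf') (copairE tg') (@copairE (undup (s ++ t))).
  rewrite scaler_sumr -big_split; apply: eq_bigr => i _ /=.
  by rewrite !linearP.
split=> // i; rewrite linearP; have [->|/sf'.2 //] := eqVneq (dsproj i f) 0.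
by rewrite scaler0 add0r; apply: tg'.2.
Qed.
Definition copair : {linear dsum -> L} := mklin copair_linear.

Lemma copair_in i (x : M i) : copair (dsin i x) = phi i x.
Proof.
rewrite mklinE (@copairE [:: i]); first by rewrite big_seq1 dsproj_in.
split=> // j; rewrite inE; have [//|ji] := eqVneq j i.
by rewrite dsproj_out ?eqxx // eq_sym.
Qed.

End Copair.

Lemma dsum_decomp s f : supports s f -> f = \sum_(i <- s) dsin i (dsproj i f).
Proof.
move=> [su fs]; apply: dsumP => j; rewrite linear_sum.
have [js|/negP js] := boolP (j \in s).
  rewrite (bigD1_seq j) // big1 => [|i ij]; last by rewrite dsproj_out.
  by rewrite dsproj_in; apply/esym/addr0.
have [->|/fs //] := eqVneq (dsproj j f) 0; rewrite big_seq big1 // => i si.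
by rewrite dsproj_out //; apply: contra_notN js => /eqP <-.
Qed.

Lemma dsum_ext (L : lmodType R) (f g : {linear dsum -> L}) :
  (forall i x, f (dsin i x) = g (dsin i x)) -> forall x, f x = g x.
Proof.
move=> fg x; have [s /dsum_decomp ->] := supportsP x.
by rewrite !linear_sum; apply: eq_bigr.
Qed.

End DirectSum.

Arguments dsproj {R I M} i : simpl never.
Arguments dsin {R I M} i : simpl never.
Arguments copair : simpl never.

(** * Complexes *)

Lemma int_succ (P : int -> Prop) : (forall n, P (n + 1)) -> forall n, P n.
Proof. by move=> PS n; rewrite -(subrK 1 n). Qed.

Section Complexes.
Context {k : comPzRingType} {A : kalg k}.
Implicit Types X Y Z K P E B : complex A.

Section Cast.
Variable X : complex A.

(** Terms of [X] in provably equal degrees have different types; every change of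
    degree goes through this transport. *)
Definition castx m n (e : m = n) : {linear X m -> X n} :=
  eq_rect m (fun j => {linear X m -> X j}) idfun n e.

Lemma castx_id m (e : m = m) x : castx e x = x.
Proof. by rewrite (eq_irrelevance e erefl). Qed.

Lemma castx_comp m n p (e : m = n) (f : n = p) (g : m = p) x :
  castx f (castx e x) = castx g x.
Proof. by case: p / f g => g; rewrite castx_id (eq_irrelevance e g). Qed.

Lemma castxK m n (e : m = n) (f : n = m) x : castx f (castx e x) = x.
Proof. by rewrite (castx_comp e f erefl). Qed.

Lemma castx_d m n (e : m = n) (f : m + 1 = n + 1) x :
  cdiff X n (castx e x) = castx f (cdiff X m x).
Proof. by case: n / e f => f; rewrite !castx_id. Qed.

End Cast.

Lemma castx_nat X Y (u : forall n, X n -> Y n) m n (e : m = n) x :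
  u n (castx X e x) = castx Y e (u m x).
Proof. by case: n / e; rewrite !castx_id. Qed.

(** Boundaries in every degree; the cast hides that [m] need not be
    syntactically a successor. *)
Definition bdry X m (x : X m) : Prop :=
  exists n (e : n + 1 = m) (y : X n), x = castx X e (cdiff X n y).

Lemma bdryS X n (x : X (n + 1)) : bdry x <-> exists y, x = cdiff X n y.
Proof.
split=> [[m [e [y ->]]]|[y ->]]; last by exists n, erefl, y; rewrite castx_id.
have e' : m = n by apply: (addIr 1).
by exists (castx X e' y); rewrite (castx_d _ e).
Qed.

Lemma bdry_d X n (y : X n) : bdry (cdiff X n y).
Proof. by apply/bdryS; exists y. Qed.

Lemma bdry_lin X m a (x y : X m) : bdry x -> bdry y -> bdry (a *: x + y).
Proof.
move=> [n [e [x' ->]]] [n' [e' [y' ->]]].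
have en : n' = n by apply: (addIr 1); rewrite e.
case: n / en e x' => e x'; exists n', e', (a *: x' + y').
by rewrite !linearP (eq_irrelevance e e').
Qed.

Lemma bdry0 X m : bdry (0 : X m).
Proof. by move: m; apply: int_succ => n; apply/bdryS; exists 0; rewrite linear0. Qed.

Definition bdrymod X m : submodule (X m) := Submodule (bdry0 X m) (@bdry_lin X m).

Lemma bdryD X m (x y : X m) : bdry x -> bdry y -> bdry (x + y).
Proof. exact: (smemD (N := bdrymod X m)). Qed.
Lemma bdryN X m (x : X m) : bdry x -> bdry (- x).
Proof. exact: (smemN (N := bdrymod X m)). Qed.
Lemma bdry_map X Y (f : chmap X Y) m (x : X m) : bdry x -> bdry (f m x).
Proof.
move=> [n [e [y ->]]]; exists n, e, (f n y).
by rewrite (castx_nat (fun n => f n)) cmapE.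
Qed.

Lemma bdry_cycle X m (x : X m) : bdry x -> cdiff X m x = 0.
Proof.
move=> [n [e [y ->]]]; rewrite (castx_d e (congr1 (+%R^~ 1) e)) cdiffK.
by rewrite linear0.
Qed.

Definition acyclic K := forall n (x : K n), cdiff K n x = 0 -> bdry x.

Lemma qisP X Y (f : chmap X Y) : quasi_iso f <->
  (forall n (x : X n), cdiff X n x = 0 -> bdry (f n x) -> bdry x) /\
  (forall n (y : Y n), cdiff Y n y = 0 ->
     exists x : X n, cdiff X n x = 0 /\ bdry (y - f n x)).
Proof.
split=> [[fi fs]|[fi fs]]; split.
- apply: int_succ => n x dx /bdryS fx; apply/bdryS.
  by have [x' ->] := fi _ _ dx fx; exists x'.
- apply: int_succ => n y dy; have [x [dx [y' yE]]] := fs _ _ dy.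
  by exists x; split=> //; apply/bdryS; exists y'.
- move=> n x dx fx; apply/bdryS; apply: fi => //; exact/bdryS.
- move=> n y dy; have [x [dx /bdryS [y' yE]]] := fs _ _ dy.
  by exists x; split=> //; exists y'.
Qed.

Lemma qis_bij X Y (f : chmap X Y) (g : forall n, Y n -> X n) :
  (forall n, cancel (f n) (g n)) -> (forall n, cancel (g n) (f n)) -> quasi_iso f.
Proof.
move=> fK gK; have fI n := can_inj (fK n); apply/qisP; split.
- apply: int_succ => n x _ /bdryS [y fx]; apply/bdryS; exists (g n y).
  by apply: fI; rewrite cmapE gK.
- move=> n y dy; exists (g n y); rewrite gK subrr; split; last exact: bdry0.
  by apply: fI; rewrite cmapE gK dy linear0.
Qed.

Lemma qis_comp X Y Z (g : chmap Y Z) (f : chmap X Y) :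
  quasi_iso g -> quasi_iso f -> quasi_iso (chcomp g f).
Proof.
move=> /qisP [gi gs] /qisP [fi fs]; apply/qisP; split=> n.
  by move=> x dx /= bx; apply: fi => //; apply: gi => //; rewrite -cmapE dx linear0.
move=> z dz; have [y [dy bz]] := gs _ _ dz; have [x [dx by_]] := fs _ _ dy.
exists x; split=> //=; rewrite -(subrK (g n y) z) -addrA -linearB.
by apply: bdryD => //; apply: bdry_map.
Qed.

Lemma qis_cancel_right X Y Z (g : chmap Y Z) (f : chmap X Y) :
  quasi_iso f -> quasi_iso (chcomp g f) -> quasi_iso g.
Proof.
move=> /qisP [fi fs] /qisP [gi gs]; apply/qisP; split=> n.
  move=> y dy gy; have [x [dx yx]] := fs _ _ dy.
  suff: bdry (f n x) by move=> /(bdryD yx); rewrite subrK.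
  apply: bdry_map; apply: gi => //=; rewrite -(subrK (g n y) (g n (f n x))) -linearB.
  by apply: bdryD => //; apply: bdry_map; rewrite -opprB; apply: bdryN.
move=> z dz; have [x [dx bz]] := gs _ _ dz; exists (f n x); split=> //.
by rewrite -cmapE dx linear0.
Qed.

Lemma qis_acyclic X Y (f : chmap X Y) : acyclic X -> acyclic Y -> quasi_iso f.
Proof.
move=> aX aY; apply/qisP; split=> n; first by move=> x dx _; apply: aX.
by move=> y dy; exists 0; split; rewrite linear0 // subr0; apply: aY.
Qed.

(** ** Desuspension, and the contractible complex that maps onto a given one *)

Section Unshift.
Variable X : complex A.

Fact unshift_eq (n : int) : n - 1 + 1 = n + 1 - 1.
Proof. by rewrite subrK addrK. Qed.

(** The sign compensates the one in the differential of [cshift]. *)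
Definition unshift_d (n : int) : {linear X (n - 1) -> X (n + 1 - 1)} :=
  \- (castx X (unshift_eq n) \o cdiff X (n - 1)).

Fact unshift_dK n x : unshift_d (n + 1) (unshift_d n x) = 0.
Proof.
rewrite /unshift_d /= !linearN /= opprK.
rewrite (castx_d _ (congr1 (+%R^~ 1) (unshift_eq n))) cdiffK.
by rewrite !linear0.
Qed.

Definition unshift : complex A := Complex unshift_dK.

Fact shiftK_subproof n x :
  castx X (addrK 1 (n + 1)) (cdiff (cshift unshift) n x)
    = cdiff X n (castx X (addrK 1 n) x).
Proof.
rewrite /= /unshift_d /= opprK (castx_d _ (congr1 (+%R^~ 1) (addrK 1 n))).
exact: castx_comp.
Qed.
Definition shiftK : chmap (cshift unshift) X := ChMap shiftK_subproof.

Lemma shiftK_surj n y : exists x, shiftK n x = y.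
Proof. by exists (castx X (esym (addrK 1 n)) y); apply: castxK. Qed.

End Unshift.

Section UnshiftShift.
Variable X : complex A.

Fact unshiftK_subproof n (x : unshift (cshift X) n) :
  castx X (subrK 1 (n + 1)) (cdiff (unshift (cshift X)) n x)
    = cdiff X n (castx X (subrK 1 n) x).
Proof.
rewrite /= /unshift_d /= linearN.
have -> m p (e : m = p) y : castx (cshift X) e y = castx X (congr1 (+%R^~ 1) e) y.
  by case: p / e; rewrite !castx_id.
have e1 := congr1 (+%R^~ 1) (subrK 1 n); rewrite (castx_d _ e1).
by rewrite (castx_comp _ _ e1) linearN opprK.
Qed.
Definition unshiftK : chmap (unshift (cshift X)) X := ChMap unshiftK_subproof.

Lemma unshiftK_qis : quasi_iso unshiftK.
Proof.
apply: (@qis_bij _ X unshiftK (fun n y => castx X (esym (subrK 1 n)) y)) => n x;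
  by rewrite /= castxK.
Qed.

End UnshiftShift.

Fact chunshift_subproof X Y (f : chmap X Y) n (x : unshift X n) :
  f (n + 1 - 1) (cdiff (unshift X) n x) = cdiff (unshift Y) n (f (n - 1) x).
Proof.
by rewrite /= /unshift_d /= linearN (castx_nat (fun n => f n)) cmapE.
Qed.
Definition chunshift X Y (f : chmap X Y) : chmap (unshift X) (unshift Y) :=
  @ChMap _ _ (unshift X) (unshift Y) (fun n => f (n - 1)) (chunshift_subproof f).

Lemma bdry_unshift X n (x : X (n - 1)) : @bdry (unshift X) n x <-> @bdry X (n - 1) x.
Proof.
move: n x; apply: int_succ => n x.
have cE y : castx X (unshift_eq n) (cdiff X (n - 1) (- y)) = cdiff (unshift X) n y.
  by rewrite /= /unshift_d /= !linearN.
split=> [/bdryS [y ->]|[m [e [y ->]]]].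
  by exists (n - 1), (unshift_eq n), (- y); rewrite cE.
have em : m = n - 1 by apply: (addIr 1); rewrite e addrK subrK.
apply/bdryS; exists (- castx X em y).
rewrite -cE opprK (castx_d _ (congr1 (+%R^~ 1) em)).
by rewrite (castx_comp _ _ e).
Qed.

Lemma qis_unshift X Y (f : chmap X Y) : quasi_iso f -> quasi_iso (chunshift f).
Proof.
have dE Z n (x : Z (n - 1)) : cdiff (unshift Z) n x = 0 <-> cdiff Z (n - 1) x = 0.
  rewrite /= /unshift_d /=; split=> [/eqP|->]; last by rewrite linear0 oppr0.
  rewrite oppr_eq0 => /eqP /(congr1 (castx Z (esym (unshift_eq n)))).
  by rewrite castxK linear0.
move=> /qisP [fi fs]; apply/qisP; split=> n.
  by move=> x /dE dx /bdry_unshift bx; apply/bdry_unshift; apply: fi.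
move=> y /dE /fs [x [dx bx]]; exists x; split; first exact/dE.
exact/bdry_unshift.
Qed.

Lemma cone_id_acyclic X : acyclic (cone (chid X)).
Proof.
apply: int_succ => n [a b] /= [_ ab]; apply/bdryS; exists (b, 0).
rewrite /= /cone_diff /= linear0 addr0; congr pair.
by apply/eqP; rewrite -addr_eq0; apply/eqP.
Qed.

(** [disk X] is contractible and maps onto [X].  Adding it to the source turns an
    arbitrary map into a surjective one without changing its homology. *)
Definition disk X : complex A := cone (chid (unshift X)).
Definition disk_proj X : chmap (disk X) X :=
  chcomp (shiftK X) (cone_proj (chid (unshift X))).

Lemma disk_proj_surj X n (y : X n) : exists x, disk_proj X n x = y.
Proof. by have [x <-] := shiftK_surj y; exists (x, 0). Qed.

Lemma disk_acyclic X : acyclic (disk X).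
Proof. exact: cone_id_acyclic. Qed.

(** ** Products of two complexes and subcomplexes *)

Section CSum.
Variables X Y : complex A.

Definition csum_obj (n : int) : rmodType A := (X n * Y n)%type.
Definition csum_diff_fun n (p : csum_obj n) : csum_obj (n + 1) :=
  (cdiff X n p.1, cdiff Y n p.2).
Fact csum_diff_linear n : linear (@csum_diff_fun n).
Proof. by move=> a p q; rewrite /csum_diff_fun /= !linearP. Qed.
Fact csum_diffK n (p : csum_obj n) :
  mklin (@csum_diff_linear (n + 1)) (mklin (@csum_diff_linear n) p) = 0.
Proof. by rewrite !mklinE /csum_diff_fun /= !cdiffK. Qed.
Definition csum : complex A := Complex csum_diffK.

Lemma csum_acyclic : acyclic X -> acyclic Y -> acyclic csum.
Proof.
move=> aX aY; apply: int_succ => n [x y] [/aX /bdryS [x' ->] /aY /bdryS [y' ->]].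
by apply/bdryS; exists (x', y').
Qed.

Definition csum_inl_fun n (x : X n) : csum n := (x, 0).
Fact csum_inl_linear n : linear (@csum_inl_fun n).
Proof. by move=> a x y; rewrite /csum_inl_fun; congr pair; rewrite /= scaler0 addr0. Qed.
Fact csum_inl_subproof n x : mklin (@csum_inl_linear (n + 1)) (cdiff X n x) =
  cdiff csum n (mklin (@csum_inl_linear n) x).
Proof. by rewrite -[RHS]/(cdiff X n x, cdiff Y n 0) linear0. Qed.
Definition csum_inl : chmap X csum := ChMap csum_inl_subproof.

Lemma csum_inl_qis : acyclic Y -> quasi_iso csum_inl.
Proof.
move=> aY; apply/qisP; split; apply: int_succ => n.
  by move=> x _ /bdryS [[x' y'] [xE _]]; apply/bdryS; exists x'.
move=> [x y] [dx /aY /bdryS [y' yE]]; exists x; split=> //; apply/bdryS.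
exists (0, y'); rewrite -[RHS]/(cdiff X n 0, cdiff Y n y') linear0 -yE.
by congr pair; rewrite /= ?subrr ?subr0.
Qed.

Section Maps.
Variable Z : complex A.

Definition csum_copair_fun (f : chmap X Z) (g : chmap Y Z) n (p : csum n) : Z n :=
  f n p.1 + g n p.2.
Fact csum_copair_linear f g n : linear (@csum_copair_fun f g n).
Proof. by move=> a p q; rewrite /csum_copair_fun /= !linearP /= scalerDr addrACA. Qed.
Fact csum_copair_subproof f g n p :
  mklin (@csum_copair_linear f g (n + 1)) (cdiff csum n p)
    = cdiff Z n (mklin (@csum_copair_linear f g n) p).
Proof.
rewrite -[LHS]/(f (n + 1) (cdiff X n p.1) + g (n + 1) (cdiff Y n p.2)).
by rewrite !cmapE -linearD.
Qed.
Definition csum_copair f g : chmap csum Z := ChMap (csum_copair_subproof f g).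

Definition csum_pair_fun (f : chmap Z X) (g : chmap Z Y) n (z : Z n) : csum n :=
  (f n z, g n z).
Fact csum_pair_linear f g n : linear (@csum_pair_fun f g n).
Proof. by move=> a p q; rewrite /csum_pair_fun /= !linearP. Qed.
Fact csum_pair_subproof f g n z :
  mklin (@csum_pair_linear f g (n + 1)) (cdiff Z n z)
    = cdiff csum n (mklin (@csum_pair_linear f g n) z).
Proof.
by rewrite -[LHS]/(f (n + 1) (cdiff Z n z), g (n + 1) (cdiff Z n z)) !cmapE.
Qed.
Definition csum_pair f g : chmap Z csum := ChMap (csum_pair_subproof f g).
End Maps.

Definition csum_fst_fun n (p : csum n) : X n := p.1.
Fact csum_fst_linear n : linear (@csum_fst_fun n). Proof. by []. Qed.
Definition csum_fst : chmap csum X :=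
  @ChMap _ _ csum X (fun n => mklin (@csum_fst_linear n)) (fun n p => erefl).
Definition csum_snd_fun n (p : csum n) : Y n := p.2.
Fact csum_snd_linear n : linear (@csum_snd_fun n). Proof. by []. Qed.
Definition csum_snd : chmap csum Y :=
  @ChMap _ _ csum Y (fun n => mklin (@csum_snd_linear n)) (fun n p => erefl).

End CSum.

Definition chneg X Y (f : chmap X Y) : chmap X Y := chscale (-1) f.

Lemma chnegE X Y (f : chmap X Y) n x : chneg f n x = - f n x.
Proof. by rewrite /= /kact rmorphN rmorph1 scaleN1r. Qed.

Section SubComplex.
Variables (X : complex A) (N : forall n, submodule (X n)).
Hypothesis dN : forall n x, N n x -> N (n + 1) (cdiff X n x).

Definition subcx_diff n : {linear submod (N n) -> submod (N (n + 1))} :=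
  corestr (f := cdiff X n \o subval (N n)) (fun x => dN (svalP x)).
Fact subcx_diffK n x : subcx_diff (n + 1) (subcx_diff n x) = 0.
Proof. by apply: submod_inj; rewrite /= cdiffK. Qed.
Definition subcx : complex A := Complex subcx_diffK.

Definition subcx_incl : chmap subcx X :=
  @ChMap _ _ subcx X (fun n => subval (N n)) (fun n x => erefl).

Fact subcx_lift_subproof Y (f : chmap Y X) (fN : forall n y, N n (f n y)) n y :
  corestr (fN (n + 1)) (cdiff Y n y) = cdiff subcx n (corestr (fN n) y).
Proof. by apply: submod_inj; rewrite /= cmapE. Qed.
Definition subcx_lift Y (f : chmap Y X) fN : chmap Y subcx :=
  @ChMap _ _ Y subcx (fun n => corestr (fN n)) (@subcx_lift_subproof Y f fN).

End SubComplex.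

Section QuotComplex.
Variables (X : complex A) (N : forall n, submodule (X n)).
Hypothesis dN : forall n x, N n x -> N (n + 1) (cdiff X n x).

Definition quocx_diff_fun n (c : quomod (N n)) : quomod (N (n + 1)) :=
  quo _ (cdiff X n (quorepr c)).
Lemma quocx_diffE n x : quocx_diff_fun (quo (N n) x) = quo _ (cdiff X n x).
Proof. by apply: quo_eq; rewrite -linearB; apply: dN; apply: quorepr_quo. Qed.
Fact quocx_diff_linear n : linear (@quocx_diff_fun n).
Proof.
move=> a c d; have [x <-] := quo_surj c; have [y <-] := quo_surj d.
by rewrite -linearP !quocx_diffE !linearP.
Qed.
Fact quocx_diffK n c :
  mklin (@quocx_diff_linear (n + 1)) (mklin (@quocx_diff_linear n) c) = 0.
Proof.
by have [x <-] := quo_surj c; rewrite !mklinE !quocx_diffE cdiffK linear0.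
Qed.
Definition quocx : complex A := Complex quocx_diffK.
Fact quocx_proj_subproof n x : quo (N (n + 1)) (cdiff X n x) = cdiff quocx n (quo (N n) x).
Proof. exact/esym/quocx_diffE. Qed.
Definition quocx_proj : chmap X quocx := 
  @ChMap _ _ X quocx (fun n => quo (N n)) quocx_proj_subproof.
End QuotComplex.

Section Kernel.
Variables (X Y : complex A) (p : chmap X Y).

Program Definition kermod n : submodule (X n) :=
  @Submodule _ _ (fun x => p n x = 0) _ _.
Next Obligation. by move=> n; exact: linear0. Qed.
Next Obligation. by move=> n a x y /=; rewrite linearP => -> ->; rewrite scaler0 addr0. Qed.

Fact kercx_subproof n x : kermod n x -> kermod (n + 1) (cdiff X n x).
Proof. by rewrite /= cmapE => ->; rewrite linear0. Qed.
Definition kercx : complex A := subcx kercx_subproof.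

(** A preimage of a cycle of the kernel under the differential is corrected by a
    cycle and then by a boundary until it lies in the kernel. *)
Lemma kercx_acyclic : quasi_iso p -> (forall n y, exists x, p n x = y) ->
  acyclic kercx.
Proof.
move=> [pi ps] psurj; apply: int_succ => n; move: n; apply: int_succ => n; move=> [x px] /(congr1 sval) /= dx.
have [|x' xE] := pi _ _ dx; first by exists 0; rewrite linear0.
have [|z [dz [b zE]]] := ps _ (p _ x'); first by rewrite -cmapE -xE.
have [e eE] := psurj _ b; apply/bdryS.
have kx : p _ (x' - z - cdiff X _ e) = 0 by rewrite !linearB cmapE eE zE subrr.
exists (submk (N := kermod _) kx); apply: submod_inj.
by rewrite /= !linearB cdiffK dz !subr0.
Qed.

End Kernel.

(** ** Direct sums of complexes *)

Section DSumLift.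
Variables (R : pzRingType) (I : eqType) (M N : I -> lmodType R).

(** Components of an element of a direct sum may be chosen independently: finite
    support is kept by choosing [0] over [0]. *)
Lemma dsum_choice (Q : forall i, M i -> N i -> Prop) (x : dsum M) :
  (forall i, exists y, Q i (dsproj i x) y) -> (forall i, Q i 0 0) ->
  exists y : dsum N, forall i, Q i (dsproj i x) (dsproj i y).
Proof.
move=> Qx Q0; have Qx' i : exists y, Q i (dsproj i x) y /\ (dsproj i x = 0 -> y = 0).
  have [xi|xi] := pselect (dsproj i x = 0); first by exists 0; rewrite xi.
  by have [y Qy] := Qx i; exists y.
have sy : exists s : seq I, forall i, sval (cid (Qx' i)) != 0 -> i \in s.
  have [s [_ sx]] := supportsP x; exists s => i; case: cid => y /= [_ y0] yn0.
  by apply: sx; apply: contra_neq yn0; apply: y0.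
exists (dsmk sy) => i; have [] := svalP (cid (Qx' i)).
by rewrite -[dsproj i (dsmk sy)]/(sval (cid (Qx' i))).
Qed.

Definition dsmap (f : forall i, {linear M i -> N i}) : {linear dsum M -> dsum N} :=
  copair (fun i => (dsin i : {linear N i -> dsum N}) \o f i).

Lemma dsmap_in f i x : dsmap f (dsin i x) = dsin i (f i x).
Proof. exact: copair_in. Qed.

Lemma dsmap_proj f i x : dsproj i (dsmap f x) = f i (dsproj i x).
Proof.
apply: (dsum_ext (f := dsproj i \o dsmap f) (g := f i \o dsproj i)) => j y.
rewrite -[LHS]/(dsproj i (dsmap f (dsin j y))) -[RHS]/(f i (dsproj i (dsin j y))).
rewrite dsmap_in.
have [<-|ij] := eqVneq j i; first by rewrite !dsproj_in.
by rewrite !dsproj_out // linear0.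
Qed.
End DSumLift.

Section DSumComplex.
Variables (I : eqType) (X : I -> complex A).

Fact dsumc_diffK n (x : dsum (fun i => X i n)) :
  dsmap (fun i => cdiff (X i) (n + 1)) (dsmap (fun i => cdiff (X i) n) x) = 0.
Proof. by apply: dsumP => i; rewrite !dsmap_proj cdiffK linear0. Qed.
Definition dsumc : complex A :=
  @Complex _ _ (fun n => dsum (fun i => X i n)) (fun n => dsmap (fun i => cdiff (X i) n))
    dsumc_diffK.

Fact dscproj_subproof i n (x : dsumc n) :
  dsproj i (cdiff dsumc n x) = cdiff (X i) n (dsproj i x).
Proof. exact: dsmap_proj. Qed.
Definition dscproj i : chmap dsumc (X i) :=
  @ChMap _ _ dsumc (X i) (fun n => dsproj i) (@dscproj_subproof i).

Fact dscin_subproof i n (x : X i n) :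
  dsin i (cdiff (X i) n x) = cdiff dsumc n (dsin i x).
Proof. exact/esym/dsmap_in. Qed.
Definition dscin i : chmap (X i) dsumc :=
  @ChMap _ _ (X i) dsumc (fun n => dsin i) (@dscin_subproof i).

Lemma dsc_acyclic : (forall i, acyclic (X i)) -> acyclic dsumc.
Proof.
move=> aX; apply: int_succ => n x dx.
have [i|i|y yE] := @dsum_choice _ _ (fun i => X i (n + 1)) (fun i => X i n)
  (fun i x y => x = cdiff (X i) n y) x.
- apply/bdryS; apply: aX.
  by rewrite -[LHS]/(cdiff (X i) (n + 1) (dscproj i _ x)) -cmapE dx linear0.
- by rewrite linear0.
apply/bdryS; exists y; apply: dsumP => i; rewrite yE.
exact: (esym (dscproj_subproof i y)).
Qed.

Fact dscopair_subproof (Y : complex A) (f : forall i, chmap (X i) Y) n x :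
  copair (fun i => f i (n + 1)) (cdiff dsumc n x)
    = cdiff Y n (copair (fun i => f i n) x).
Proof.
apply: (dsum_ext (f := copair (fun i => f i (n + 1)) \o cdiff dsumc n)
                 (g := cdiff Y n \o copair (fun i => f i n))) => i y.
rewrite -[LHS]/(copair _ (dsmap _ (dsin i y))) -[RHS]/(cdiff Y n (copair _ (dsin i y))).
by rewrite dsmap_in !copair_in cmapE.
Qed.
Definition dscopair (Y : complex A) (f : forall i, chmap (X i) Y) : chmap dsumc Y :=
  @ChMap _ _ dsumc Y (fun n => copair (fun i => f i n)) (dscopair_subproof f).

Lemma dscopair_in (Y : complex A) (f : forall i, chmap (X i) Y) i n x :
  dscopair f n (dscin i n x) = f i n x.
Proof. exact: (copair_in (fun i => f i n)). Qed.

End DSumComplex.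

Section DSumMap.
Variables (I : eqType) (X Y : I -> complex A) (f : forall i, chmap (X i) (Y i)).

Fact dscmap_subproof n x :
  dsmap (fun i => f i (n + 1)) (cdiff (dsumc X) n x)
    = cdiff (dsumc Y) n (dsmap (fun i => f i n) x).
Proof. by apply: dsumP => i; rewrite !dsmap_proj cmapE. Qed.
Definition dscmap : chmap (dsumc X) (dsumc Y) :=
  @ChMap _ _ (dsumc X) (dsumc Y) (fun n => dsmap (fun i => f i n)) dscmap_subproof.

Lemma dscmap_proj i n x : dscproj Y i n (dscmap n x) = f i n (dscproj X i n x).
Proof. exact: (dsmap_proj (fun i => f i n)). Qed.

Lemma dscmap_in i n x : dscmap n (dscin X i n x) = dscin Y i n (f i n x).
Proof. exact: (dsmap_in (fun i => f i n)). Qed.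

Lemma dscmap_qis : (forall i, quasi_iso (f i)) -> quasi_iso dscmap.
Proof.
move=> qf; split=> n.
  move=> x dx [y fx].
  have [i|i|x' xE] := @dsum_choice _ _ (fun i => X i (n + 1)) (fun i => X i n)
    (fun i x y => x = cdiff (X i) n y) x.
  - have [fi _] := qf i; apply: fi.
      by rewrite -[LHS]/(cdiff _ _ (dscproj X i _ x)) -cmapE dx linear0.
    exists (dscproj Y i n y); rewrite -[LHS]/(f i _ (dscproj X i _ x)).
    by rewrite -dscmap_proj fx cmapE.
  - by rewrite linear0.
  by exists x'; apply: dsumP => i; rewrite xE; exact: (esym (dscproj_subproof i x')).
move=> y dy.
have [i|i|x xE] := @dsum_choice _ _ (fun i => Y i (n + 1)) (fun i => X i (n + 1))
    (fun i y x => cdiff (X i) _ x = 0 /\ exists y', y - f i _ x = cdiff (Y i) n y') y.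
- have [_ fs] := qf i; apply: fs.
  by rewrite -[LHS]/(cdiff _ _ (dscproj Y i _ y)) -cmapE dy linear0.
- by split; first exact: linear0; exists 0; rewrite (linear0 (f i _)) subr0 linear0.
exists x; split; first by apply: dsumP => i; rewrite [RHS]linear0; have [<- _] := xE i; exact: dscproj_subproof.
have [i|i|y' yE] := @dsum_choice _ _ (fun i => Y i (n + 1)) (fun i => Y i n)
    (fun i y y' => y = cdiff (Y i) n y') (y - dscmap _ x).
- have [_ [y' yE]] := xE i; exists y'; rewrite -yE linearB; congr (_ - _).
  exact: (dscmap_proj i x).
- by rewrite linear0.
by exists y'; apply: dsumP => i; rewrite yE; exact: (esym (dscproj_subproof i y')).
Qed.

End DSumMap.

(** ** Homotopies *)

(** Chain maps are compared up to maps that factor through an acyclic complex.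
    Such maps vanish in the derived category because acyclic complexes do, and
    for a cofibrant source they are the nullhomotopic ones. *)
Definition heq X Y (u v : chmap X Y) : Prop :=
  exists K, acyclic K /\ exists (w : chmap X K) (t : chmap K Y),
    forall n x, u n x = v n x + t n (w n x).

Definition homotopic X Y (u v : chmap X Y) : Prop :=
  exists h : forall n, {linear X (n + 1) -> Y n},
    forall n x, u (n + 1) x = v (n + 1) x
      + (cdiff Y n (h n x) + h (n + 1) (cdiff X (n + 1) x)).

Lemma heq_ext X Y (u v : chmap X Y) : (forall n x, u n x = v n x) -> heq u v.
Proof.
move=> uv; exists (disk Y); split; first exact: disk_acyclic.
by exists (chzero _ _), (chzero _ _) => n x; rewrite uv /= addr0.
Qed.

Lemma heq_sym X Y (u v : chmap X Y) : heq u v -> heq v u.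
Proof.
move=> [K [aK [w [t uv]]]]; exists K; split=> //; exists (chneg w), t => n x.
by rewrite uv chnegE linearN addrK.
Qed.

Lemma heq_add X Y (u u' v v' : chmap X Y) :
  heq u u' -> heq v v' -> heq (chadd u v) (chadd u' v').
Proof.
move=> [K [aK [w [t uE]]]] [L [aL [w' [t' vE]]]].
exists (csum K L); split; first exact: csum_acyclic.
exists (csum_pair w w'), (csum_copair t t') => n x.
by rewrite /= uE vE addrACA.
Qed.

Lemma heq_trans X Y (u v w : chmap X Y) : heq u v -> heq v w -> heq u w.
Proof.
move=> [K [aK [a [b uE]]]] [L [aL [a' [b' vE]]]].
exists (csum K L); split; first exact: csum_acyclic.
exists (csum_pair a a'), (csum_copair b b') => n x.
by rewrite uE vE /= -addrA [X in _ + X]addrC.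
Qed.

Lemma heq_compl X Y Z (g : chmap Y Z) (u v : chmap X Y) :
  heq u v -> heq (chcomp g u) (chcomp g v).
Proof.
move=> [K [aK [a [b uE]]]]; exists K; split=> //; exists a, (chcomp g b) => n x.
by rewrite /= uE linearD.
Qed.

Lemma heq_scale X Y c (u v : chmap X Y) : heq u v -> heq (chscale c u) (chscale c v).
Proof.
move=> [K [aK [a [b uE]]]]; exists K; split=> //; exists a, (chscale c b) => n x.
by rewrite /= uE linearD.
Qed.

(** A homotopy is a map out of the cone of the identity of the source. *)
Lemma homotopic_heq X Y (u v : chmap X Y) : homotopic u v -> heq u v.
Proof.
move=> [h uE]; exists (cone (chid X)); split; first exact: cone_id_acyclic.
have [D Dd DE] : exists2 D : forall n, {linear X n -> Y n},
    forall n x, D (n + 1) (cdiff X n x) = cdiff Y n (D n x) &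
    forall n x, D n x = u n x - v n x.
  by exists (fun n => u n \- v n) => // n x; rewrite /= !cmapE linearB.
pose t_fun n (p : cone (chid X) n) : Y n := h n p.1 + D n p.2.
have t_lin n : linear (@t_fun n).
  by move=> a p q; rewrite /t_fun !linearP scalerDr addrACA.
have tE n p : mklin (t_lin (n + 1)) (cdiff (cone (chid X)) n p)
    = cdiff Y n (mklin (t_lin n) p).
  case: p => a b; rewrite !mklinE /t_fun /= linearN !linearD /= Dd.
  by rewrite DE uE [v _ _ + _]addrC addrK [_ + h _ _]addrC addrA addKr.
exists (cone_inl (chid X)), (@ChMap _ _ (cone (chid X)) Y (fun n => mklin (t_lin n)) tE).
by move=> n x; rewrite -[X in _ + X]/(h n 0 + D n x) linear0 add0r DE addrC subrK.
Qed.

End Complexes.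

(** * Linear categories *)

Section LinCat.
Context {k : comPzRingType}.
Implicit Types C D : lincat k.

Lemma comp0m C (X Y Z : C) (f : hom X Y) : hzero Y Z ∘ f = hzero X Z.
Proof. by rewrite -(hscale0 (hzero Y Z)) compZl hscale0. Qed.

Lemma compm0 C (X Y Z : C) (g : hom Y Z) : g ∘ hzero X Y = hzero X Z.
Proof. by rewrite -(hscale0 (hzero X Y)) compZr hscale0. Qed.

Definition hsub C (X Y : C) (f g : hom X Y) : hom X Y := hadd f (hscale (-1) g).

Lemma hadd0r C (X Y : C) (f : hom X Y) : hadd f (hzero X Y) = f.
Proof. by rewrite haddC hadd0. Qed.

Lemma hsubK C (X Y : C) (f g : hom X Y) : hadd (hsub f g) g = f.
Proof.
rewrite /hsub -haddA -[X in hadd _ X](_ : hscale (-1 + 1) g = _).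
  by rewrite addNr hscale0 hadd0r.
by rewrite hscaleDl hscale1.
Qed.

Lemma hsubxx C (X Y : C) (f : hom X Y) : hsub f f = hzero X Y.
Proof.
rewrite /hsub -[f in LHS]hscale1 hscaleA -hscaleDl mulr1 subrr.
exact: hscale0.
Qed.

Lemma comp_subl C (X Y Z : C) (f g : hom Y Z) (h : hom X Y) :
  hsub f g ∘ h = hsub (f ∘ h) (g ∘ h).
Proof. by rewrite compDl compZl. Qed.

Lemma fmap0 C D (F : linfunctor C D) (X Y : C) :
  fmap F (hzero X Y) = hzero (F X) (F Y).
Proof. by rewrite -(hscale0 (hzero X Y)) fmapZ hscale0. Qed.

Lemma is_iso_id C (X : C) : is_iso (idm X).
Proof. by exists (idm X); rewrite comp1m. Qed.

Lemma is_iso_comp C (X Y Z : C) (g : hom Y Z) (f : hom X Y) :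
  is_iso g -> is_iso f -> is_iso (g ∘ f).
Proof.
move=> [g' [gl gr]] [f' [fl fr]]; exists (f' ∘ g'); split.
  by rewrite compA -(compA g g' f') gl compm1.
by rewrite compA -(compA f' f g) fr compm1.
Qed.

Lemma is_iso_fmap C D (F : linfunctor C D) (X Y : C) (f : hom X Y) :
  is_iso f -> is_iso (fmap F f).
Proof. by move=> [g [gf fg]]; exists (fmap F g); rewrite -!fmapM gf fg !fmap1. Qed.

Lemma iso_mono C (X Y Z : C) (f : hom Y Z) (g h : hom X Y) :
  is_iso f -> f ∘ g = f ∘ h -> g = h.
Proof.
move=> [f' [ff' _]] /(congr1 (compm f')); rewrite !compA ff' !comp1m //.
Qed.

Lemma iso_epi C (X Y Z : C) (f : hom X Y) (g h : hom Y Z) :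
  is_iso f -> g ∘ f = h ∘ f -> g = h.
Proof.
move=> [f' [_ ff']] /(congr1 (compm^~ f')); rewrite -!compA ff' !compm1 //.
Qed.

Lemma iso_cancel_right C (X Y Z : C) (g : hom Y Z) (f : hom X Y) :
  is_iso f -> is_iso (g ∘ f) -> is_iso g.
Proof.
move=> isof [h [hl hr]]; exists (f ∘ h); split; last by rewrite compA hr.
by apply: (iso_epi isof); rewrite -!compA hl compm1 comp1m.
Qed.

Lemma isomorphic_refl C (X : C) : isomorphic X X.
Proof. by exists (idm X); apply: is_iso_id. Qed.

Lemma isomorphic_sym C (X Y : C) : isomorphic X Y -> isomorphic Y X.
Proof. by move=> [f [g [gf fg]]]; exists g, f. Qed.

Lemma isomorphic_trans C (X Y Z : C) :
  isomorphic X Y -> isomorphic Y Z -> isomorphic X Z.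
Proof. by move=> [f fi] [g gi]; exists (g ∘ f); apply: is_iso_comp. Qed.

Lemma isomorphic_fmap C D (F : linfunctor C D) (X Y : C) :
  isomorphic X Y -> isomorphic (F X) (F Y).
Proof. by move=> [f fi]; exists (fmap F f); apply: is_iso_fmap. Qed.

End LinCat.

(** * Cofibrant complexes *)

Section Cofibrant.
Context {k : comPzRingType} {A : kalg k}.
Implicit Types X Y Z K P E B : complex A.

(** Lifts are strict; lifts up to homotopy against arbitrary quasi-isomorphisms
    follow by adding disks. *)
Definition cofibrant P : Prop := forall E B (p : chmap E B), quasi_iso p ->
  (forall n y, exists x, p n x = y) ->
  forall phi : chmap P B, exists psi : chmap P E, forall n x, p n (psi n x) = phi n x.

(** A map into an acyclic complex [K] lifts to [disk K], and the second component
    of the lift is a nullhomotopy. *)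
Lemma cofibrant_homotopic P Y (u v : chmap P Y) : cofibrant P ->
  heq u v -> homotopic u v.
Proof.
move=> cP [K [aK [w [t uv]]]].
have [||psi psiE] := cP _ _ (disk_proj K) _ _ w.
- exact: qis_acyclic (@disk_acyclic _ _ K) aK.
- exact: disk_proj_surj.
pose h n x := t n (shiftK K n (psi (n + 1) x).2).
have h_lin n : linear (h n) by move=> a x y; rewrite /h linearP /= !linearP.
exists (fun n => mklin (h_lin n)) => n x; rewrite uv -psiE; congr (_ + _).
rewrite -[RHS]/(cdiff Y n (h n x) + h (n + 1) (cdiff P (n + 1) x)) /h.
rewrite [psi _ (cdiff _ _ _)]cmapE -(cmapE t) -linearD; congr (t _ _).
rewrite -[X in _ = X + _](cmapE (shiftK K)) -linearD; congr (shiftK K _ _).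
by rewrite /= addrCA addNr addr0.
Qed.

Lemma surj_bdry E B (p : chmap E B) n (y : B n) : (forall n y, exists x, p n x = y) ->
  bdry y -> exists2 x, bdry x & p n x = y.
Proof.
move=> ps [m [e [b ->]]]; have [x <-] := ps _ b.
exists (castx E e (cdiff E m x)); first by exists m, e, x.
by rewrite (castx_nat (fun n => p n)) cmapE.
Qed.

Lemma cofibrant_dsumc (I : eqType) (X : I -> complex A) :
  (forall i, cofibrant (X i)) -> cofibrant (dsumc X).
Proof.
move=> cX E B p qp ps phi.
have lift i : exists psi : chmap (X i) E,
    forall n x, p n (psi n x) = chcomp phi (dscin X i) n x by apply: cX.
exists (dscopair (fun i => sval (cid (lift i)))) => n.
apply: (dsum_ext (f := p n \o dscopair (fun i => sval (cid (lift i))) n) (g := phi n)) => i x.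
rewrite -[LHS]/(p n (dscopair (fun i => sval (cid (lift i))) n (dscin X i n x))) dscopair_in.
by case: cid => psi /= ->.
Qed.

Lemma qis_ext X Y (f g : chmap X Y) : (forall n x, f n x = g n x) ->
  quasi_iso f -> quasi_iso g.
Proof.
move=> fg [fi fs]; split=> n.
  by move=> x dx [y gx]; apply: fi => //; exists y; rewrite fg.
by move=> y /fs [x [dx [y' yE]]]; exists x; split=> //; exists y'; rewrite -fg.
Qed.

Lemma qis_copair X Y L (s : chmap X Y) (g : chmap L Y) :
  quasi_iso s -> acyclic L -> quasi_iso (csum_copair s g).
Proof.
move=> qs aL; apply: (@qis_cancel_right _ _ _ _ _ _ (csum_inl X L)).
  exact: csum_inl_qis.
apply: qis_ext qs => n x.
by rewrite -[RHS]/(s n x + g n 0) linear0 addr0.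
Qed.

(** Quasi-isomorphisms are monic up to [heq]: after [s] is extended by [t] and
    by a disk to a surjective quasi-isomorphism, the difference of the two
    maps lands in its kernel, which is acyclic. *)
Lemma heq_cancel P X Y (s : chmap X Y) (u u' : chmap P X) : quasi_iso s ->
  heq (chcomp s u) (chcomp s u') -> heq u u'.
Proof.
move=> qs [K [aK [w [t uE]]]].
pose L := csum K (disk Y).
have aL : acyclic L by apply: csum_acyclic => //; apply: disk_acyclic.
pose g : chmap L Y := csum_copair (chneg t) (disk_proj Y).
pose p := csum_copair s g.
have ap : acyclic (kercx p).
  apply: kercx_acyclic; first exact: qis_copair.
  move=> n y; have [c cE] := disk_proj_surj y; exists (0, (0, c)).
  rewrite -[LHS]/(s n 0 + (chneg t n 0 + disk_proj Y n c)) cE.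
  by rewrite !linear0 !add0r.
pose f : chmap P (csum X L) :=
  csum_pair (chadd u (chneg u')) (csum_pair w (chzero P (disk Y))).
have fK n x : kermod p n (f n x).
  rewrite -[kermod _ _ _]/(s n (u n x + chneg u' n x) + (chneg t n (w n x) + disk_proj Y n 0) = 0).
  rewrite !chnegE linear0 addr0 linearB.
  by have := uE n x; rewrite /= => ->; rewrite addrAC addrK subrr.
exists (kercx p); split=> //.
exists (subcx_lift (kercx_subproof (p := p)) fK), (chcomp (csum_fst _ _) (subcx_incl (kercx_subproof (p := p)))) => n x.
by rewrite -[X in _ = _ + X]/(u n x + chneg u' n x) chnegE addrCA subrr addr0.
Qed.

Section Lifting.
Variable P : complex A.
Hypothesis cP : cofibrant P.

(** [v] lifts strictly to the sum of [X] and a disk; dropping the disk changes the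
    composite by a map that factors through an acyclic complex. *)
Lemma cof_lift X Y (s : chmap X Y) (v : chmap P Y) : quasi_iso s ->
  exists u : chmap P X, heq (chcomp s u) v.
Proof.
move=> qs; pose p := csum_copair s (disk_proj Y).
have qp : quasi_iso p by apply: qis_copair => //; apply: disk_acyclic.
have [|psi psiE] := cP qp _ v.
  move=> n y; have [c cE] := disk_proj_surj y; exists (0, c).
  by rewrite /= /csum_copair_fun /= linear0 add0r.
exists (chcomp (csum_fst _ _) psi); apply: heq_sym; exists (disk Y).
split; first exact: disk_acyclic.
by exists (chcomp (csum_snd _ _) psi), (disk_proj Y) => n x; rewrite -psiE.
Qed.

End Lifting.
End Cofibrant.

Section BoundedProjective.
Context {k : comPzRingType} {A : kalg k}.
Implicit Types X Y Z K P E B : complex A.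

Lemma proj_retract (M N : rmodType A) (i : {linear M -> N}) (r : {linear N -> M}) :
  (forall x, r (i x) = x) -> projective N -> projective M.
Proof.
move=> ri pN U V p f ps; have [g gE] := pN _ _ p (f \o r) ps.
by exists (g \o i) => x; rewrite /= gE /= ri.
Qed.

(** Surjective quasi-isomorphisms have no obstruction to lifting a single
    element once a lift of its differential is given. *)
Lemma fiber_surj E B (p : chmap E B) (i : int) (b : B i) (e : E (i + 1)) :
  quasi_iso p -> (forall n y, exists x, p n x = y) ->
  p (i + 1) e = cdiff B i b -> cdiff E (i + 1) e = 0 ->
  exists x, p i x = b /\ cdiff E i x = e.
Proof.
move=> /qisP [pi pS] ps pe de.
have /bdryS [e1 e1E] : bdry e by apply: pi => //; rewrite pe; apply: bdry_d.
have [|z [dz bz]] := pS _ (b - p i e1).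
  by rewrite linearB -cmapE -e1E pe subrr.
have [x bx xE] := surj_bdry ps bz.
exists (e1 + z + x); rewrite !linearD /= xE dz (bdry_cycle bx) !addr0; split=> //.
by rewrite addrC -[b - _ - _]addrA -opprD subrK.
Qed.

Lemma lift_degree E B (p : chmap E B) (i : int) (M : rmodType A)
    (f : {linear M -> B i}) (g : {linear M -> E (i + 1)}) :
  quasi_iso p -> (forall n y, exists x, p n x = y) -> projective M ->
  (forall x, p (i + 1) (g x) = cdiff B i (f x)) ->
  (forall x, cdiff E (i + 1) (g x) = 0) ->
  exists h : {linear M -> E i}, forall x, p i (h x) = f x /\ cdiff E i (h x) = g x.
Proof.
move=> qp ps pM pg dg.
pose T : rmodType A := (B i * E (i + 1)%R)%type.
pose N : submodule T := @Submodule _ T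
  (fun be => p (i + 1) be.2 = cdiff B i be.1 /\ cdiff E (i + 1) be.2 = 0)
  ltac:(by split; rewrite /= !linear0) ltac:(by move=> a x y [x1 x2] [y1 y2];
    split; rewrite /= linearP /= ?x1 ?y1 ?x2 ?y2 ?linearP // scaler0 addr0).
have q_lin : linear (fun e : E i => (p i e, cdiff E i e) : T).
  by move=> a x y; rewrite !linearP.
have qN e : N (mklin q_lin e).
  by split; rewrite /= ?cmapE // cdiffK.
have f_lin : linear (fun x : M => (f x, g x) : T).
  by move=> a x y; rewrite !linearP.
have fN e : N (mklin f_lin e) by split; rewrite /= ?pg ?dg.
have [|h hE] := pM _ _ (corestr qN) (corestr fN).
  move=> [[b e] [/= pe de]]; have [x [px dx]] := fiber_surj qp ps pe de.
  by exists x; apply: submod_inj; rewrite /= -px -dx.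
by exists h => x; have /(congr1 sval) [-> ->] := hE x.
Qed.

(** A lift is built one degree at a time, from the top down. *)
Lemma bounded_cofibrant P : bounded P -> (forall n, projective (P n)) -> cofibrant P.
Proof.
move=> [m bP] pP E B p qp ps phi.
pose good (i : int) := exists psi : forall n, {linear P n -> E n}, forall n, i <= n ->
  (forall x, p n (psi n x) = phi n x) /\
  (forall x, psi (n + 1) (cdiff P n x) = cdiff E n (psi n x)).
have P0 (n : int) (x : P n) : (m < `|n|)%N -> x = 0 by move=> mn; apply: bP.
have good_top : good (m%:Z + 1).
  exists (fun n => \0) => n mn; have P00 (x : P n) : x = 0 by apply: P0; lia.
  by split=> x; rewrite (P00 x) !linear0.
have good_step i : good (i + 1) -> good i.
  move=> [psi psiE].
  have [h1 h2] := psiE (i + 1) (lexx _).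
  have [|x|g gE] := @lift_degree _ _ p i _ (phi i) (psi (i + 1) \o cdiff P i) qp ps (pP i).
  - by move=> x; rewrite /= h1 cmapE.
  - by rewrite /= -h2 cdiffK linear0.
  exists (dfwith psi g) => n; rewrite le_eqVlt => /predU1P [<-|i_n].
    rewrite dfwith_in dfwith_out; last by lia.
    by split=> x; have [pg gd] := gE x; rewrite ?pg ?gd.
  have [q1 q2] := psiE n ltac:(lia).
  by rewrite !dfwith_out; [split| lia..].
have good_low (j : nat) : good (m%:Z + 1 - j%:Z).
  elim: j => [|j IH]; first by rewrite subr0.
  by apply: good_step; rewrite (_ : _ + 1 = m%:Z + 1 - j%:Z) //; lia.
have [psi psiE] := good_low (m + m + 1)%N.
have psid n x : psi (n + 1) (cdiff P n x) = cdiff E n (psi n x).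
  have [/psiE [//]|nm] := lerP (m%:Z + 1 - (m + m + 1)%N%:Z) n.
  have -> : x = 0 by apply: P0; lia.
  by rewrite !linear0.
exists (ChMap psid) => n x /=.
have [/psiE [//]|nm] := lerP (m%:Z + 1 - (m + m + 1)%N%:Z) n.
have -> : x = 0 by apply: P0; lia.
by rewrite !linear0.
Qed.
End BoundedProjective.

(** * Morphisms out of a cofibrant complex *)

Section DerivedHom.
Context {k : comPzRingType} {A : kalg k}.
Implicit Types X Y Z K P E B : complex A.

Lemma dmap_comp X Y Z (g : chmap Y Z) (f : chmap X Y) :
  dmap (chcomp g f) = dmap g ∘ dmap f.
Proof. by rewrite /dmap /compm /= dcompE; apply/dclassP; apply: deq_mapM. Qed.

Lemma dmap_add X Y (f g : chmap X Y) : dmap (chadd f g) = hadd (dmap f) (dmap g).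
Proof. by rewrite /dmap /hadd /= daddE; apply/dclassP; apply: deq_mapD. Qed.

Lemma dmap_scale X Y a (f : chmap X Y) : dmap (chscale a f) = hscale a (dmap f).
Proof. by rewrite /dmap /hscale /= dscaleE; apply/dclassP; apply: deq_mapZ. Qed.

Lemma dmap_ext X Y (f g : chmap X Y) : (forall n x, f n x = g n x) -> dmap f = dmap g.
Proof. by move=> fg; apply/dclassP; apply: deq_map_ext. Qed.

Lemma dmap_qis X Y (s : chmap X Y) : quasi_iso s -> is_iso (dmap s).
Proof.
move=> qs; exists (dclass (tinv qs)); rewrite /compm /= !dcompE.
by split; apply/dclassP; [apply: deq_invl | apply: deq_invr].
Qed.

Lemma acyclic_zero K : acyclic K -> is_zero (K : derived A).
Proof.
move=> aK; have [g [gs _]] := dmap_qis (qis_acyclic (chzero K K) aK aK).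
by rewrite /is_zero -gs compm0.
Qed.

Lemma dmap_heq X Y (u v : chmap X Y) : heq u v -> dmap u = dmap v.
Proof.
move=> [K [aK [w [t uE]]]].
have -> : dmap u = dmap (chadd v (chcomp t w)) by apply: dmap_ext.
rewrite dmap_add dmap_comp -(comp1m (dmap w)) (acyclic_zero aK) comp0m compm0.
exact: hadd0r.
Qed.

Section Cofibrant.
Variable P : complex A.
Hypothesis cP : cofibrant P.

(** The functor [X |-> (chain maps P -> X)/heq] inverts quasi-isomorphisms, so
    every morphism of the derived category acts on it.  Since morphisms of the
    derived category are words in chain maps and inverses, the action is
    computed on words. *)
Fixpoint act X Y (f : dterm X Y) : chmap P X -> chmap P Y :=
  match f with
  | tmap _ _ g => chcomp g
  | tinv _ _ s qs => fun u => sval (cid (cof_lift cP u qs))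
  | tcomp _ _ _ g f => fun u => act g (act f u)
  | tadd _ _ f g => fun u => chadd (act f u) (act g u)
  | tscale _ _ a f => fun u => chscale a (act f u)
  end.

Lemma act_heq X Y (f : dterm X Y) u v : heq u v -> heq (act f u) (act f v).
Proof.
elim: f u v => {X Y} [X Y g|X Y s qs|X Y Z g IHg f IHf|X Y f IHf g IHg|X Y a f IHf] u v uv /=.
- exact: heq_compl.
- case: cid => u' /= su; case: cid => v' /= sv.
  apply: (heq_cancel qs); apply: heq_trans su _; apply: heq_trans uv _.
  exact: heq_sym.
- by apply: IHg; apply: IHf.
- by apply: heq_add; [apply: IHf | apply: IHg].
- by apply: heq_scale; apply: IHf.
Qed.

Lemma act_add X Y (f : dterm X Y) u v :
  heq (act f (chadd u v)) (chadd (act f u) (act f v)).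
Proof.
elim: f u v => {X Y} [X Y g|X Y s qs|X Y Z g IHg f IHf|X Y f IHf g IHg|X Y a f IHf] u v /=.
- by apply: heq_ext => n x /=; rewrite linearD.
- case: cid => w /= sw; case: cid => u' /= su; case: cid => v' /= sv.
  apply: (heq_cancel qs); apply: heq_trans sw _; apply: heq_sym.
  apply: heq_trans (heq_add su sv).
  by apply: heq_ext => n x /=; rewrite linearD.
- by apply: heq_trans (IHg _ _); apply: act_heq.
- apply: heq_trans (heq_add (IHf _ _) (IHg _ _)) _.
  by apply: heq_ext => n x /=; rewrite addrACA.
- apply: heq_trans (heq_scale a (IHf _ _)) _.
  by apply: heq_ext => n x /=; rewrite linearD.
Qed.

Lemma act_scale X Y (f : dterm X Y) a u :
  heq (act f (chscale a u)) (chscale a (act f u)).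
Proof.
elim: f u => {X Y} [X Y g|X Y s qs|X Y Z g IHg f IHf|X Y f IHf g IHg|X Y b f IHf] u /=.
- by apply: heq_ext => n x /=; rewrite /kact linearZ.
- case: cid => w /= sw; case: cid => u' /= su.
  apply: (heq_cancel qs); apply: heq_trans sw _; apply: heq_sym.
  apply: heq_trans (heq_scale a su).
  by apply: heq_ext => n x /=; rewrite /kact linearZ.
- by apply: heq_trans (IHg _); apply: act_heq.
- apply: heq_trans (heq_add (IHf _) (IHg _)) _.
  by apply: heq_ext => n x /=; rewrite linearD.
- apply: heq_trans (heq_scale b (IHf _)) _.
  apply: heq_ext => n x /=; rewrite /kact !scalerA; congr (_ *: _).
  by rewrite -[LHS]/(kalg_map A a * kalg_map A b :> A) kalg_central.
Qed.

Lemma act_deq X Y (f g : dterm X Y) : deq f g -> forall u, heq (act f u) (act g u).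
Proof.
have ext X' Y' (u v : chmap X' Y') := @heq_ext _ _ X' Y' u v.
elim=> {X Y f g} /=; try by move=> *; apply: ext.
- by move=> *; apply: heq_sym.
- by move=> X Y f g h _ fg _ gh u; apply: heq_trans (fg u) (gh u).
- move=> X Y Z g g' f f' _ gg' _ ff' u; apply: heq_trans (gg' _).
  by apply: act_heq.
- by move=> *; apply: heq_add.
- by move=> *; apply: heq_scale.
- by move=> X Y f u; apply: act_heq; apply: ext.
- by move=> X Y f g h u; apply: ext => n x /=; rewrite addrA.
- by move=> X Y f g u; apply: ext => n x /=; rewrite addrC.
- by move=> X Y f u; apply: ext => n x /=; rewrite add0r.
- by move=> X Y f u; apply: ext => n x /=; rewrite /kact rmorph0 scale0r.
- by move=> X Y f u; apply: ext => n x /=; rewrite /kact rmorph1 scale1r.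
- move=> X Y a b f u; apply: ext => n x /=; rewrite /kact scalerA rmorphM.
  by congr (_ *: _); rewrite -[LHS]/(kalg_map A b * kalg_map A a :> A) kalg_central.
- by move=> X Y a b f u; apply: ext => n x /=; rewrite /kact rmorphD scalerDl.
- by move=> X Y a f g u; apply: ext => n x /=; rewrite linearD.
- by move=> X Y Z h f g u; apply: act_add.
- by move=> X Y Z a f g u; apply: act_scale.
- by move=> X Y f g fg u; apply: ext => n x /=; apply: fg.
- by move=> X Y s qs u; case: cid => v /= sv; apply: (heq_cancel qs).
- by move=> X Y s qs u; case: cid => v /= sv; apply: heq_trans sv _; apply: ext.
Qed.

Lemma act_sound X Y (f : dterm X Y) u :
  (dclass f : @hom k (derived_lincat A) X Y) ∘ dmap u = dmap (act f u).
Proof.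
elim: f u => {X Y} [X Y g|X Y s qs|X Y Z g IHg f IHf|X Y f IHf g IHg|X Y b f IHf] u.
- exact/esym/dmap_comp.
- have /dmap_heq su : heq (chcomp s (act (tinv qs) u)) u by rewrite /=; case: cid.
  rewrite -{1}su dmap_comp compA (_ : _ ∘ dmap s = idm (X : derived_lincat A)).
    exact: comp1m.
  by rewrite /compm /= dcompE; apply/dclassP; apply: deq_invl.
- rewrite -[RHS]/(dmap (act g (act f u))) -IHg -IHf compA; congr (_ ∘ _).
  by rewrite /compm /= dcompE.
- rewrite -[RHS]/(dmap (chadd (act f u) (act g u))) dmap_add -IHf -IHg -compDl; congr (_ ∘ _).
  by rewrite /hadd /= daddE.
- rewrite -[RHS]/(dmap (chscale b (act f u))) dmap_scale -IHf -compZl; congr (_ ∘ _).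
  by rewrite /hscale /= dscaleE.
Qed.

Lemma dhom_chain X (f : @hom k (derived A) P X) : exists u : chmap P X, f = dmap u.
Proof.
move: f; apply: dhomP => f; exists (act f (chid P)); rewrite -act_sound.
exact/esym/(@compm1 _ (derived_lincat A)).
Qed.

Lemma dmap_inj X (u v : chmap P X) : dmap u = dmap v -> heq u v.
Proof.
move=> /dclassP /act_deq /(_ (chid P)) /= uv.
apply: heq_trans (heq_trans uv _); apply: heq_ext => //.
Qed.

End Cofibrant.
End DerivedHom.

(** * Resolutions *)

Section FreeModule.
Variables (R : pzRingType) (I : eqType).

Definition freemod : lmodType R := dsum (fun _ : I => (R^o : lmodType R)).
Definition gen1 (i : I) : freemod := dsin i (1 : R^o).

Definition scalar_fun (M : lmodType R) (v : M) (a : R^o) : M := (a : R) *: v.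
Fact scalar_linear (M : lmodType R) (v : M) : linear (scalar_fun v).
Proof. by move=> a b c; rewrite /scalar_fun scalerDl -scalerA. Qed.

Definition freelin (M : lmodType R) (v : I -> M) : {linear freemod -> M} :=
  copair (fun i => mklin (scalar_linear (v i))).

Lemma freelin1 (M : lmodType R) (v : I -> M) i : freelin v (gen1 i) = v i.
Proof. by rewrite /freelin copair_in -[LHS]/(1 *: v i) scale1r. Qed.

Lemma dsin_gen1 i (a : R) : dsin i (a : R^o) = a *: gen1 i :> freemod.
Proof. by rewrite /gen1 -linearZ; congr (dsin i _); exact: (esym (mulr1 a)). Qed.

Lemma free_decomp s (x : freemod) : supports s x ->
  x = \sum_(i <- s) (dsproj i x : R) *: gen1 i.
Proof.
move=> /dsum_decomp {1}->; apply: eq_bigr => i _; exact: dsin_gen1.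
Qed.

Lemma free_ext (M : lmodType R) (f g : {linear freemod -> M}) :
  (forall i, f (gen1 i) = g (gen1 i)) -> forall x, f x = g x.
Proof.
by move=> fg; apply: dsum_ext => i a; rewrite dsin_gen1 !linearZ /= fg.
Qed.

End FreeModule.

Lemma free_projective (A : pzRingType) (I : eqType) : projective (freemod A^c I).
Proof.
move=> M N p f ps; exists (freelin (fun i => sval (cid (ps (f (gen1 A^c i)))))) => x.
apply: (free_ext (f := p \o freelin _)) => i.
rewrite -[LHS]/(p (freelin _ (gen1 _ i))) freelin1.
by case: cid.
Qed.

Section Resolution.
Context {k : comPzRingType} {A : kalg k}.
Variable X : complex A.

(** A generator of degree [n] of the resolution is an element [x] of [X n]
    together with a combination [z] of generators of degree [n + 1]; it is sent
    to [x] and has differential [z].  All cycles and all nullhomotopies that the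
    resolution needs are thereby added at once. *)
Inductive gen : int -> Type :=
  Gen n of seq (A^c * gen (n + 1)) & X n : gen n.

Definition gdiff n (g : gen n) : seq (A^c * gen (n + 1)) :=
  let: Gen _ z _ := g in z.
Definition gval n (g : gen n) : X n := let: Gen _ _ x := g in x.

Definition rawmod (n : int) : rmodType A := freemod A^c {classic gen n}.
Definition rgen n (g : gen n) : rawmod n := gen1 A^c (g : {classic gen n}).
Definition zsum n (z : seq (A^c * gen n)) : rawmod n :=
  foldr (fun p s => p.1 *: rgen p.2 + s) 0 z.

Definition rawdiff n : {linear rawmod n -> rawmod (n + 1)} :=
  freelin (fun g : {classic gen n} => zsum (gdiff g)).
Definition raweps n : {linear rawmod n -> X n} :=
  freelin (fun g : {classic gen n} => gval g).

Fixpoint valid n (g : gen n) : Prop :=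
  let: Gen m z x := g in
  [/\ foldr (fun p P => valid p.2 /\ P) True z,
      rawdiff _ (zsum z) = 0 & raweps _ (zsum z) = cdiff X m x].

Section GenInd.
Variable Q : forall n, gen n -> Prop.
Hypothesis QGen : forall n z x,
  foldr (fun p P => Q p.2 /\ P) True z -> Q (@Gen n z x).
Fixpoint gen_nested_ind n (g : gen n) : Q g :=
  let: Gen m z x := g in
  QGen x ((fix loop z : foldr (fun p P => Q p.2 /\ P) True z :=
    match z with [::] => I | p :: z' => conj (gen_nested_ind p.2) (loop z') end) z).
End GenInd.

(** Only generators whose data define a cycle over the right boundary may be used.
    The condition is imposed afterwards: the resolution is the submodule of
    combinations of valid generators, on which [rawdiff] squares to zero. *)
Definition validmod n : submodule (rawmod n).
Proof.
refine (@Submodule _ (rawmod n)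
  (fun x => forall g : {classic gen n}, dsproj g x != 0 -> valid g) _ _).
- by move=> g; rewrite linear0 eqxx.
- move=> a x y vx vy g; rewrite linearP.
  have [x0|/vx //] := eqVneq (dsproj g x) 0.
  by rewrite x0 scaler0 add0r; apply: vy.
Defined.

Lemma valid_rgen n (g : gen n) : valid g -> validmod n (rgen g).
Proof.
move=> vg h; have [<- //|gh] := eqVneq (g : {classic gen n}) h.
by rewrite dsproj_out // eqxx.
Qed.

Lemma valid_zsum n z : foldr (fun p P => valid p.2 /\ P) True z -> validmod n (zsum z).
Proof.
elim: z => [_|p z IH [vp vz]]; first exact: smem0.
by apply: smem_lin; [apply: valid_rgen | apply: IH].
Qed.

Lemma validP n (x : rawmod n) : validmod n x ->
  exists2 z, foldr (fun p P => valid p.2 /\ P) True z & x = zsum z.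
Proof.
move=> vx; have [s sx] := supportsP x.
exists [seq (dsproj g x : A^c, g : gen n) | g <- s & dsproj g x != 0].
  elim: s {sx} => [//|g s IH] /=; case: ifPn => //= gx.
  by split=> //; apply: vx.
rewrite {1}(free_decomp sx); elim: s {sx} => [|g s IH] /=; first by rewrite big_nil.
rewrite big_cons IH; case: ifPn => [//|/negPn/eqP ->].
by rewrite scale0r add0r.
Qed.

Lemma zsum_lin n (M : rmodType A) (f : {linear rawmod n -> M}) z :
  f (zsum z) = foldr (fun p s => p.1 *: f (rgen p.2) + s) 0 z.
Proof. by elim: z => [|p z IH] /=; rewrite ?linear0 // linearP IH. Qed.

Lemma valid_ext n (M : rmodType A) (f g : {linear rawmod n -> M}) x :
  (forall h, valid h -> f (rgen h) = g (rgen h)) -> validmod n x -> f x = g x.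
Proof.
move=> fg /validP [z + ->]; rewrite !zsum_lin.
by elim: z => [//|p z IH] /= [/fg -> /IH ->].
Qed.

Lemma rawdiff_rgen n (g : gen n) : rawdiff n (rgen g) = zsum (gdiff g).
Proof. exact: freelin1. Qed.
Lemma raweps_rgen n (g : gen n) : raweps n (rgen g) = gval g.
Proof. exact: freelin1. Qed.

Lemma validE n (g : gen n) : valid g ->
  [/\ foldr (fun p P => valid p.2 /\ P) True (gdiff g),
      rawdiff _ (zsum (gdiff g)) = 0 & raweps _ (zsum (gdiff g)) = cdiff X n (gval g)].
Proof. by case: g. Qed.

Lemma valid_diff n x : validmod n x -> validmod (n + 1) (rawdiff n x).
Proof.
move=> /validP [z + ->]; rewrite zsum_lin; elim: z => [_|p z IH [vp vz]].
  exact: smem0.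
apply: smem_lin; last exact: IH.
by rewrite rawdiff_rgen; apply: valid_zsum; have [] := validE vp.
Qed.

Definition res_obj n : rmodType A := submod (validmod n).
Definition res_diff n : {linear res_obj n -> res_obj (n + 1)} :=
  corestr (f := rawdiff n \o subval (validmod n)) (fun x => valid_diff (svalP x)).
Fact res_diffK n x : res_diff (n + 1) (res_diff n x) = 0.
Proof.
apply: submod_inj; case: x => x vx /=.
apply: (valid_ext (f := rawdiff (n + 1) \o rawdiff n) (g := \0)) vx => g /validE [_ dg _].
by rewrite -[LHS]/(rawdiff _ (rawdiff _ (rgen g))) rawdiff_rgen.
Qed.
Definition resolution : complex A := Complex res_diffK.

Fact res_eps_subproof n (x : resolution n) :
  (raweps (n + 1) \o subval (validmod (n + 1))) (cdiff resolution n x)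
    = cdiff X n ((raweps n \o subval (validmod n)) x).
Proof.
case: x => x vx.
apply: (valid_ext (f := raweps (n + 1) \o rawdiff n) (g := cdiff X n \o raweps n)) vx.
move=> g /validE [_ _ dg].
rewrite -[LHS]/(raweps _ (rawdiff _ (rgen g))) -[RHS]/(cdiff X n (raweps _ (rgen g))).
by rewrite rawdiff_rgen raweps_rgen.
Qed.
Definition res_eps : chmap resolution X :=
  @ChMap _ _ resolution X (fun n => raweps n \o subval (validmod n)) res_eps_subproof.

(** A cycle [y] of [X] is hit by the generator with value [y] and differential [0];
    a cycle [z] of the resolution that becomes the boundary of [y] is the
    differential of the generator with data [z] and [y]. *)
Lemma res_eps_qis : quasi_iso res_eps.
Proof.
split=> n.
  move=> [x vx] /(congr1 sval) /= dx [y xy].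
  have [z vz xE] := validP vx.
  have vg : valid (Gen z y) by split=> //=; rewrite -xE.
  exists (submk (valid_rgen vg)); apply: submod_inj.
  by rewrite -[RHS]/(rawdiff _ (rgen (Gen z y))) rawdiff_rgen /= xE.
move=> y dy; have vg : valid (Gen [::] y).
  by split; [by [] | exact: linear0 | rewrite dy; exact: linear0].
exists (submk (valid_rgen vg)); split.
  by apply: submod_inj; rewrite -[LHS]/(rawdiff _ (rgen (Gen [::] y))) rawdiff_rgen.
exists 0; rewrite linear0 -[X in _ - X]/(raweps _ (rgen (Gen [::] y))).
by rewrite raweps_rgen subrr.
Qed.

Definition res_proj n : {linear rawmod n -> res_obj n} :=
  freelin (fun g : {classic gen n} => match pselect (valid g) with
    | left vg => submk (valid_rgen vg) | right _ => 0 end).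

Lemma res_projK n x : res_proj n (subval (validmod n) x) = x.
Proof.
apply: submod_inj; case: x => x vx.
apply: (valid_ext (f := subval (validmod n) \o res_proj n) (g := idfun)) vx => g vg.
rewrite -[LHS]/(sval (res_proj n (rgen g))) /res_proj freelin1.
by case: pselect.
Qed.

Lemma res_projective n : projective (resolution n).
Proof. by apply: (proj_retract (@res_projK n)); apply: free_projective. Qed.

Section Lift.
Variables (E B : complex A) (p : chmap E B) (phi : chmap resolution B).
Hypotheses (qp : quasi_iso p) (ps : forall n y, exists x, p n x = y).

Let phir n : {linear rawmod n -> B n} := phi n \o res_proj n.

Fixpoint glift n (g : gen n) : E n :=
  let: Gen m z x := g in
  let liftable := exists e : E m, p m e = phir m (rgen (Gen z x)) /\
    cdiff E m e = foldr (fun q s => q.1 *: glift q.2 + s) 0 z in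
  match pselect liftable with left h => sval (cid h) | right _ => 0 end.

Let rlift n : {linear rawmod n -> E n} := freelin (fun g : {classic gen n} => glift g).

Lemma rlift_rgen n (g : gen n) : rlift n (rgen g) = glift g.
Proof. exact: freelin1. Qed.

Lemma phir_val n (x : resolution n) : phir n (sval x) = phi n x.
Proof. by rewrite /phir /= -[in RHS](res_projK x). Qed.

Definition lifted n (g : gen n) : Prop :=
  p n (glift g) = phir n (rgen g) /\ cdiff E n (glift g) = rlift (n + 1) (zsum (gdiff g)).

Lemma lifted_zsum n (z : seq (A^c * gen n)) :
  foldr (fun q P => lifted q.2 /\ P) True z ->
  p n (rlift n (zsum z)) = phir n (zsum z) /\
  cdiff E n (rlift n (zsum z)) = rlift (n + 1) (rawdiff n (zsum z)).
Proof.
elim: z => [_|q z IH [[lq dq] /IH [pz dz]]]; first by rewrite !linear0.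
have -> : zsum (q :: z) = q.1 *: rgen q.2 + zsum z by [].
by rewrite !linearP pz dz rlift_rgen lq dq rawdiff_rgen.
Qed.

(** Along the generators of the differential the lift is already a lift, so there
    is no obstruction to lifting the generator itself. *)
Lemma liftedP n (g : gen n) : valid g -> lifted g.
Proof.
elim/gen_nested_ind: n / g => n z x IH vg.
have [vz dz _] := validE vg; rewrite -[gdiff _]/z in vz dz.
have {IH} lz : foldr (fun q P => lifted q.2 /\ P) True z.
  by elim: z IH vz {x vg dz} => [//|q z IHz] /= [lq lz] [vq vz]; split; auto.
have [pz dlz] := lifted_zsum lz.
have sE : foldr (fun q s => q.1 *: glift q.2 + s) 0 z = rlift (n + 1) (zsum z).
  rewrite zsum_lin; elim: z {x vg vz dz lz pz dlz} => [//|q z IHz].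
  rewrite -[LHS]/(q.1 *: glift q.2 + foldr _ _ _) IHz.
  by rewrite -(rlift_rgen q.2).
have [||e eE] := @fiber_surj _ _ _ _ p n (phir n (rgen (Gen z x))) (rlift (n + 1) (zsum z)) qp ps.
- rewrite pz -[zsum z](rawdiff_rgen (Gen z x)).
  rewrite -[rgen _]/(sval (submk (valid_rgen vg))).
  rewrite -[rawdiff _ _]/(sval (cdiff resolution n (submk (valid_rgen vg)))).
  by rewrite !phir_val cmapE.
- by rewrite dlz dz linear0.
rewrite /lifted -[gdiff _]/z /= sE; case: pselect => [h|[]]; last by exists e.
by case: cid.
Qed.

Lemma res_lift : exists psi : chmap resolution E, forall n x, p n (psi n x) = phi n x.
Proof.
have psiE n x : (rlift (n + 1) \o subval (validmod (n + 1))) (cdiff resolution n x)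
    = cdiff E n ((rlift n \o subval (validmod n)) x).
  case: x => x vx.
  apply: (valid_ext (f := rlift (n + 1) \o rawdiff n) (g := cdiff E n \o rlift n)) vx => g vg.
  rewrite -[LHS]/(rlift _ (rawdiff _ (rgen g))) -[RHS]/(cdiff E n (rlift n (rgen g))).
  by rewrite rawdiff_rgen rlift_rgen (liftedP vg).2.
exists (@ChMap _ _ resolution E (fun n => rlift n \o subval (validmod n)) psiE) => n x.
rewrite -phir_val; case: x => x vx.
apply: (valid_ext (f := p n \o rlift n) (g := phir n)) vx => g vg.
by rewrite -[LHS]/(p n (rlift n (rgen g))) rlift_rgen (liftedP vg).1.
Qed.

End Lift.

Lemma res_cofibrant : cofibrant resolution.
Proof. by move=> E B p qp ps phi; apply: res_lift. Qed.

End Resolution.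

(** * Coproducts and compact objects *)

Section Coproducts.
Context {k : comPzRingType}.
Implicit Types C D : lincat k.

Definition coproduct C (I : eqType) (Yi : I -> C) (Y : C)
    (iota : forall i, hom (Yi i) Y) : Prop :=
  forall (W : C) (f : forall i, hom (Yi i) W),
    exists g : hom Y W, (forall i, g ∘ iota i = f i) /\
      forall g', (forall i, g' ∘ iota i = f i) -> g' = g.

(** These are the morphisms with finitely many components.  They are generated
    inductively, so that stability under sums, composition and functors is an
    induction and no index set of the components has to be carried along. *)
Inductive fin_sum C (I : Type) (Yi : I -> C) (Y : C) (iota : forall i, hom (Yi i) Y)
    (X : C) : hom X Y -> Prop :=
| fin_sum0 : fin_sum iota (hzero X Y)
| fin_sumD i (a : hom X (Yi i)) f :
    fin_sum iota f -> fin_sum iota (hadd (iota i ∘ a) f).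

Definition compact C (X : C) : Prop :=
  forall (I : eqType) (Yi : I -> C) (Y : C) (iota : forall i, hom (Yi i) Y),
    coproduct iota -> forall f : hom X Y, fin_sum iota f.

Definition preserves_coproducts C D (F : linfunctor C D) : Prop :=
  forall (I : eqType) (Yi : I -> C) (Y : C) (iota : forall i, hom (Yi i) Y),
    coproduct iota -> coproduct (fun i => fmap F (iota i)).

Section FinSum.
Variables (C : lincat k) (I : Type) (Yi : I -> C) (Y : C).
Variable iota : forall i, hom (Yi i) Y.

Lemma fin_sum_add X (f g : hom X Y) :
  fin_sum iota f -> fin_sum iota g -> fin_sum iota (hadd f g).
Proof.
by move=> ff fg; elim: ff => [|i a f' _ IH]; rewrite ?hadd0 // -haddA; constructor.
Qed.

Lemma fin_sum1 X i (a : hom X (Yi i)) : fin_sum iota (iota i ∘ a).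
Proof. by rewrite -(hadd0r (iota i ∘ a)); do 2!constructor. Qed.

Lemma fin_sum_compr X X' (f : hom X Y) (a : hom X' X) :
  fin_sum iota f -> fin_sum iota (f ∘ a).
Proof.
elim=> [|i b f' _ IH]; first by rewrite comp0m; constructor.
by rewrite compDl -compA; constructor.
Qed.

End FinSum.

Section FinSumComp.
Variables (C : lincat k) (I : Type) (Yi : I -> C) (Y : C).
Variable iota : forall i, hom (Yi i) Y.

Lemma fin_sum_compl (J : Type) (Zj : J -> C) Z (kappa : forall j, hom (Zj j) Z) X
    (f : hom X Y) (e : hom Y Z) :
  (forall i, fin_sum kappa (e ∘ iota i)) -> fin_sum iota f -> fin_sum kappa (e ∘ f).
Proof.
move=> eiota; elim=> [|i b f' _ IH]; first by rewrite compm0; constructor.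
by rewrite compDr compA; apply: fin_sum_add => //; apply: fin_sum_compr.
Qed.

Lemma fin_sum_factor X (f : hom X Y) Z (e : hom Z Y) :
  (forall i, exists a, iota i = e ∘ a) -> fin_sum iota f -> exists g, f = e ∘ g.
Proof.
move=> eiota; elim=> [|i b f' _ [g ->]]; first by exists (hzero _ _); rewrite compm0.
by have [a ->] := eiota i; exists (hadd (a ∘ b) g); rewrite compDr compA.
Qed.

End FinSumComp.

Lemma fin_sum_fmap C D (F : linfunctor C D) (I : Type) (Yi : I -> C) Y
    (iota : forall i, hom (Yi i) Y) X (f : hom X Y) :
  fin_sum iota f -> fin_sum (fun i => fmap F (iota i)) (fmap F f).
Proof.
elim=> [|i a f' _ IH]; first by rewrite fmap0; constructor.
by rewrite fmapD fmapM; exact: (@fin_sumD D I (fun i => F (Yi i)) _ (fun i => fmap F (iota i))).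
Qed.

Section Universal.
Variables (C : lincat k) (I : eqType) (Yi : I -> C) (Y : C).
Variable iota : forall i, hom (Yi i) Y.
Hypothesis cY : coproduct iota.

Lemma coprod_epi W (g h : hom Y W) : (forall i, g ∘ iota i = h ∘ iota i) -> g = h.
Proof. by move=> gh; have [f [_ fU]] := cY (fun i => h ∘ iota i); rewrite (fU g) // (fU h). Qed.

Lemma coprod_proj : exists pi : forall i, hom Y (Yi i),
  (forall i, pi i ∘ iota i = idm (Yi i)) /\
  (forall i j, i != j -> pi j ∘ iota i = hzero _ _).
Proof.
pose delta j i := dfwith (fun i => hzero (Yi i) (Yi j)) (idm (Yi j)) i.
exists (fun j => sval (cid (cY (delta j)))); split=> [i|i j ij]; case: cid => p /= [pE _].
  by rewrite pE /delta dfwith_in.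
by rewrite pE /delta dfwith_out // eq_sym.
Qed.

(** The idempotent of [Y] that projects onto the summands met by [f]. *)
Lemma fin_sum_idem X (f : hom X Y) : fin_sum iota f ->
  exists e : hom Y Y, e ∘ f = f /\ forall X' (g : hom X' Y), fin_sum iota (e ∘ g).
Proof.
have [pi [pi1 pi0]] := coprod_proj.
suff gen : fin_sum iota f -> exists e : hom Y Y,
    [/\ e ∘ f = f, forall X' (g : hom X' Y), fin_sum iota (e ∘ g) &
      forall i, e ∘ iota i = iota i \/ e ∘ iota i = hzero _ _].
  by move=> /gen [e [ef fe _]]; exists e.
elim=> [|i a f' _ [e [ef fe ei]]].
  exists (hzero _ _); split; [by rewrite comp0m| |by move=> i; right; rewrite comp0m].
  by move=> X' g; rewrite comp0m; constructor.
have [eii|eii] := ei i; first by exists e; split; rewrite // compDr ef compA eii.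
have pie : pi i ∘ e = hzero _ _.
  apply: coprod_epi => j; rewrite -compA comp0m.
  have [->|ji] := eqVneq j i; first by rewrite eii compm0.
  by have [->|->] := ei j; rewrite ?compm0 // pi0.
exists (hadd e (iota i ∘ pi i)); split.
- have pif : pi i ∘ f' = hzero _ _ by rewrite -ef compA pie comp0m.
  rewrite compDr !compDl compA eii comp0m hadd0 ef -!compA pif compm0 hadd0r.
  by rewrite (compA a (iota i) (pi i)) pi1 comp1m.
- move=> X' g; rewrite compDl haddC -compA; apply: fin_sum_add => //.
  exact: fin_sum1.
move=> j; rewrite compDl -compA; have [->|ji] := eqVneq j i.
  by left; rewrite eii pi1 compm1 hadd0.
by rewrite (pi0 _ _ ji) compm0 hadd0r.
Qed.

Lemma coprod_iso Y' (Yi' : I -> C) (e : hom Y Y') (q : forall i, hom (Yi' i) (Yi i)) :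
  is_iso e -> (forall i, is_iso (q i)) -> coproduct (fun i => e ∘ iota i ∘ q i).
Proof.
move=> [e' [ee' e'e]] qiso W f.
pose q' i := sval (cid (qiso i)).
have q'P i : q' i ∘ q i = idm _ /\ q i ∘ q' i = idm _ by rewrite /q'; case: cid.
have [g [gE gU]] := cY (fun i => f i ∘ q' i).
exists (g ∘ e'); split.
  move=> i; rewrite !compA -(compA e e' g) ee' compm1 gE -compA.
  by have [-> _] := q'P i; rewrite compm1.
move=> g' g'E; have -> : g' = g' ∘ e ∘ e' by rewrite -compA e'e compm1.
congr (_ ∘ _); apply: gU => i; rewrite -(g'E i) -!compA.
by have [_ ->] := q'P i; rewrite compm1.
Qed.

Lemma coprod_unique Y' (Yi' : I -> C) (iota' : forall i, hom (Yi' i) Y')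
    (q : forall i, hom (Yi i) (Yi' i)) :
  coproduct iota' -> (forall i, is_iso (q i)) ->
  exists e : hom Y Y', is_iso e /\ forall i, e ∘ iota i = iota' i ∘ q i.
Proof.
move=> cY' qiso; pose q' i := sval (cid (qiso i)).
have q'P i : q' i ∘ q i = idm _ /\ q i ∘ q' i = idm _ by rewrite /q'; case: cid.
have [e [eE _]] := cY (fun i => iota' i ∘ q i).
have [e' [e'E e'U]] := cY' _ (fun i => iota i ∘ q' i).
exists e; split=> //; exists e'; split.
  apply: coprod_epi => i; rewrite -compA eE compA e'E -compA comp1m.
  by have [-> _] := q'P i; rewrite compm1.
have [g [_ gU]] := cY' _ iota'; transitivity g; last symmetry; apply: gU => i.
  by rewrite -compA e'E compA eE -compA; have [_ ->] := q'P i; rewrite compm1.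
by rewrite comp1m.
Qed.

End Universal.

Lemma compact_iso C (X Y : C) : isomorphic X Y -> compact X -> compact Y.
Proof.
move=> [f [g [gf fg]]] cX I Zi Z iota cZ h.
by rewrite -(compm1 h) -fg compA; apply: fin_sum_compr; apply: cX.
Qed.

(** An object is compact as soon as its identity is a finite sum of morphisms
    that factor through compact objects; this covers finite direct sums and
    direct summands at once. *)
Lemma compact_fin_sum C (J : Type) (Zj : J -> C) (X : C) (y : forall j, hom (Zj j) X) :
  (forall j, compact (Zj j)) -> fin_sum y (idm X) -> compact X.
Proof.
move=> cZ idX I Yi Y iota cY f; rewrite -(compm1 f).
by apply: (fin_sum_compl _ idX) => j; apply: cZ.
Qed.

Section Adjunction.
Variables (C D : lincat k) (L : linfunctor C D) (R : linfunctor D C).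
Variable ad : adjunction L R.

Definition adj_left (X : C) (Y : D) (f : hom (L X) Y) : hom X (R Y) :=
  fmap R f ∘ adj_unit ad X.
Definition adj_right (X : C) (Y : D) (g : hom X (R Y)) : hom (L X) Y :=
  adj_counit ad Y ∘ fmap L g.

Lemma adj_leftK X Y : cancel (@adj_left X Y) (@adj_right X Y).
Proof.
move=> f; rewrite /adj_left /adj_right fmapM compA -counit_nat -compA triangleL.
exact: compm1.
Qed.

Lemma adj_rightK X Y : cancel (@adj_right X Y) (@adj_left X Y).
Proof.
move=> g; rewrite /adj_left /adj_right fmapM -compA -unit_nat compA triangleR.
exact: comp1m.
Qed.

Lemma left_adjoint_coproducts : preserves_coproducts L.
Proof.
move=> I Yi Y iota cY W f.
have [g [gE gU]] := cY _ (fun i => adj_left (f i)).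
exists (adj_right g); split=> [i|g' g'E].
  by rewrite /adj_right -compA -fmapM gE; apply: adj_leftK.
rewrite -(adj_leftK g'); congr (adj_right _); apply: gU => i.
by rewrite -g'E /adj_left fmapM -!compA -unit_nat.
Qed.

Lemma adj_right_fin_sum (I : Type) (Yi : I -> D) Y (iota : forall i, hom (Yi i) Y) X
    (g : hom X (R Y)) :
  fin_sum (fun i => fmap R (iota i)) g -> fin_sum iota (adj_right g).
Proof.
elim=> [|i a f' _ IH]; rewrite /adj_right.
  by rewrite fmap0 compm0; constructor.
by rewrite fmapD compDr fmapM compA -counit_nat -compA; constructor.
Qed.

Lemma adj_left_fin_sum (I : Type) (Yi : I -> D) Y (iota : forall i, hom (Yi i) Y) X
    (f : hom (L X) Y) :
  fin_sum iota f -> fin_sum (fun i => fmap R (iota i)) (adj_left f).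
Proof.
by move=> /(fin_sum_fmap R) ff; rewrite /adj_left; apply: fin_sum_compr.
Qed.

(** Transposing a morphism from [L X] to a coproduct gives a morphism from [X] to a
    coproduct, and transposing back preserves finite sums. *)
Lemma compact_left_adjoint X : preserves_coproducts R -> compact X -> compact (L X).
Proof.
move=> Rc cX I Yi Y iota cY f; rewrite -(adj_leftK f).
by apply: adj_right_fin_sum; apply: cX; apply: Rc.
Qed.

End Adjunction.

Lemma compact_reflect C D (F : linfunctor C D) (X : C) :
  fully_faithful F -> preserves_coproducts F -> compact (F X) -> compact X.
Proof.
move=> ff Fc cFX I Yi Y iota cY f.
have ffs : fin_sum (fun i => fmap F (iota i)) (fmap F f) by apply: cFX; apply: Fc.
suff {f ffs} gen h : fin_sum (fun i => fmap F (iota i)) h ->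
    forall f : hom X Y, h = fmap F f -> fin_sum iota f by exact: gen ffs _ _.
elim=> [|i a h' _ IH] f hf.
  have [inv invK _] := ff X Y; rewrite -(invK f) -hf -(fmap0 F) invK; constructor.
have [inv invK Kinv] := ff X Y; have [inv' invK' Kinv'] := ff X (Yi i).
rewrite -(invK f) -hf -(Kinv' a) -(Kinv h') -fmapM -fmapD invK.
by constructor; apply: IH; rewrite Kinv.
Qed.

End Coproducts.

(** * Stalk complexes *)

Lemma fin_gen_surj (A : pzRingType) (M N : rmodType A) (f : {linear M -> N}) :
  (forall y, exists x, f x = y) -> fin_gen M -> fin_gen N.
Proof.
move=> fs [n [e eM]]; exists n, (fun i => f (e i)) => y.
have [x <-] := fs y; have [c ->] := eM x; exists c.
by rewrite linear_sum; apply: eq_bigr => i _; rewrite linearZ.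
Qed.

Section Stalk.
Context {k : comPzRingType} {A : kalg k}.
Implicit Types X Y Z K P : complex A.

Section Def.
Variables (M : rmodType A) (a : int).

(** [M] in degree [a].  The other terms are realized as the zero submodule of
    [M] so that all terms have elements of the same type. *)
Definition stalkmod (n : int) : submodule M.
Proof.
refine (@Submodule _ M (fun x => n != a -> x = 0) _ _) => //.
by move=> b x y x0 y0 na; rewrite x0 // y0 // scaler0 addr0.
Defined.

Fact stalk_diffK n (x : submod (stalkmod n)) :
  (\0 : {linear submod (stalkmod (n + 1)) -> submod (stalkmod (n + 1 + 1))})
    ((\0 : {linear submod (stalkmod n) -> submod (stalkmod (n + 1))}) x) = 0.
Proof. by []. Qed.
Definition stalk : complex A := Complex stalk_diffK.

Definition stalk_in (x : M) : stalk a :=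
  submk (N := stalkmod a) (fun na : a != a => False_ind (x = 0) (negP na (eqxx a))).

Lemma stalk_val (n : int) (v : stalk n) : n != a -> sval v = 0.
Proof. exact: (svalP v). Qed.

Section MapOut.
Variables (Y : complex A) (f : {linear M -> Y a}).
Hypothesis df : forall x, cdiff Y a (f x) = 0.

Definition stalk_fam n : {linear M -> Y n} := dfwith (fun j => \0 : {linear M -> Y j}) f n.
Lemma stalk_fam_d n x : cdiff Y n (stalk_fam n x) = 0.
Proof. by rewrite /stalk_fam; case: dfwithP => [|j ja] /=; rewrite ?df ?linear0. Qed.
Fact stalk_map_subproof n v :
  (stalk_fam (n + 1) \o subval (stalkmod (n + 1))) (cdiff stalk n v)
    = cdiff Y n ((stalk_fam n \o subval (stalkmod n)) v).
Proof. by rewrite [RHS]stalk_fam_d -[LHS]/(stalk_fam (n + 1) 0) linear0. Qed.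
Definition stalk_map : chmap stalk Y :=
  @ChMap _ _ stalk Y (fun n => stalk_fam n \o subval (stalkmod n)) stalk_map_subproof.

Lemma stalk_mapE v : stalk_map a v = f (sval v).
Proof. by rewrite /= /stalk_fam dfwith_in. Qed.

End MapOut.

Lemma stalk_ext Y (u v : chmap stalk Y) :
  (forall x, u a (stalk_in x) = v a (stalk_in x)) -> forall n x, u n x = v n x.
Proof.
move=> uv n x; have [an|na] := eqVneq a n.
  case: n / an x => x; have -> : x = stalk_in (sval x) by apply: submod_inj.
  exact: uv.
have -> : x = 0 by apply: submod_inj; apply: stalk_val; rewrite eq_sym.
by rewrite !linear0.
Qed.

Lemma stalk_bounded : bounded stalk.
Proof.
exists `|a|%N => n an x; apply: submod_inj; apply: stalk_val.
by apply: contraTneq an => ->; rewrite ltnn.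
Qed.

Fact stalk_in_linear : linear stalk_in.
Proof. by move=> b x y; apply: submod_inj. Qed.

Lemma stalk_retract n : exists (i : {linear stalk n -> M}) (r : {linear M -> stalk n}),
  forall x, r (i x) = x.
Proof.
exists (subval (stalkmod n)); have [an|na] := eqVneq a n.
  by case: n / an; exists (mklin stalk_in_linear) => x; apply: submod_inj.
by exists \0 => x; apply: submod_inj; rewrite (stalk_val x) // eq_sym.
Qed.

Lemma stalk_projective n : projective M -> projective (stalk n).
Proof. by have [i [r ri]] := stalk_retract n; apply: proj_retract ri. Qed.

Lemma stalk_fin_gen n : fin_gen M -> fin_gen (stalk n).
Proof.
have [i [r ri]] := stalk_retract n; apply: (fin_gen_surj (f := r)) => x.
by exists (i x).
Qed.

End Def.

End Stalk.

(** * Perfect complexes *)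

Section Perfect.
Context {k : comPzRingType} {A : kalg k}.
Implicit Types X Y Z K P : complex A.

Definition perfect P := bounded P /\ forall n, fin_gen (P n) /\ projective (P n).

Lemma KbprojP X : Kbproj (X : derived A) <->
  exists2 P, perfect P & isomorphic (P : derived A) X.
Proof.
by split=> [[P [bP fP PX]]|[P [bP fP] PX]]; exists P.
Qed.

Lemma Kbproj_iso X Y : isomorphic (X : derived A) Y -> Kbproj (X : derived A) ->
  Kbproj (Y : derived A).
Proof.
move=> XY [P [bP fP PX]]; exists P; split=> //; exact: isomorphic_trans PX XY.
Qed.

Lemma perfect_Kbproj P : perfect P -> Kbproj (P : derived A).
Proof. by move=> pP; apply/KbprojP; exists P => //; apply: isomorphic_refl. Qed.

Lemma perfect_cofibrant P : perfect P -> cofibrant P.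
Proof. by move=> [bP fP]; apply: bounded_cofibrant => // n; have [] := fP n. Qed.

Lemma perfect_stalk (M : rmodType A) a : fin_gen M -> projective M -> perfect (stalk M a).
Proof.
move=> fM pM; split; first exact: stalk_bounded.
by move=> n; split; [apply: stalk_fin_gen | apply: stalk_projective].
Qed.

Lemma regular_fin_gen : fin_gen ((A^c)^o : rmodType A).
Proof.
exists 1%N, (fun _ => 1) => x; exists (fun _ => x).
by rewrite big_ord1 -[RHS]/(x * 1) mulr1.
Qed.

Lemma regular_projective : projective ((A^c)^o : rmodType A).
Proof.
pose i := mklin (scalar_linear (gen1 A^c tt)).
pose r := freelin (fun _ : unit => (1 : (A^c)^o)).
apply: (proj_retract (i := i) (r := r)); last exact: free_projective.
by move=> x; rewrite -[i x]/((x : A^c) *: gen1 A^c tt) linearZ freelin1; exact: mulr1.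
Qed.

Definition cell (a : int) : complex A := stalk ((A^c)^o : rmodType A) a.

Lemma cell_perfect a : perfect (cell a).
Proof. exact: perfect_stalk regular_fin_gen regular_projective. Qed.

Lemma cell_cofibrant a : cofibrant (cell a).
Proof. exact/perfect_cofibrant/cell_perfect. Qed.

Definition cell1 a : cell a a := stalk_in a (1 : (A^c)^o).

Section CellMap.
Variables (Y : complex A) (a : int) (y : Y a).
Hypothesis dy : cdiff Y a y = 0.

Fact cell_map_subproof x : cdiff Y a (mklin (scalar_linear y) x) = 0.
Proof. by rewrite mklinE /scalar_fun linearZ /= dy scaler0. Qed.
Definition cell_map : chmap (cell a) Y := stalk_map cell_map_subproof.

Lemma cell_map1 : cell_map a (cell1 a) = y.
Proof. by rewrite /cell_map stalk_mapE mklinE /scalar_fun scale1r. Qed.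
End CellMap.

End Perfect.

(** * Homology classes as morphisms out of cells *)

Section Detection.
Context {k : comPzRingType} {A : kalg k}.
Implicit Types X Y Z K P : complex A.

Lemma cell_cycle Y a (u : chmap (cell a) Y) : cdiff Y a (u a (cell1 a)) = 0.
Proof. by rewrite -cmapE linear0. Qed.

Lemma cell_ext Y a (u v : chmap (cell a) Y) :
  u a (cell1 a) = v a (cell1 a) -> forall n x, u n x = v n x.
Proof.
move=> uv; apply: stalk_ext => y.
have -> : stalk_in a y = (y : A^c) *: cell1 a.
  by apply: submod_inj; rewrite -[RHS]/(y * 1 : A^c) mulr1.
by rewrite !linearZ uv.
Qed.

Lemma bdry_dmap0 Y a (u : chmap (cell a) Y) :
  bdry (u a (cell1 a)) -> dmap u = hzero (cell a : derived A) Y.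
Proof.
move: a u; apply: int_succ => a u /bdryS [y uy].
apply/dmap_heq/homotopic_heq; pose f := mklin (scalar_linear y).
exists (fun n => stalk_fam (a := a) f n \o subval (stalkmod _ (a + 1) (n + 1))) => n x.
rewrite (_ : cdiff (cell (a + 1)) _ x = 0) // linear0 addr0.
rewrite -[X in _ = X + _]/(0 : Y (n + 1)) add0r.
have [an|na] := eqVneq a n; last first.
  have -> : x = 0.
    by apply: submod_inj; apply: stalk_val; apply: contra_neq na => /addIr.
  by rewrite !linear0.
case: n / an x => x; rewrite /= /stalk_fam dfwith_in.
have -> : x = (sval x : A^c) *: cell1 (a + 1).
  by apply: submod_inj; rewrite -[RHS]/(sval x * 1 : A^c) mulr1.
rewrite linearZ uy -linearZ /=; congr (cdiff Y a _).
by rewrite -[RHS]/(((sval x : A^c) * 1) *: y) mulr1.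
Qed.

(** [bdry_dmap0] and this lemma identify the homology of [Y] in degree [a] with the
    morphisms from [cell a] to [Y]. *)
Lemma dmap0_bdry Y a (u : chmap (cell a) Y) :
  dmap u = hzero (cell a : derived A) Y -> bdry (u a (cell1 a)).
Proof.
move=> /(dmap_inj (@cell_cofibrant _ _ a) (v := chzero _ _)) [K [aK [w [t uE]]]].
rewrite uE add0r; apply: bdry_map; apply: aK.
exact: cell_cycle.
Qed.

Lemma iso_dmap_qis X Y (s : chmap X Y) : is_iso (dmap s) -> quasi_iso s.
Proof.
move=> iso_s; apply/qisP; split=> n.
  move=> x dx bx; rewrite -(cell_map1 dx); apply: dmap0_bdry.
  apply: (iso_mono iso_s); rewrite compm0 -dmap_comp; apply: bdry_dmap0.
  by rewrite -[X in bdry X]/(s n (cell_map dx n (cell1 n))) cell_map1.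
move=> y dy; have [g [_ sg]] := iso_s.
have [u uE] := dhom_chain (@cell_cofibrant _ _ n) (g ∘ dmap (cell_map dy)).
have : dmap (cell_map dy) = dmap (chcomp s u) by rewrite dmap_comp -uE compA sg comp1m.
move=> /(dmap_inj (@cell_cofibrant _ _ n)) [K [aK [w [t eqE]]]].
exists (u n (cell1 n)); split; first exact: cell_cycle.
have := eqE n (cell1 n); rewrite cell_map1 => ->.
rewrite -[chcomp _ _ _ _]/(s n (u n (cell1 n))) addrC addrA addNr add0r.
by apply: bdry_map; apply: aK; apply: cell_cycle.
Qed.

Definition eps X : hom (resolution X : derived A) X := dmap (res_eps X).
Lemma eps_iso X : is_iso (eps X).
Proof. exact/dmap_qis/res_eps_qis. Qed.

(** Cells detect isomorphisms: after a resolution of the source, [g] is a chain map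
    and the hypotheses say that it is a quasi-isomorphism. *)
Lemma cells_iso X Y (g : hom (X : derived A) Y) :
  (forall n (f : hom (cell n : derived A) Y), exists f', f = g ∘ f') ->
  (forall n (f : hom (cell n : derived A) X), g ∘ f = hzero _ _ -> f = hzero _ _) ->
  is_iso g.
Proof.
move=> gs gi; have [u uE] := dhom_chain (@res_cofibrant _ _ X) (g ∘ eps X).
suff qu : quasi_iso u.
  by apply: (iso_cancel_right (eps_iso X)); rewrite uE; apply: dmap_qis.
apply/qisP; split=> n.
  move=> x dx bx; rewrite -(cell_map1 dx); apply: dmap0_bdry.
  apply: (iso_mono (eps_iso X)); rewrite compm0; apply: gi.
  rewrite compA uE -dmap_comp; apply: bdry_dmap0.
  by rewrite -[X in bdry X]/(u n (cell_map dx n (cell1 n))) cell_map1.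
move=> y dy; have [f' fE] := gs _ (dmap (cell_map dy)).
have [e' [_ ee']] := eps_iso X.
have [v vE] := dhom_chain (@cell_cofibrant _ _ n) (e' ∘ f').
have : dmap (cell_map dy) = dmap (chcomp u v).
  by rewrite dmap_comp -uE -vE -compA [eps X ∘ _]compA ee' comp1m.
move=> /(dmap_inj (@cell_cofibrant _ _ n)) [K [aK [w [t eqE]]]].
exists (v n (cell1 n)); split; first exact: cell_cycle.
have := eqE n (cell1 n); rewrite cell_map1 => ->.
rewrite -[chcomp _ _ _ _]/(u n (v n (cell1 n))) addrC addrA addNr add0r.
by apply: bdry_map; apply: aK; apply: cell_cycle.
Qed.

(** * Coproducts in the derived category *)

Lemma dscproj_in (I : eqType) (X : I -> complex A) i n x :
  dscproj X i n (dscin X i n x) = x.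
Proof. exact: (@dsproj_in _ _ (fun i => X i n)). Qed.

Lemma dscproj_out (I : eqType) (X : I -> complex A) i j n x : i != j ->
  dscproj X j n (dscin X i n x) = 0.
Proof. exact: (@dsproj_out _ _ (fun i => X i n)). Qed.

Definition dsum_in (I : eqType) (X : I -> complex A) i : hom (X i : derived A) (dsumc X) :=
  dmap (dscin X i).

(** Direct sums of cofibrant complexes are coproducts: chain maps on the summands
    can be glued, and so can their factorizations through acyclic complexes. *)
Lemma dsumc_coproduct_cof (I : eqType) (V : I -> complex A) :
  (forall i, cofibrant (V i)) ->
  coproduct (C := derived A) (dsum_in V).
Proof.
move=> cV W f.
pose u i := sval (cid (dhom_chain (cV i) (f i))).
have uE i : f i = dmap (u i) by rewrite /u; case: cid.
exists (dmap (dscopair u)); split.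
  by move=> i; rewrite uE -dmap_comp; apply: dmap_ext => n x; apply: dscopair_in.
move=> g' g'E; have [v vE] := dhom_chain (cofibrant_dsumc cV) g'.
have hv i : heq (chcomp v (dscin V i)) (u i).
  by apply: (dmap_inj (cV i)); rewrite dmap_comp -vE -uE; exact: g'E.
pose K i := sval (cid (hv i)).
have KP i : acyclic (K i) /\ exists (w : chmap (V i) (K i)) (t : chmap (K i) W),
    forall n x, v n (dscin V i n x) = u i n x + t n (w n x).
  by rewrite /K; case: cid.
pose w i := sval (cid (KP i).2).
have wP i : exists t : chmap (K i) W,
    forall n x, v n (dscin V i n x) = u i n x + t n (w i n x).
  by rewrite /w; case: cid.
pose t i := sval (cid (wP i)).
have tP i : forall n x, v n (dscin V i n x) = u i n x + t i n (w i n x).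
  by rewrite /t; case: cid.
rewrite vE; apply: dmap_heq; exists (dsumc K).
split; first by apply: dsc_acyclic => i; have [] := KP i.
exists (dscmap w), (dscopair t) => n x.
apply: (dsum_ext (f := v n) (g := dscopair u n \+ (dscopair t n \o dscmap w n))) => i y.
rewrite -[LHS]/(v n (dscin V i n y)) tP.
rewrite -[RHS]/(dscopair u n (dscin V i n y) + dscopair t n (dscmap w n (dscin V i n y))).
by rewrite dscmap_in !dscopair_in.
Qed.

Lemma dsumc_coproduct (I : eqType) (X : I -> complex A) :
  coproduct (C := derived A) (dsum_in X).
Proof.
pose V i := resolution (X i); pose s i := res_eps (X i).
have cV := dsumc_coproduct_cof (fun i => @res_cofibrant _ _ (X i)).
have iso_s : is_iso (dmap (dscmap s)).
  by apply: dmap_qis; apply: dscmap_qis => i; apply: res_eps_qis.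
pose q i := sval (cid (eps_iso (X i))).
have qP i : q i ∘ eps (X i) = idm _ /\ eps (X i) ∘ q i = idm _ by rewrite /q; case: cid.
have qiso i : is_iso (q i) by exists (eps (X i)); have [? ?] := qP i.
have := coprod_iso cV iso_s qiso.
congr coproduct; apply: functional_extensionality_dep => i.
have -> : dmap (dscmap s) ∘ dsum_in V i = dsum_in X i ∘ eps (X i).
  rewrite /dsum_in /eps -!dmap_comp; apply: dmap_ext => n x; exact: dscmap_in.
by rewrite -compA; have [_ ->] := qP i; rewrite compm1.
Qed.

Lemma dmap_sum_fin (I : eqType) (V : I -> complex A) P (u : chmap P (dsumc V)) (s : seq I) :
  (forall n x, u n x = \sum_(i <- s) dscin V i n (dscproj V i n (u n x))) ->
  dmap u = foldr (fun i f => hadd (dsum_in V i ∘ dmap (chcomp (dscproj V i) u)) f)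
     (hzero (P : derived A) (dsumc V)) s.
Proof.
move=> uE; pose v := foldr (fun i f => chadd (chcomp (dscin V i) (chcomp (dscproj V i) u)) f)
  (chzero P (dsumc V)) s.
transitivity (dmap v).
  apply: dmap_ext => n x; rewrite uE /v; elim: s {uE v} => [|i s IH].
    by rewrite big_nil.
  by rewrite big_cons IH.
rewrite /v; elim: s {uE v} => [//|i s IH].
rewrite -[LHS]/(dmap (chadd _ (foldr _ _ s))) dmap_add IH.
rewrite -[RHS]/(hadd (dsum_in V i ∘ dmap (chcomp (dscproj V i) u)) (foldr _ _ s)).
by rewrite -dmap_comp.
Qed.

(** Finitely many degrees matter, in each of them finitely many generators, and
    the image of a generator has finite support. *)
Lemma perfect_finite (I : eqType) (V : I -> complex A) P (u : chmap P (dsumc V)) :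
  perfect P -> exists s, forall n x,
    u n x = \sum_(i <- s) dscin V i n (dscproj V i n (u n x)).
Proof.
move=> [[m bP] fP].
have fin n : exists s : seq I, forall x, forall i, dsproj i (u n x) != 0 -> i \in s.
  have [[r [e eP]] _] := fP n.
  pose S j := sval (cid (supportsP (u n (e j)))).
  have SP j : forall i, dsproj i (u n (e j)) != 0 -> i \in S j.
    by rewrite /S; case: cid => ? [].
  exists (flatten [seq S j | j <- enum 'I_r]) => x i.
  have [c ->] := eP x; rewrite !linear_sum.
  apply: contraNT => /flattenP Si; rewrite big1 // => j _.
  rewrite [LHS](_ : _ = c j *: dsproj i (u n (e j))); last by rewrite !linearZ.
  have [->|] := eqVneq (dsproj i (u n (e j))) 0; first by rewrite scaler0.
  move=> /SP Sj; case: Si; exists (S j) => //.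
  by apply/mapP; exists j; rewrite ?mem_enum.
pose S n := sval (cid (fin n)).
have SP n : forall x i, dsproj i (u n x) != 0 -> i \in S n by rewrite /S; case: cid.
pose T := flatten [seq S j%:Z ++ S (- j%:Z) | j <- iota 0 m.+1].
exists (undup T) => n x; apply: dsum_decomp; split; first exact: undup_uniq.
move=> i ui; rewrite mem_undup; apply/flattenP.
have nm : (`|n| <= m)%N.
  rewrite leqNgt; apply: contra_neqN ui => mn.
  by rewrite (bP _ mn x) !linear0.
exists (S `|n|%N%:Z ++ S (- `|n|%N%:Z)).
  by apply/mapP; exists `|n|%N; rewrite // mem_iota.
rewrite mem_cat; have [nE|nE] : n = `|n|%N%:Z \/ n = - `|n|%N%:Z by lia.
  by rewrite -nE (SP n x i ui).
by rewrite -nE (SP n x i ui) orbT.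
Qed.

Lemma perfect_fin_sum (I : eqType) (V : I -> complex A) P
    (f : hom (P : derived A) (dsumc V)) : perfect P -> fin_sum (dsum_in V) f.
Proof.
move=> pP; have [u ->] := dhom_chain (perfect_cofibrant pP) f.
have [s /dmap_sum_fin ->] := perfect_finite u pP.
elim: s => [|i s IH]; first exact: (@fin_sum0 _ (derived A)).
exact: (@fin_sumD _ (derived A)).
Qed.

Lemma perfect_compact P : perfect P -> compact (C := derived A) P.
Proof.
move=> pP I Yi Y iota cY f.
have [e [[e' [e'e ee']] eE]] := coprod_unique (dsumc_coproduct (X := Yi)) cY (fun i => is_iso_id (Yi i)).
rewrite -(comp1m f) -ee' -compA.
apply: (fin_sum_compl _ (perfect_fin_sum (e' ∘ f) pP)) => i.
by rewrite eE compm1 -(compm1 (iota i)); apply: fin_sum1.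
Qed.

Lemma Kbproj_compact X : Kbproj (X : derived A) -> compact (C := derived A) X.
Proof.
by move=> /KbprojP [P pP PX]; apply: compact_iso PX _; apply: perfect_compact.
Qed.

(** The comparison map from the direct sum of the [Yi] to [Y] is surjective on
    homology by the hypothesis on cells, and injective because the projections
    of [Y] recover the components. *)
Lemma cells_coproduct (I : eqType) (Yi : I -> derived A) (Y : derived A)
    (iota : forall i, hom (Yi i) Y) (pi : forall i, hom Y (Yi i)) :
  (forall i, pi i ∘ iota i = idm (Yi i)) ->
  (forall i j, i != j -> pi j ∘ iota i = hzero _ _) ->
  (forall n (f : hom (cell n : derived A) Y), fin_sum iota f) ->
  coproduct iota.
Proof.
move=> pi1 pi0 fin.
have cE := dsumc_coproduct (X := Yi).
have [g [gE _]] := cE _ iota.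
have piE i : pi i ∘ g = dmap (dscproj Yi i).
  apply: (coprod_epi cE) => j; rewrite -compA gE /dsum_in -dmap_comp.
  have [ij|ij] := eqVneq j i.
    case: i / ij; rewrite pi1; apply: dmap_ext => n x; exact: (esym (dscproj_in (X := Yi) x)).
  by rewrite pi0 //; apply: dmap_ext => n x; exact: (esym (dscproj_out (X := Yi) x ij)).
suff iso_g : is_iso g.
  have := coprod_iso cE iso_g (fun i => is_iso_id (Yi i)).
  by congr coproduct; apply: functional_extensionality_dep => i; rewrite gE compm1.
apply: cells_iso => n f.
  by apply: fin_sum_factor (fin n f) => i; exists (dsum_in _ i).
have [u ->] := dhom_chain (@cell_cofibrant _ _ n) f => gu.
have [s /dmap_sum_fin ->] := perfect_finite u (@cell_perfect _ _ n).
elim: s => [//|i s IH].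
rewrite -[LHS]/(hadd (dsum_in _ i ∘ dmap (chcomp (dscproj _ i) u)) (foldr _ _ s)).
by rewrite IH hadd0r dmap_comp -piE -compA gu !compm0.
Qed.

(** [cells_coproduct] read on chain maps: a map out of a cell is given by one
    element. *)
Lemma chain_coproduct (I : eqType) (X : I -> complex A) Y
    (iota : forall i, chmap (X i) Y) (pi : forall i, chmap Y (X i)) :
  (forall i n x, pi i n (iota i n x) = x) ->
  (forall i j n x, i != j -> pi j n (iota i n x) = 0) ->
  (forall n y, exists s, y = \sum_(i <- s) iota i n (pi i n y)) ->
  coproduct (C := derived A) (fun i => dmap (iota i)).
Proof.
move=> pi1 pi0 fin; apply: (@cells_coproduct _ _ _ _ (fun i => dmap (pi i))).
- by move=> i; rewrite -dmap_comp; apply: dmap_ext => n x; apply: pi1.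
- by move=> i j ij; rewrite -dmap_comp; apply: dmap_ext => n x; apply: pi0.
move=> n f; have [u ->] := dhom_chain (@cell_cofibrant _ _ n) f.
have [s sE] := fin n (u n (cell1 n)).
have -> : dmap u = dmap (foldr (fun i v => chadd (chcomp (iota i) (chcomp (pi i) u)) v)
    (chzero _ _) s).
  apply: dmap_ext; apply: cell_ext; rewrite sE; elim: s {sE} => [|i s IH].
    by rewrite big_nil.
  by rewrite big_cons IH.
elim: s {sE} => [|i s IH]; first exact: (@fin_sum0 _ (derived A)).
rewrite -[foldr _ _ _]/(chadd _ (foldr _ _ s)) dmap_add dmap_comp.
exact: fin_sumD.
Qed.

End Detection.

(** * Compact objects are bounded complexes of projectives *)

Section Truncation.
Context {k : comPzRingType} {A : kalg k}.
Implicit Types X Y Z K P R : complex A.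

(** Idempotents with image quasi-isomorphic to [P] are how [P] is truncated:
    the image is a summand of [P], so it inherits cofibrancy and projective terms. *)
Lemma idem_image P (e : chmap P P) :
  (forall n x, e n (e n x) = e n x) ->
  (forall n x, cdiff P n x = 0 -> bdry (x - e n x)) ->
  exists R (i : chmap R P) (r : chmap P R),
    [/\ forall n x, r n (i n x) = x, forall n x, i n (r n x) = e n x & quasi_iso i].
Proof.
move=> ee eb.
pose N n : submodule (P n) := @Submodule _ (P n) (fun x => e n x = x)
  (linear0 (e n)) ltac:(by move=> a x y /= ex ey; rewrite linearP ex ey).
have dN n x : N n x -> N (n + 1) (cdiff P n x) by move=> Nx; rewrite /= cmapE Nx.
have eN n x : N n (e n x) by exact: ee.
exists (subcx dN), (subcx_incl dN), (subcx_lift dN eN); split=> //.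
  by move=> n [x Nx]; apply: submod_inj.
apply/qisP; split=> n.
  move=> y _ /= bx; have -> : y = subcx_lift dN eN n (sval y).
    by apply: submod_inj; apply/esym/(svalP y).
  exact: bdry_map.
move=> y dy; exists (subcx_lift dN eN n y); split; last exact: eb.
by rewrite -cmapE dy linear0.
Qed.

(** [P] is exact at [n] and the boundaries in degree [n + 1] are a direct
    summand. *)
Definition split_at P n := exists h : {linear P (n + 1) -> P n},
  forall x, bdry (x - h (cdiff P n x)).

Lemma split_exact P n x : split_at P n -> cdiff P n x = 0 -> bdry x.
Proof. by move=> [h hE] dx; have := hE x; rewrite dx linear0 subr0. Qed.

Lemma split_d P n (h : {linear P (n + 1) -> P n}) :
  (forall x, bdry (x - h (cdiff P n x))) ->
  forall x, cdiff P n (h (cdiff P n x)) = cdiff P n x.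
Proof.
by move=> hE x; apply/eqP; rewrite eq_sym -subr_eq0 -linearB (bdry_cycle (hE x)).
Qed.

(** Below [n] everything is discarded, and in degree [n + 1] only the complement of
    the boundaries given by the splitting is kept.  These projections form an
    idempotent chain map. *)
Lemma trunc_low P n : split_at P n ->
  (forall j (x : P j), j < n -> cdiff P j x = 0 -> bdry x) ->
  exists R (i : chmap R P) (r : chmap P R),
    [/\ forall m x, r m (i m x) = x, quasi_iso i &
        forall j (x : R j), j <= n -> x = 0].
Proof.
move=> sP exP; have [h hE] := sP; have dhd := split_d hE.
pose e0 j : {linear P j -> P j} := 
  if j <= n then (\0 : {linear P j -> P j}) else (idfun : {linear P j -> P j}).
pose e1 : {linear P (n + 1) -> P (n + 1)} := idfun \- (cdiff P n \o h).
have e1E y : e1 y = y - cdiff P n (h y) by [].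
pose e j := dfwith e0 e1 j.
have e_in : e (n + 1) = e1 by apply: dfwith_in.
have e_low j : j <= n -> forall x, e j x = 0.
  by move=> jn x; rewrite /e dfwith_out ?/e0 ?jn //; lia.
have e_high j : n + 1 < j -> forall x, e j x = x.
  by move=> jn x; rewrite /e dfwith_out ?/e0 ?ifF //; lia.
have case_j j : [\/ j < n, j = n, j = n + 1 | n + 1 < j].
  by have [] := ltrgtP j n; have [] := ltrgtP j (n + 1); try lia; constructor.
have ed j x : e (j + 1) (cdiff P j x) = cdiff P j (e j x).
  have [jn|jn|jn|jn] := case_j j.
  - by rewrite !e_low ?linear0 //; lia.
  - by rewrite {j}jn in x *; rewrite e_in e1E dhd subrr e_low // linear0.
  - rewrite {j}jn in x *; rewrite e_high ?e_in ?e1E ?linearB ?cdiffK ?subr0 //; lia.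
  - by rewrite !e_high //; lia.
have [||R [i [r [ri ir qi]]]] := @idem_image P (ChMap ed).
- move=> j x /=; have [jn|jn|jn|jn] := case_j j.
  - by rewrite !e_low //; lia.
  - by rewrite !e_low //; lia.
  - by rewrite {j}jn in x *; rewrite e_in !e1E linearB linearB /= dhd subrr subr0.
  - by rewrite !e_high.
- move=> j x dx /=; have [jn|jn|jn|jn] := case_j j.
  - by rewrite e_low ?subr0; [apply: exP | lia].
  - by rewrite {j}jn in x dx *; rewrite e_low // subr0; apply: split_exact sP dx.
  - by rewrite {j}jn in x dx *; rewrite e_in e1E opprB addrCA subrr addr0; apply: bdry_d.
  - by rewrite e_high // subrr; apply: bdry0.
exists R, i, r; split=> // j x jn.
have ix : i j x = 0 by rewrite -{1}(ri _ x) ir /= e_low.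
by rewrite -(ri _ x) ix linear0.
Qed.

(** Above [n] everything is discarded, and in degree [n] only the cycles are kept,
    onto which the splitting projects. *)
Lemma trunc_high P n : split_at P n ->
  (forall j (x : P j), n < j -> cdiff P j x = 0 -> bdry x) ->
  exists R (i : chmap R P) (r : chmap P R),
    [/\ forall m x, r m (i m x) = x, quasi_iso i &
        forall j (x : R j), n < j -> x = 0].
Proof.
move=> sP exP; have [h hE] := sP; have dhd := split_d hE.
pose e0 j : {linear P j -> P j} := 
  if j <= n then (idfun : {linear P j -> P j}) else (\0 : {linear P j -> P j}).
pose e1 : {linear P n -> P n} := idfun \- (h \o cdiff P n).
have e1E y : e1 y = y - h (cdiff P n y) by [].
pose e j := dfwith e0 e1 j.
have e_in : e n = e1 by apply: dfwith_in.
have e_low j : j < n -> forall x, e j x = x.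
  by move=> jn x; rewrite /e dfwith_out ?/e0 ?ifT //; lia.
have e_high j : n < j -> forall x, e j x = 0.
  by move=> jn x; rewrite /e dfwith_out ?/e0 ?ifF //; lia.
have e_cycle m x : m = n -> cdiff P m x = 0 -> e m x = x.
  by move=> mn; rewrite {m}mn in x *; rewrite e_in e1E => ->; rewrite linear0 subr0.
have ed j x : e (j + 1) (cdiff P j x) = cdiff P j (e j x).
  have [jn|jn|jn] := ltrgtP j n.
  - rewrite [e j x]e_low //; have [jn1|jn1] := eqVneq (j + 1) n.
      by rewrite e_cycle // cdiffK.
    by rewrite e_low //; lia.
  - by rewrite !e_high ?linear0 //; lia.
  - rewrite {j}jn in x *; rewrite e_in e1E linearB dhd subrr e_high //; lia.
have [||R [i [r [ri ir qi]]]] := @idem_image P (ChMap ed).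
- move=> j x /=; have [jn|jn|jn] := ltrgtP j n; first by rewrite !e_low.
    by rewrite !e_high.
  by rewrite {j}jn in x *; rewrite e_in !e1E linearB dhd subrr linear0 subr0.
- move=> j x dx /=; have [jn|jn|jn] := ltrgtP j n.
  - by rewrite e_low // subrr; apply: bdry0.
  - by rewrite e_high ?subr0 //; apply: exP.
  - rewrite {j}jn in x dx *; rewrite e_in e1E dx linear0 subr0 subrr; exact: bdry0.
exists R, i, r; split=> // j x jn.
have ix : i j x = 0 by rewrite -{1}(ri _ x) ir /= e_high.
by rewrite -(ri _ x) ix linear0.
Qed.

Lemma split_retract P R (i : chmap R P) (r : chmap P R) n :
  (forall x, r n (i n x) = x) -> split_at P n -> split_at R n.
Proof.
move=> ri [h hE]; exists (r n \o (h \o i (n + 1))) => x.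
rewrite -{1}(ri x) -[X in _ - X]/(r n (h (i (n + 1) (cdiff R n x)))).
by rewrite cmapE -linearB; apply: bdry_map.
Qed.

Section CompactSplit.
Variable P : complex A.
Hypotheses (cP : cofibrant P) (pP : forall n, projective (P n)).

(** The single cokernel [P n / B n], placed in degree [n], as a quotient
    complex of [P]. *)
Definition cokmod (n i : int) : submodule (P i).
Proof.
refine (@Submodule _ (P i) (fun x => i = n -> bdry x) _ _) => [_|a x y bx b_y iN].
  exact: bdry0.
by apply: bdry_lin; auto.
Defined.
Fact cokmod_d n i x : cokmod n i x -> cokmod n (i + 1) (cdiff P i x).
Proof. by move=> _ _; apply: bdry_d. Qed.
Definition cokcx n : complex A := quocx (@cokmod_d n).
Definition cok_proj n : chmap P (cokcx n) := quocx_proj (@cokmod_d n).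

Lemma cok_zero n i (x : cokcx n i) : i != n -> x = 0.
Proof.
move=> iN; have [y <-] := quo_surj x; apply/quo_eq0 => iN'.
by rewrite iN' eqxx in iN.
Qed.

(** Every degree meets only one of these quotients, so [P] maps to their direct
    sum. *)
Fact cok_sum_subproof i x :
  dsin (M := fun n => cokcx n (i + 1)) (i + 1) (cok_proj (i + 1) (i + 1) (cdiff P i x))
    = cdiff (dsumc cokcx) i (dsin (M := fun n => cokcx n i) i (cok_proj i i x)).
Proof.
rewrite -[RHS](cmapE (dscin cokcx i) (cok_proj i i x)).
rewrite [cdiff (cokcx i) _ _]cok_zero; last by lia.
have -> : cok_proj (i + 1) (i + 1) (cdiff P i x) = 0.
  by apply/quo_eq0 => _; apply: bdry_d.
by rewrite !linear0.
Qed.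
Definition cok_sum : chmap P (dsumc cokcx) :=
  @ChMap _ _ P (dsumc cokcx)
    (fun i => dsin (M := fun n => cokcx n i) i \o cok_proj i i) cok_sum_subproof.

Lemma cok_sum_proj n i x : dscproj cokcx n i (cok_sum i x) = cok_proj n i x.
Proof.
rewrite -[cok_sum i x]/(dscin cokcx i i (cok_proj i i x)).
have [iN|iN] := eqVneq i n; first by case: n / iN; apply: dscproj_in.
by rewrite dscproj_out // [RHS]cok_zero.
Qed.

(** By compactness almost all components [P -> P n / B n] vanish in the derived
    category.  A nullhomotopy of such a component, lifted to [P n], is a splitting
    of [P] in degree [n]. *)
Lemma compact_split : compact (C := derived A) P ->
  exists N : nat, forall n : int, (N < `|n|)%N -> split_at P n.
Proof.
move=> compP.
have fin f : fin_sum (dsum_in cokcx) f -> exists N : nat, forall n : int, (N < `|n|)%N ->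
    dmap (dscproj cokcx n) ∘ f = hzero (P : derived A) (cokcx n).
  elim=> [|i a f' _ [N NE]]; first by exists 0%N => n _; rewrite compm0.
  exists (maxn N `|i|%N) => n; rewrite gtn_max => /andP [Nn iN].
  rewrite compDr NE // hadd0r compA /dsum_in -dmap_comp.
  have -> : dmap (chcomp (dscproj cokcx n) (dscin cokcx i)) = hzero (cokcx i : derived A) _.
    apply: dmap_ext => m x; apply: dscproj_out.
    by apply: contraTneq iN => ->; rewrite ltnn.
  exact: comp0m.
have [N NE] := fin _ (compP _ _ _ _ (dsumc_coproduct (X := cokcx)) (dmap cok_sum)).
exists N; apply: int_succ => n nN.
have : dmap (cok_proj (n + 1)) = dmap (chzero P (cokcx (n + 1))).
  rewrite -[RHS](NE _ nN) -dmap_comp; apply: dmap_ext => i x; exact/esym/cok_sum_proj.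
move=> /(dmap_inj cP) /(cofibrant_homotopic cP) [h hE].
have [h' h'E] := @pP _ _ _ (quo (cokmod (n + 1) (n + 1))) (h (n + 1)) (@quo_surj _ _ _).
exists h' => x; apply: (iffLR (quo_eq0 (cokmod (n + 1) (n + 1)) _)) => //.
rewrite linearB h'E.
have := hE n x; rewrite [h n x]cok_zero; last by lia.
rewrite linear0 add0r -[X in _ = X + _]/(0 : cokcx (n + 1) (n + 1)) add0r => qE.
by apply/eqP; rewrite subr_eq0; apply/eqP; exact: qE.
Qed.

End CompactSplit.

Definition within P (a : int) (l : nat) :=
  forall (j : int) (x : P j), (j < a) || (a + l%:Z < j) -> x = 0.

Lemma within_bounded P a l : within P a l -> bounded P.
Proof. by move=> wP; exists (`|a| + l)%N => n an x; apply: wP; lia. Qed.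

Lemma within_cofibrant P a l : (forall n, projective (P n)) -> within P a l ->
  cofibrant P.
Proof. by move=> pP wP; apply: bounded_cofibrant => //; apply: within_bounded wP. Qed.

Lemma compact_bounded X : compact (C := derived A) X ->
  exists P a l, [/\ within P a l, forall n, projective (P n) &
    isomorphic (P : derived A) X].
Proof.
move=> compX; pose P := resolution X.
have PX : isomorphic (P : derived A) X by exists (eps X); apply: eps_iso.
have [N sP] := compact_split (@res_cofibrant _ _ X) (@res_projective _ _ X)
  (compact_iso (isomorphic_sym PX) compX).
have [||R [i [r [ri qi R0]]]] := @trunc_high P (N%:Z + 1).
- by apply: sP; lia.
- by move=> j x jN; apply: split_exact; apply: sP; lia.
have sR (j : int) : (N < `|j|)%N -> split_at R j.
  by move=> Nj; apply: split_retract (sP j Nj) => x; apply: ri.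
have [||S [i' [r' [ri' qi' S0]]]] := @trunc_low R (- N%:Z - 1).
- by apply: sR; lia.
- by move=> j x jN; apply: split_exact; apply: sR; lia.
exists S, (- N%:Z), (N + N + 1)%N; split.
- move=> j x /orP [jN|jN]; first by apply: S0; lia.
  by rewrite -(ri' _ x) (R0 _ (i' j x)) ?linear0 //; lia.
- move=> n; apply: (proj_retract (ri' n)); apply: (proj_retract (ri n)).
  exact: res_projective.
exists (eps X ∘ (dmap i ∘ dmap i')).
by apply: is_iso_comp; [apply: eps_iso | apply: is_iso_comp; apply: dmap_qis].
Qed.

End Truncation.

(** * Devissage of compact complexes *)

Section ProductModules.
Variable A : pzRingType.
Variables M N : rmodType A.

Lemma fin_gen_prod : fin_gen M -> fin_gen N -> fin_gen ((M * N)%type : rmodType A).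
Proof.
move=> [m [e eM]] [n [f fN]].
exists (m + n)%N, (fun i => match split i with inl j => (e j, 0) | inr j => (0, f j) end).
move=> [x y]; have [c xE] := eM x; have [d yE] := fN y.
exists (fun i => match split i with inl j => c j | inr j => d j end).
have sl i : split (lshift n i) = inl i :> 'I_m + 'I_n by exact: (unsplitK (inl i)).
have sr i : split (rshift m i) = inr i :> 'I_m + 'I_n by exact: (unsplitK (inr i)).
rewrite big_split_ord /=.
under eq_bigr => i _ do rewrite sl.
under [X in _ = _ + X]eq_bigr => i _ do rewrite sr.
have inl_lin : linear (fun x : M => (x, 0) : M * N).
  by move=> a u v; congr pair; rewrite /= scaler0 addr0.
have inr_lin : linear (fun y : N => (0, y) : M * N).
  by move=> a u v; congr pair; rewrite /= scaler0 addr0.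
have <- : (x, 0) = \sum_(i < m) c i *: (e i, 0) :> M * N.
  rewrite xE -[LHS]/(mklin inl_lin (\sum_i c i *: e i)) linear_sum.
  by apply: eq_bigr => i _; rewrite linearZ.
have <- : (0, y) = \sum_(i < n) d i *: (0, f i) :> M * N.
  rewrite yE -[LHS]/(mklin inr_lin (\sum_i d i *: f i)) linear_sum.
  by apply: eq_bigr => i _; rewrite linearZ.
by congr pair; rewrite /= ?addr0 ?add0r.
Qed.

Lemma projective_prod : projective M -> projective N ->
  projective ((M * N)%type : rmodType A).
Proof.
move=> pM pN U V p f ps.
have inl_lin : linear (fun x : M => (x, 0) : M * N).
  by move=> a x y; congr pair; rewrite /= scaler0 addr0.
have inr_lin : linear (fun y : N => (0, y) : M * N).
  by move=> a x y; congr pair; rewrite /= scaler0 addr0.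
have [g gE] := pM _ _ p (f \o mklin inl_lin) ps.
have [h hE] := pN _ _ p (f \o mklin inr_lin) ps.
have gh_lin : linear (fun xy : M * N => g xy.1 + h xy.2).
  by move=> a x y; rewrite !linearP scalerDr addrACA.
exists (mklin gh_lin) => -[x y].
rewrite -[LHS]/(p (g x + h y)) linearD gE hE.
rewrite -[X in X + _]/(f (x, 0)) -[X in _ + X]/(f (0, y)) -linearD; congr (f _).
by congr pair; rewrite /= ?addr0 ?add0r.
Qed.

End ProductModules.

Section BottomDegree.
Context {k : comPzRingType} {A : kalg k}.
Implicit Types X Y Z K P R : complex A.

Lemma qis_inj_surj X Y (f : chmap X Y) : (forall n x, f n x = 0 -> x = 0) ->
  (forall n y, exists x, f n x = y) -> quasi_iso f.
Proof.
move=> fi fs; pose g n y := sval (cid (fs n y)).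
have gK n : cancel (g n) (f n) by move=> y; rewrite /g; case: cid.
apply: (qis_bij (g := g)) => // n x.
by apply/eqP; rewrite -subr_eq0; apply/eqP/fi; rewrite linearB gK subrr.
Qed.

Lemma zero_below P (a n : int) (x : P n) : (forall j (x : P j), j < a -> x = 0) ->
  n + 1 = a -> x = 0.
Proof. by move=> P0 na; apply: P0; rewrite -na; lia. Qed.

(** Compactness makes the lowest term of [P] finitely generated up to a
    correction that factors through the next term.  The map into a direct sum
    of cells that is tested is a splitting of [P a] off the free module on its
    elements. *)
Lemma compact_bottom P (a : int) : cofibrant P -> projective (P a) ->
  (forall j (x : P j), j < a -> x = 0) -> compact (C := derived A) P ->
  exists (G : rmodType A) (alpha : {linear P a -> G}) (y : {linear G -> P a})
    (H : {linear P (a + 1) -> P a}),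
    [/\ fin_gen G, projective G & forall p, p = y (alpha p) + H (cdiff P a p)].
Proof.
move: a; apply: int_succ => b; set a := b + 1 => cP pPa P0 compP.
pose I : eqType := P a.
pose V (_ : I) := cell a : complex A.
have [sigma sigmaE] : exists s : {linear P a -> freemod A^c I},
    forall p, freelin (fun x : I => (x : P a)) (s p) = p.
  apply: (pPa _ _ _ idfun) => p; exists (gen1 _ (p : I)); exact: freelin1.
pose cellin : {linear (A^c)^o -> cell a a} := mklin (@stalk_in_linear _ _ _ a).
pose g : {linear P a -> dsumc V a} := dsmap (fun _ : I => cellin) \o sigma.
pose u n : {linear P n -> dsumc V n} := 
  dfwith (fun j => \0 : {linear P j -> dsumc V j}) g n.
have dV n (x : dsumc V n) : cdiff (dsumc V) n x = 0.
  by apply: dsumP => i; rewrite dsmap_proj linear0.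
have uE n x : u (n + 1) (cdiff P n x) = cdiff (dsumc V) n (u n x).
  rewrite dV; have [na|na] := eqVneq a (n + 1).
    by rewrite (zero_below x P0 (esym na)) !linear0.
  by rewrite /u dfwith_out.
pose ev : {linear dsumc V a -> P a} :=
  copair (fun x : I => mklin (scalar_linear (x : P a)) \o subval (stalkmod _ a a)).
have ev_in (x : I) v : ev (dsin x v) = (sval v : A^c) *: (x : P a).
  by rewrite /ev copair_in.
have evu p : ev (u a p) = p.
  rewrite /u dfwith_in -{2}(sigmaE p).
  apply: (free_ext (f := ev \o dsmap (fun _ : I => cellin)) (g := freelin _)) => x.
  rewrite -[LHS]/(ev (dsmap _ (gen1 A^c x))) dsmap_in ev_in freelin1.
  exact: scale1r.
have fin f : fin_sum (dsum_in V) f -> forall v : chmap P (dsumc V), f = dmap v ->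
    exists (G : rmodType A) (alpha : {linear P a -> G}) (y : {linear G -> P a})
    (H : {linear P (a + 1) -> P a}),
    [/\ fin_gen G, projective G & forall p, ev (v a p) = y (alpha p) + H (cdiff P a p)].
  elim=> [|x w f' _ IH] v vE.
    have := dmap_inj cP (u := v) (v := chzero _ _) (esym vE).
    move=> /(cofibrant_homotopic cP) [h hE].
    exists ((A^c)^o : rmodType A), \0, \0, (ev \o h a).
    split; [exact: regular_fin_gen | exact: regular_projective | move=> p].
    by rewrite /= (hE b p) dV add0r add0r add0r.
  have [w' w'E] := dhom_chain cP w; have [v' v'E] := dhom_chain cP f'.
  have [G [alpha [y [H [fG pG yE]]]]] := IH _ v'E.
  have : dmap v = dmap (chadd (chcomp (dscin V x) w') v').
    by rewrite -vE dmap_add dmap_comp -w'E -v'E.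
  move=> /(dmap_inj cP) /(cofibrant_homotopic cP) [h hE].
  pose G' : rmodType A := ((A^c)^o * G)%type.
  have alpha_lin : linear (fun p => (sval (w' a p), alpha p) : G').
    by move=> c p q; rewrite !linearP.
  have y_lin : linear (fun cg : G' => (cg.1 : A^c) *: (x : P a) + y cg.2).
    move=> c p q; rewrite linearP scalerDr addrACA; congr (_ + _).
      by rewrite scalerDl -scalerA.
    exact: (linearP y).
  pose H' : {linear P (a + 1) -> P a} := H \+ (ev \o h a).
  exists G'; exists (mklin alpha_lin); exists (mklin y_lin); exists H'.
  split.
  - by apply: fin_gen_prod => //; apply: regular_fin_gen.
  - by apply: projective_prod => //; apply: regular_projective.
  move=> p; rewrite (hE b p) dV add0r linearD.
  rewrite -[chadd _ _ _ _]/(dsin x (w' a p) + v' a p) linearD ev_in yE.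
  rewrite -[RHS]/((sval (w' a p) : A^c) *: (x : P a) + y (alpha p) +
    (H (cdiff P a p) + ev (h a (cdiff P a p)))).
  by rewrite !addrA.
have [G [alpha [y [H [fG pG yE]]]]] := fin _
  (compP _ _ _ _ (dsumc_coproduct (X := V)) (dmap (ChMap uE))) _ erefl.
by exists G, alpha, y, H; split=> // p; rewrite -yE evu.
Qed.

End BottomDegree.

Section Extension.
Context {k : comPzRingType} {A : kalg k}.
Variables (P : complex A) (a : int) (G : rmodType A) (alpha : {linear P a -> G}).
Hypothesis P0 : forall j (x : P j), j < a -> x = 0.
Let S := stalk G (a + 1).

Definition ext_fam n : {linear P n -> G} := dfwith (fun j => \0 : {linear P j -> G}) alpha n.

Lemma ext_famN n x : stalkmod G (a + 1) (n + 1) (ext_fam n x).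
Proof.
move=> na; rewrite /ext_fam dfwith_out //.
by apply: contra_neq na => ->.
Qed.

Definition tau n : {linear P n -> S (n + 1)} := corestr (@ext_famN n).

Lemma tau_d n x : tau (n + 1) (cdiff P n x) = 0.
Proof.
apply: submod_inj; rewrite /= /ext_fam; have [na|na] := eqVneq a (n + 1).
  by rewrite (zero_below x P0 (esym na)) linear0 linear0.
by rewrite dfwith_out.
Qed.

(** The extension of [P] by [S], the module [G] in degree [a + 1], that is
    classified by [alpha].  It is the desuspended cone of the map from [P] to
    [G] in degree [a]. *)
Definition ext_obj n : rmodType A := (P n * S n)%type.
Definition ext_diff_fun n (p : ext_obj n) : ext_obj (n + 1) :=
  (cdiff P n p.1, tau n p.1).
Fact ext_diff_linear n : linear (@ext_diff_fun n).
Proof. by move=> c p q; rewrite /ext_diff_fun !linearP. Qed.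
Fact ext_diffK n p : mklin (@ext_diff_linear (n + 1)) (mklin (@ext_diff_linear n) p) = 0.
Proof.
rewrite -[LHS]/(cdiff P (n + 1) (cdiff P n p.1), tau (n + 1) (cdiff P n p.1)).
by rewrite cdiffK tau_d.
Qed.
Definition ext : complex A := Complex ext_diffK.

Definition ext_in_fun n (s : S n) : ext n := (0, s).
Fact ext_in_linear n : linear (@ext_in_fun n).
Proof. by move=> c x y; congr pair; rewrite /= scaler0 addr0. Qed.
Fact ext_in_subproof n s :
  mklin (@ext_in_linear (n + 1)) (cdiff S n s) = cdiff ext n (mklin (@ext_in_linear n) s).
Proof. by rewrite -[RHS]/(cdiff P n 0, tau n 0) !linear0. Qed.
Definition ext_in : chmap S ext := ChMap ext_in_subproof.

Definition ext_out_fun n (p : ext n) : P n := p.1.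
Fact ext_out_linear n : linear (@ext_out_fun n). Proof. by []. Qed.
Definition ext_out : chmap ext P :=
  @ChMap _ _ ext P (fun n => mklin (@ext_out_linear n)) (fun n p => erefl).

Definition ext_cone_fun n (c : cone ext_in n) : P n := c.2.1.
Fact ext_cone_linear n : linear (@ext_cone_fun n). Proof. by []. Qed.
Fact ext_cone_subproof n (c : cone ext_in n) :
  mklin (@ext_cone_linear (n + 1)) (cdiff (cone ext_in) n c)
    = cdiff P n (mklin (@ext_cone_linear n) c).
Proof. by rewrite -[LHS]/(0 + cdiff P n c.2.1) add0r. Qed.
Definition ext_cone : chmap (cone ext_in) P := ChMap ext_cone_subproof.

Lemma ext_cone_qis : quasi_iso ext_cone.
Proof.
have dE n (c : cone ext_in n) : cdiff (cone ext_in) n c =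
    (0, (cdiff P n c.2.1, c.1 + tau n c.2.1)).
  rewrite -[LHS]/(- (0 : S _), (0 + cdiff P n c.2.1, c.1 + tau n c.2.1)).
  by rewrite oppr0 add0r.
split=> n.
  move=> [s [x s']]; rewrite dE => -[_ /= sx] [y xy].
  have {}xy : x = cdiff P n y := xy.
  exists (s' - tau n y, (y, 0)); rewrite dE /= subrK -xy; congr (_, _).
  apply: submod_inj; apply: etrans sx; rewrite -[ext_fam _ _]/(sval (tau (n + 1) x)).
  by rewrite xy tau_d addr0.
move=> x dx; exists (- tau (n + 1) x, (x, 0)); split.
  by rewrite dE /= dx addNr.
by exists 0; rewrite linear0 -[X in _ - X]/x subrr.
Qed.

Section Terms.
Hypotheses (pG : projective G) (pP : forall n, projective (P n)).

Lemma ext_projective n : projective (ext n).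
Proof. by apply: projective_prod => //; apply: stalk_projective. Qed.

Lemma ext_within l : within P a l.+1 -> within ext a l.+1.
Proof.
move=> wP j [x s] ja; congr pair; first by apply: wP; lia.
by apply: submod_inj; apply: stalk_val; lia.
Qed.

(** The restriction of [f] to [S] has finitely many components because [S] is
    perfect; let [e] project onto the summands that it meets.  Then [f - e f]
    vanishes on [S], so it factors through the compact object [P], and [e f] is
    a finite sum like every morphism composed with [e]. *)
Lemma ext_compact l : fin_gen G -> within P a l.+1 -> compact (C := derived A) P ->
  compact (C := derived A) ext.
Proof.
move=> fG wP cP I Yi W iota cW f.
have cE : cofibrant ext.
  apply: bounded_cofibrant; last exact: ext_projective.
  exact/within_bounded/ext_within/wP.
have pS : perfect S by apply: perfect_stalk.
have [e [ef fe]] := fin_sum_idem cW (perfect_compact pS cW (f ∘ dmap ext_in)).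
rewrite -(hsubK f (e ∘ f)); apply: fin_sum_add; last exact: fe.
have [u uE] := dhom_chain cE (hsub f (e ∘ f)).
have : dmap (chcomp u ext_in) = dmap (chzero S W).
  by rewrite dmap_comp -uE comp_subl -compA ef hsubxx.
move=> /(dmap_inj (perfect_cofibrant pS)).
move=> /(cofibrant_homotopic (perfect_cofibrant pS)) [h hE].
have uS n s : u (n + 1) (0, s) = cdiff W n (h n s).
  have := hE n s; rewrite -[LHS]/(u (n + 1) (0, s)) => ->.
  by rewrite -[cdiff S _ _]/(0 : S _) linear0 addr0 add0r.
pose v_fun n (x : P n) : W n := u n (x, 0) - h n (tau n x).
have v_lin n : linear (@v_fun n).
  move=> c x y; rewrite /v_fun.
  have -> : h n (tau n (c *: x + y)) = c *: h n (tau n x) + h n (tau n y).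
    by rewrite !linearP.
  have -> : ((c *: x + y, 0) : ext n) = c *: ((x, 0) : ext n) + (y, 0).
    by congr pair; rewrite /= scaler0 addr0.
  by rewrite (linearP (u n)) opprD addrACA scalerBr.
have v_d n x : mklin (v_lin (n + 1)) (cdiff P n x) = cdiff W n (mklin (v_lin n) x).
  rewrite -[LHS]/(u (n + 1) (cdiff P n x, 0) - h (n + 1) (tau (n + 1) (cdiff P n x))).
  rewrite tau_d linear0 subr0.
  rewrite -[RHS]/(cdiff W n (u n (x, 0) - h n (tau n x))) linearB -cmapE.
  rewrite -[cdiff ext _ _]/((cdiff P n x, tau n x) : ext (n + 1)) -uS -linearB.
  by congr (u _ _); congr pair; rewrite /= ?subr0 ?subrr.
pose v : chmap P W := @ChMap _ _ P W (fun n => mklin (v_lin n)) v_d.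
suff -> : hsub f (e ∘ f) = dmap v ∘ dmap ext_out.
  by apply: fin_sum_compr; apply: cP.
rewrite uE -dmap_comp; apply/dmap_heq/homotopic_heq.
have K_lin n : linear (fun p : ext (n + 1) => h n p.2 : W n).
  by move=> c p q; rewrite -linearP.
exists (fun n => mklin (K_lin n)) => n [x s].
rewrite -[RHS]/(u (n + 1) (x, 0) - h (n + 1) (tau (n + 1) x) +
  (cdiff W n (h n s) + h (n + 1) (tau (n + 1) x))).
rewrite addrA -uS addrAC subrK -linearD; congr (u _ _).
by congr pair; rewrite /= ?addr0 ?add0r.
Qed.

End Terms.
End Extension.

Section Devissage.
Context {k : comPzRingType} {A : kalg k}.
Implicit Types X Y Z K P R : complex A.

(** Compact complexes are built from finitely generated projective modules:
    by [compact_bottom] the extension of [P] by [G] in degree [a + 1] has a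
    split bottom differential, so it is equivalent to a shorter complex, and
    [P] is the cone of [G -> extension]. *)
Lemma devissage (Phi : complex A -> Prop) :
  (forall X Y, isomorphic (X : derived A) Y -> Phi X -> Phi Y) ->
  (forall M a, fin_gen M -> projective M -> Phi (stalk M a)) ->
  (forall X Y (u : chmap X Y), Phi X -> Phi Y -> Phi (cone u)) ->
  forall X, compact (C := derived A) X -> Phi X.
Proof.
move=> Phi_iso Phi_stalk Phi_cone X compX.
have [P [a [l [wP pP PX]]]] := compact_bounded compX.
apply: (Phi_iso P) => //.
have {compX PX} compP := compact_iso (isomorphic_sym PX) compX.
elim: l a P wP pP compP => [|l IH] a P wP pP compP.
  have [G [alpha [y [H [fG pG yE]]]]] := compact_bottom (within_cofibrant pP wP) (pP a)
    (fun j x ja => wP j x ltac:(lia)) compP.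
  have yE' p : y (alpha p) = p.
    by rewrite [RHS]yE (wP _ (cdiff P a p)) ?linear0 ?addr0 //; lia.
  have d0 x : cdiff P a ((idfun : {linear P a -> P a}) x) = 0 by apply: wP; lia.
  apply: (Phi_iso (stalk (P a) a)); last first.
    apply: Phi_stalk => //; apply: (fin_gen_surj (f := y)) fG => x.
    by exists (alpha x).
  exists (dmap (stalk_map d0)); apply: dmap_qis; apply: qis_inj_surj => n x.
    have [an|na] := eqVneq a n; last first.
      by move=> _; apply: submod_inj; apply: stalk_val; rewrite eq_sym.
    case: n / an x => x; rewrite stalk_mapE /= => x0; exact: submod_inj.
  have [an|na] := eqVneq a n.
    by case: n / an x => x; exists (stalk_in a x); rewrite stalk_mapE.
  by exists 0; rewrite linear0 (wP _ x) //; lia.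
have P0 j (x : P j) : j < a -> x = 0 by move=> ja; apply: wP; lia.
have [G [alpha [y [H [fG pG yE]]]]] := compact_bottom (within_cofibrant pP wP) (pP a)
  P0 compP.
pose E := ext alpha P0.
have wE : within E a l.+1 by apply: ext_within.
have [||R [i [r [ri qi R0]]]] := @trunc_low _ _ E a.
- have K_lin : linear (fun p : E (a + 1) => (H p.1 + y (sval p.2), 0) : E a).
    move=> c p q; congr pair; last by rewrite /= scaler0 addr0.
    rewrite -[LHS]/(H (c *: p.1 + q.1) + y (c *: sval p.2 + sval q.2)).
    rewrite -[RHS]/(c *: (H p.1 + y (sval p.2)) + (H q.1 + y (sval q.2))).
    by rewrite !linearP scalerDr addrACA.
  exists (mklin K_lin) => -[p s].
  have -> : s = 0 by apply: submod_inj; apply: stalk_val; lia.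
  rewrite [X in bdry X](_ : _ = 0); first exact: bdry0.
  rewrite -[X in _ - X]/((H (cdiff P a p) + y (ext_fam alpha a p), 0) : E a).
  by rewrite /ext_fam dfwith_in [H _ + _]addrC -yE subrr.
- by move=> j x ja _; rewrite (wE _ x) ?ja //; apply: bdry0.
have PhiR : Phi R.
  apply: (IH (a + 1)).
  - move=> j x /orP [ja|ja]; first by apply: R0; lia.
    by rewrite -(ri _ x) (wE _ (i j x)) ?linear0 //; lia.
  - by move=> n; apply: (proj_retract (ri n)); apply: ext_projective.
  have RE : isomorphic (R : derived A) E by exists (dmap i); apply: dmap_qis.
  apply: (compact_iso (isomorphic_sym RE)); exact: ext_compact wP compP.
apply: (Phi_iso (cone (ext_in alpha P0))).
  by exists (dmap (ext_cone alpha P0)); apply: dmap_qis; apply: ext_cone_qis.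
apply: Phi_cone; first exact: Phi_stalk.
by apply: Phi_iso PhiR; exists (dmap i); apply: dmap_qis.
Qed.

End Devissage.

(** * Cones and distinguished triangles *)

Section Cones.
Context {k : comPzRingType} {A : kalg k}.
Implicit Types X Y Z K P Q W : complex A.

Lemma surj_regroup (V : zmodType) (y U b h c : V) :
  y - (c - b + h) = - U + (y + U + b - h - c).
Proof.
rewrite [y + U]addrC -!addrA addKr !opprD opprK; congr (_ + _).
by rewrite [LHS]addrCA [- c - h]addrC.
Qed.

Section ConeMap.
Variables (P Q X Y : complex A) (v : chmap P Q) (u : chmap X Y).
Variables (a : chmap P X) (b : chmap Q Y) (h : forall n, {linear P (n + 1) -> Y n}).
Hypothesis hE : forall n x, b (n + 1) (v (n + 1) x) = u (n + 1) (a (n + 1) x)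
  + (cdiff Y n (h n x) + h (n + 1) (cdiff P (n + 1) x)).

Definition cone_map_fun n (p : cone v n) : cone u n :=
  (a (n + 1) p.1, b n p.2 + h n p.1).
Fact cone_map_linear n : linear (@cone_map_fun n).
Proof.
move=> c p q; rewrite /cone_map_fun /= !linearP; congr pair.
by rewrite /= scalerDr addrACA.
Qed.
Fact cone_map_subproof n p :
  mklin (@cone_map_linear (n + 1)) (cdiff (cone v) n p)
    = cdiff (cone u) n (mklin (@cone_map_linear n) p).
Proof.
case: p => x y.
rewrite -[LHS]/((a (n + 1 + 1) (- cdiff P (n + 1) x),
  b (n + 1) (v (n + 1) x + cdiff Q n y) + h (n + 1) (- cdiff P (n + 1) x)) : cone u (n + 1)).
rewrite -[RHS]/((- cdiff X (n + 1) (a (n + 1) x),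
  u (n + 1) (a (n + 1) x) + cdiff Y n (b n y + h n x)) : cone u (n + 1)).
rewrite !linearN !linearD hE !cmapE; congr pair.
rewrite /= -!addrA; congr (_ + _).
rewrite [cdiff Y n (b n y) + - _]addrC !addrA addrK addrC //.
Qed.
Definition cone_map : chmap (cone v) (cone u) := ChMap cone_map_subproof.

Lemma cone_dE (P' Q' : complex A) (w : chmap P' Q') n x y :
  cdiff (cone w) n (x, y) = (- cdiff P' (n + 1) x, w (n + 1) x + cdiff Q' n y).
Proof. by []. Qed.

Lemma cone_mapE n x y : cone_map n (x, y) = (a (n + 1) x, b n y + h n x).
Proof. by []. Qed.

Hypotheses (qa : quasi_iso a) (qb : quasi_iso b).

(** The five lemma for the long exact sequences of the two cones, carried out on
    elements. *)
Lemma cone_map_qis : quasi_iso cone_map.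
Proof.
have [ai aS] := qa; have [bi bS] := qb; split=> n.
  move=> [x y]; rewrite cone_dE => -[/eqP]; rewrite oppr_eq0 => /eqP dx xy.
  move=> [[x' y']]; rewrite cone_dE cone_mapE => -[ax bh].
  have [|x0 xE] := ai _ x dx; first by exists (- x'); rewrite linearN.
  rewrite {x}xE in dx xy ax bh *; rewrite !cmapE in ax xy.
  have [|z [dz [t tE]]] := aS _ (x' + a (n + 1) x0).
    by rewrite linearD ax subrr.
  have by1 : b (n + 1) (y + v (n + 1) x0 - v (n + 1) z)
      = cdiff Y n (y' + u n t + h n x0 - h n z).
    rewrite (linearB (b _)) linearD !hE dz linear0 addr0.
    rewrite (linearB (cdiff Y n)) !(linearD (cdiff Y n)) -(cmapE u t) -tE.
    rewrite (linearB (u _)) (linearD (u _)).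
    have -> : b (n + 1) y = u (n + 1) x' + cdiff Y n y' - h (n + 1) (cdiff P (n + 1) x0).
      by rewrite -bh addrK.
    rewrite opprD [u _ _ + (_ + h _ _)]addrA [_ + h _ _]addrC [_ - h _ _ + _]addrA subrK.
    by rewrite [u _ x' + _]addrC !addrA; congr (_ + _); exact: addrAC.
  have [||w wE] := bi _ (y + v (n + 1) x0 - v (n + 1) z).
  - by rewrite linearB linearD -(cmapE v z) dz linear0 subr0 [cdiff Q _ y + _]addrC xy.
  - by exists (y' + u n t + h n x0 - h n z).
  exists (z - x0, w); rewrite cone_dE -wE (linearB (cdiff P _)) (linearB (v _)) dz sub0r opprK.
  by congr (_, _); rewrite [RHS]addrC -[RHS]addrA addKr addrK.
move=> [x' y']; rewrite cone_dE => -[/eqP]; rewrite oppr_eq0 => /eqP dx' xy'.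
have [x [dx [t tE]]] := aS _ x' dx'.
have bvx : b _ (v _ x) = u _ (a _ x) + cdiff Y _ (h _ x).
  by rewrite hE dx linear0 addr0.
have dy2 : cdiff Y _ (y' + u _ t) = - u _ (a _ x).
  rewrite linearD -cmapE -tE linearB addrA [_ + u _ x']addrC xy' sub0r //.
have [||y0 y0E] := bi _ (v _ x).
- by rewrite -cmapE dx linear0.
- exists (h _ x - (y' + u _ t)); rewrite linearB dy2 opprK bvx; exact: addrC.
have [|y4 [dy4 [w wE]]] := bS _ (y' + u _ t + b _ y0 - h _ x).
  rewrite linearB linearD dy2 -cmapE -y0E bvx addKr subrr //.
exists (x, y4 - y0); split.
  by rewrite cone_dE linearB dy4 -y0E sub0r subrr dx oppr0.
exists (- t, w); rewrite cone_dE cone_mapE (linearN (cdiff X _)) (linearN (u _)) opprK.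
rewrite -tE -wE (linearB (b _)).
transitivity ((x' - a _ x, y' - (b _ y4 - b _ y0 + h _ x)) : cone u (n + 1)) => //.
by congr (_, _); exact: surj_regroup.
Qed.

End ConeMap.

Lemma cone_iso P Q X Y (v : chmap P Q) (u : chmap X Y)
    (a : hom (P : derived A) X) (b : hom (Q : derived A) Y) :
  cofibrant P -> cofibrant Q -> is_iso a -> is_iso b ->
  b ∘ dmap v = dmap u ∘ a -> isomorphic (cone v : derived A) (cone u).
Proof.
move=> cP cQ; have [a' ->] := dhom_chain cP a; have [b' ->] := dhom_chain cQ b.
move=> /iso_dmap_qis qa /iso_dmap_qis qb; rewrite -!dmap_comp => /(dmap_inj cP).
move=> /(cofibrant_homotopic cP) [h hE].
exists (dmap (cone_map hE)); apply: dmap_qis; exact: cone_map_qis.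
Qed.

Lemma dist_cone (X Y Z : derived A) (f : hom X Y) (g : hom Y Z) (h : hom Z (shift X))
    P Q (v : chmap P Q) (a : hom (P : derived A) X) (b : hom (Q : derived A) Y) :
  dist f g h -> cofibrant P -> cofibrant Q -> is_iso a -> is_iso b ->
  b ∘ dmap v = f ∘ a -> isomorphic (cone v : derived A) Z.
Proof.
move=> [X' [Y' [u [a' [b' [c [[ia ib ic] fE _ _]]]]]]] cP cQ iso_a iso_b ba.
apply: (isomorphic_trans (Y := (cone u : derived A))); last first.
  by apply: isomorphic_sym; exists c.
apply: (cone_iso (a := a' ∘ a) (b := b' ∘ b)) => //; try exact: is_iso_comp.
by rewrite -compA ba compA fE compA.
Qed.

Lemma cone_dist X Y (u : chmap X Y) :
  @dist _ (derived A) _ _ _ (dmap u) (dmap (cone_inl u)) (dmap (cone_proj u)).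
Proof.
exists X, Y, u, (idm (X : derived A)), (idm (Y : derived A)), (idm (cone u : derived A)).
split; first by split; apply: is_iso_id.
- by rewrite (comp1m (l := derived A)) (compm1 (l := derived A)).
- by rewrite (comp1m (l := derived A)) (compm1 (l := derived A)).
by rewrite fmap1 (comp1m (l := derived A)) (compm1 (l := derived A)).
Qed.

Lemma reindex (P V : complex A) (h : forall n, {linear P (n + 1) -> V (n + 1)}) :
  exists F : forall n, {linear P n -> V n}, forall n x, F (n + 1) x = h n x.
Proof.
exists (fun n => eq_rect (n - 1 + 1) (fun m => {linear P m -> V m}) (h (n - 1)) n (subrK 1 n)).
move=> n x; move: (subrK 1 (n + 1)); move: (n + 1 - 1) (addrK 1 n) => m -> e.
by rewrite (eq_irrelevance e erefl).
Qed.

(** A nullhomotopy of the composite with values in the cone has two components: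
    the one in [V] is a chain map that lifts [f], the one in [Y] is a homotopy
    from [f] to the composite of the lift with [g]. *)
Lemma cone_lift W V Y (g : chmap V Y) (f : hom (W : derived A) Y) :
  dmap (cone_inl g) ∘ f = hzero _ _ -> exists f', f = dmap g ∘ f'.
Proof.
move=> f0; have cP := @res_cofibrant _ _ W; have [e' [_ ee']] := eps_iso W.
have [u uE] := dhom_chain cP (f ∘ eps W).
have : dmap (chcomp (cone_inl g) u) = dmap (chzero _ _).
  by rewrite dmap_comp -uE compA f0 comp0m.
move=> /(dmap_inj cP) /(cofibrant_homotopic cP) [h hE].
pose P := resolution W.
have h1_lin n : linear (fun x : P (n + 1) => (h n x).1 : V (n + 1)).
  by move=> c x y; rewrite linearP.
have h2_lin n : linear (fun x : P (n + 1) => (h n x).2 : Y n).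
  by move=> c x y; rewrite linearP.
have hE1 n x : (h (n + 1) (cdiff P (n + 1) x)).1 = cdiff V (n + 1) (h n x).1.
  have /(congr1 fst) /= := hE n x; rewrite add0r => E.
  apply: (addrI (- cdiff V (n + 1) (h n x).1)); rewrite addNr; exact/esym/E.
have hE2 n x : u (n + 1) x = g (n + 1) (h n x).1 +
    (cdiff Y n (h n x).2 + (h (n + 1) (cdiff P (n + 1) x)).2).
  by have /(congr1 snd) /= -> := hE n x; rewrite add0r addrA.
have [F FE] := reindex (fun n => mklin (h1_lin n)).
have Fd n x : F (n + 1) (cdiff P n x) = cdiff V n (F n x).
  by move: n x; apply: int_succ => n x; rewrite !FE; exact: hE1.
exists (dmap (ChMap Fd) ∘ e').
rewrite -[LHS]compm1 -ee' compA uE compA -dmap_comp; congr (_ ∘ _).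
apply/dmap_heq/homotopic_heq; exists (fun n => mklin (h2_lin n)) => n x.
by rewrite hE2; congr (_ + _); rewrite /= FE.
Qed.

(** ** Perfect complexes form a triangulated subcategory *)

Lemma perfect_cone P Q (u : chmap P Q) : perfect P -> perfect Q -> perfect (cone u).
Proof.
move=> [[m bP] fP] [[l bQ] fQ]; split.
  exists (m + l).+1 => n nml [x y]; congr pair; [apply: bP | apply: bQ]; lia.
move=> n; have [fp pp] := fP (n + 1); have [fq pq] := fQ n; split.
  exact: fin_gen_prod.
exact: projective_prod.
Qed.

Lemma Kbproj_cone X Y (u : chmap X Y) :
  Kbproj (X : derived A) -> Kbproj (Y : derived A) -> Kbproj (cone u : derived A).
Proof.
move=> /KbprojP [P pP [a ia]] /KbprojP [Q pQ [b ib]].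
have cP := perfect_cofibrant pP; have cQ := perfect_cofibrant pQ.
have [b' [b'b bb']] := ib.
have [v vE] := dhom_chain cP (b' ∘ (dmap u ∘ a)).
apply: (Kbproj_iso (X := cone v)); last exact/perfect_Kbproj/perfect_cone.
by apply: (cone_iso (a := a) (b := b)) => //; rewrite -vE compA bb' comp1m.
Qed.

(** Every arrow of the derived category has a cofibrant chain-level model with
    a prescribed cofibrant target. *)
Lemma dist_model (X Y Z : derived A) (f : hom X Y) (g : hom Y Z) (h : hom Z (shift X))
    Q (b : hom (Q : derived A) Y) : dist f g h -> cofibrant Q -> is_iso b ->
  exists v : chmap (resolution X) Q,
    b ∘ dmap v = f ∘ eps X /\ isomorphic (cone v : derived A) Z.
Proof.
move=> fgh cQ ib; have [b' [b'b bb']] := ib.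
have [v vE] := dhom_chain (@res_cofibrant _ _ X) (b' ∘ (f ∘ eps X)).
exists v; have bv : b ∘ dmap v = f ∘ eps X by rewrite -vE (compA _ b' b) bb' comp1m.
split=> //; apply: (dist_cone fgh _ cQ _ ib bv); first exact: res_cofibrant.
exact: eps_iso.
Qed.

Lemma Kbproj_dist3 (X Y Z : derived A) (f : hom X Y) (g : hom Y Z) (h : hom Z (shift X)) :
  dist f g h -> Kbproj X -> Kbproj Y -> Kbproj Z.
Proof.
move=> fgh KX /KbprojP [Q pQ [b ib]].
have [v [_ vZ]] := dist_model fgh (perfect_cofibrant pQ) ib.
apply: Kbproj_iso vZ _; apply: Kbproj_cone; last exact: perfect_Kbproj.
by apply: Kbproj_iso KX; apply: isomorphic_sym; exists (eps X); apply: eps_iso.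
Qed.

Lemma perfect_unshift P : perfect P -> perfect (unshift P).
Proof.
move=> [[m bP] fP]; split; last by move=> n; apply: fP.
by exists m.+1 => n mn x; apply: bP; lia.
Qed.

Lemma Kbproj_unshift X : Kbproj (cshift X : derived A) -> Kbproj (X : derived A).
Proof.
move=> /KbprojP [P pP [a ia]]; have [u uE] := dhom_chain (perfect_cofibrant pP) a.
rewrite uE in ia; have qu := iso_dmap_qis ia.
apply: (Kbproj_iso (X := unshift P)); last exact/perfect_Kbproj/perfect_unshift.
exists (dmap (chcomp (unshiftK X) (chunshift u))); apply: dmap_qis.
by apply: qis_comp; [apply: unshiftK_qis | apply: qis_unshift].
Qed.

Section Rotation.
Variables (P Q : complex A) (v : chmap P Q).

(** The cone of [Q -> cone v] is the shift of [P]: the rotation of the triangle of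
    [v]. *)
Definition rot_fun n (c : cone (cone_inl v) n) : cshift P n := c.2.1.
Fact rot_linear n : linear (@rot_fun n). Proof. by []. Qed.
Fact rot_subproof n (c : cone (cone_inl v) n) :
  mklin (@rot_linear (n + 1)) (cdiff (cone (cone_inl v)) n c)
    = cdiff (cshift P) n (mklin (@rot_linear n) c).
Proof. by rewrite -[LHS]/(0 - cdiff P (n + 1) c.2.1) sub0r. Qed.
Definition rot : chmap (cone (cone_inl v)) (cshift P) := ChMap rot_subproof.

Lemma rot_qis : quasi_iso rot.
Proof.
have dE n q p q' : cdiff (cone (cone_inl v)) n (q, (p, q')) =
    (- cdiff Q (n + 1) q, (- cdiff P (n + 1) p, q + (v (n + 1) p + cdiff Q n q'))).
  rewrite -[LHS]/(- cdiff Q (n + 1) q,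
    (0 - cdiff P (n + 1) p, q + (v (n + 1) p + cdiff Q n q'))).
  by rewrite sub0r.
split=> n.
  move=> [q [p q']]; rewrite dE => -[_ _ qp] [y py].
  have {}py : p = - cdiff P (n + 1) y := py.
  exists (q' - v (n + 1) y, (y, 0)); rewrite dE linear0 addr0 subrK -py.
  congr (_, _); rewrite linearB opprB -cmapE; apply/eqP; rewrite -subr_eq0.
  apply/eqP; apply: etrans qp; rewrite py linearN opprB.
  by congr (_ + _); exact: addrC.
move=> p /= dp; exists (- v (n + 1 + 1) p, (p, 0)); split.
  rewrite dE dp linear0 addr0 addNr linearN opprK -cmapE.
  have /eqP := dp; rewrite oppr_eq0 => /eqP ->; rewrite linear0 //.
by exists 0; rewrite linear0 oppr0 -[X in X = _]/(p - p) subrr.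
Qed.

End Rotation.

(** By rotation, [shift X] is a cone of perfect complexes. *)
Lemma Kbproj_dist1 (X Y Z : derived A) (f : hom X Y) (g : hom Y Z) (h : hom Z (shift X)) :
  dist f g h -> Kbproj Y -> Kbproj Z -> Kbproj X.
Proof.
move=> fgh /KbprojP [Q pQ [b ib]] KZ.
have cQ := perfect_cofibrant pQ.
have [v [_ vZ]] := dist_model fgh cQ ib.
have Kinl : Kbproj (cone (cone_inl v) : derived A).
  apply: Kbproj_cone; first exact: perfect_Kbproj.
  exact: Kbproj_iso (isomorphic_sym vZ) KZ.
have : Kbproj (cshift (resolution X) : derived A).
  by apply: Kbproj_iso Kinl; exists (dmap (rot v)); apply: dmap_qis; apply: rot_qis.
move=> /Kbproj_unshift; apply: Kbproj_iso.
by exists (eps X); apply: eps_iso.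
Qed.

(** Devissage applied to the property of being perfect. *)
Lemma compact_Kbproj X : compact (C := derived A) X -> Kbproj (X : derived A).
Proof.
apply: (@devissage _ _ (fun X => Kbproj (X : derived A))).
- exact: Kbproj_iso.
- by move=> M a fM pM; apply/perfect_Kbproj/perfect_stalk.
- exact: Kbproj_cone.
Qed.

End Cones.

(** * Functors and perfect complexes *)

Section Cells.
Context {k : comPzRingType} {A : kalg k}.

Lemma cell_map_qis (Y : complex A) a (y : Y a) (dy : cdiff Y a y = 0) :
  (forall j (x : Y j), j != a -> x = 0) ->
  (forall x, exists c : A^c, x = c *: y) -> (forall c : A^c, c *: y = 0 -> c = 0) ->
  quasi_iso (cell_map dy).
Proof.
move=> Y0 ys yi; apply: qis_inj_surj => n x; have [an|na] := eqVneq a n.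
- case: n / an x => x; rewrite /cell_map stalk_mapE => /yi x0; exact: submod_inj.
- by move=> _; apply: submod_inj; apply: stalk_val; rewrite eq_sym.
- case: n / an x => x; have [c ->] := ys x; exists (stalk_in a (c : (A^c)^o)).
  by rewrite /cell_map stalk_mapE.
by exists 0; rewrite linear0 (Y0 n x) // eq_sym.
Qed.

Lemma cell_regular : isomorphic (cell 0 : derived A) (regular A).
Proof.
pose y : regular A 0 := (1 : (A^c)^o).
have dy : cdiff (regular A) 0 y = 0 by [].
exists (dmap (cell_map dy)); apply/dmap_qis/cell_map_qis.
- by case=> [[|n]|n] x //= _; apply: thinmx0.
- by move=> x; exists x; apply: (esym (mulr1 (x : A^c))).
- by move=> c <-; apply: (esym (mulr1 (c : A^c))).
Qed.

Lemma cell_shift a : isomorphic (cell a : derived A) (cshift (cell (a + 1))).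
Proof.
pose y : cshift (@cell k A (a + 1)) a := @cell1 k A (a + 1).
have dy : cdiff (cshift (@cell k A (a + 1))) a y = 0 by exact: oppr0.
exists (dmap (cell_map dy)); apply/dmap_qis/cell_map_qis.
- move=> j x ja; apply: submod_inj; apply: stalk_val.
  by apply: contra_neq ja => /addIr.
- by move=> x; exists (sval x); apply: submod_inj; apply: (esym (mulr1 (sval x : A^c))).
- by move=> c /(congr1 sval) c0; apply: etrans (esym (mulr1 (c : A^c))) c0.
Qed.

Lemma regular_perfect : Kbproj (regular A : derived A).
Proof. by apply: Kbproj_iso cell_regular _; apply/perfect_Kbproj/cell_perfect. Qed.

(** The dual basis of a finitely generated projective module. *)
Lemma stalk_fin_sum (M : rmodType A) a : fin_gen M -> projective M ->
  exists n (e : forall i : 'I_n, hom (cell a : derived A) (stalk M a)),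
    fin_sum e (idm (stalk M a : derived A)).
Proof.
move=> [n [e eM]] pM.
have eS x : exists z, freelin e z = x.
  have [c ->] := eM x; exists (\sum_i c i *: gen1 A^c i).
  by rewrite linear_sum; apply: eq_bigr => i _; rewrite linearZ freelin1.
have [s sE] := pM _ _ (freelin e) idfun eS.
pose y i := cell_map (Y := stalk M a) (a := a) (y := stalk_in a (e i)) erefl.
pose c i : chmap (stalk M a) (cell a) :=
  stalk_map (f := mklin (@stalk_in_linear _ _ _ a) \o (dsproj i \o s)) (fun x => erefl).
exists n, (fun i => dmap (y i)).
have -> : idm (stalk M a : derived A) = dmap (foldr (fun i v => chadd (chcomp (y i) (c i)) v)
    (chzero (stalk M a) (stalk M a)) (enum 'I_n)).
  apply: dmap_ext; apply: stalk_ext => x.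
  have -> r : foldr (fun i v => chadd (chcomp (y i) (c i)) v) (chzero _ _) r a (stalk_in a x)
      = \sum_(i <- r) (dsproj i (s x) : A^c) *: stalk_in a (e i).
    elim: r => [|i r IH]; first by rewrite big_nil.
    rewrite big_cons -IH.
    rewrite -[LHS]/(y i a (c i a (stalk_in a x)) +
      (foldr (fun i v => chadd (chcomp (y i) (c i)) v) (chzero _ _) r) a (stalk_in a x)).
    by rewrite [c i a _]stalk_mapE [y i a _]stalk_mapE.
  have sx : supports (enum 'I_n) (s x) by split=> [|i _]; rewrite ?enum_uniq ?mem_enum.
  have xE : x = \sum_(i <- enum 'I_n) (dsproj i (s x) : A^c) *: e i.
    by rewrite -[LHS](sE x); exact: (copairE _ sx).
  rewrite -[LHS]/(mklin (@stalk_in_linear _ _ M a) x) [in LHS]xE linear_sum.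
  by apply: eq_bigr => i _; rewrite linearZ.
elim: (enum 'I_n) => [|i r IH]; first exact: (@fin_sum0 _ (derived A)).
rewrite -[foldr _ _ _]/(chadd (chcomp (y i) (c i)) (foldr _ _ r)) dmap_add dmap_comp.
exact: (@fin_sumD _ (derived A)).
Qed.

End Cells.

Section Functors.
Context {k : comPzRingType} {A B : kalg k}.

Section Trifunctor.
Variable F : trifunctor (derived A) (derived B).

Lemma trifunctor_shift (X : derived A) : isomorphic (F (shift X)) (shift (F X)).
Proof. by exists (fshift F X); apply: fshift_iso. Qed.

(** The cells are the shifts of [regular A]; positive shifts preserve perfect
    complexes and [Kbproj_unshift] undoes them. *)
Lemma Kbproj_cell_image : Kbproj (F (regular A)) -> forall a, Kbproj (F (cell a)).
Proof.
move=> KF.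
have step a : isomorphic (F (cell a)) (shift (F (cell (a + 1)))).
  apply: isomorphic_trans (trifunctor_shift (cell (a + 1))).
  exact: (isomorphic_fmap F (cell_shift a)).
have K0 : Kbproj (F (cell 0)).
  by apply: Kbproj_iso KF; apply/isomorphic_fmap/isomorphic_sym/cell_regular.
have up (n : nat) : Kbproj (F (cell n%:Z)).
  elim: n => [|n IH]; first exact: K0.
  rewrite -addn1 PoszD; apply: Kbproj_unshift.
  exact: Kbproj_iso (step n%:Z) IH.
have down (n : nat) : Kbproj (F (cell (- n%:Z))).
  elim: n => [|n IH]; first exact: K0.
  have := step (- n.+1%:Z); rewrite (_ : _ + 1 = - n%:Z); last by lia.
  by move=> /isomorphic_sym /Kbproj_iso; apply; apply: Kbproj_shift.
by case=> n; [apply: up | rewrite NegzE; apply: down].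
Qed.

(** Devissage applied to the property that [F X] is perfect.  For a projective
    module in a single degree, perfection of the image is seen through
    compactness, because the identity is a finite sum of morphisms through
    cells. *)
Lemma trifunctor_Kbproj : Kbproj (F (regular A)) -> forall X, Kbproj X -> Kbproj (F X).
Proof.
move=> /Kbproj_cell_image KF X /Kbproj_compact.
apply: (@devissage _ _ (fun X => Kbproj (F X))) => {X}.
- by move=> X Y XY; apply: Kbproj_iso; apply: isomorphic_fmap.
- move=> M a fM pM; apply: compact_Kbproj.
  have [n [e /(fin_sum_fmap F)]] := stalk_fin_sum a fM pM; rewrite fmap1.
  by apply: compact_fin_sum => _; apply: Kbproj_compact.
- move=> X Y u KX KY; exact: Kbproj_dist3 (fdist F (cone_dist u)) KX KY.
Qed.

End Trifunctor.

(** By [cells_coproduct] it is enough to look at morphisms from a cell to [R Y],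
    that is, from the compact object [L (cell n)] to the coproduct [Y]. *)
Lemma right_adjoint_coproducts (L : linfunctor (derived A) (derived B))
    (R : linfunctor (derived B) (derived A)) (ad : adjunction L R) :
  (forall X, Kbproj X -> Kbproj (L X)) -> preserves_coproducts R.
Proof.
move=> KL I Yi Y iota cY; have [pi [pi1 pi0]] := coprod_proj cY.
apply: (cells_coproduct (pi := fun i => fmap R (pi i))).
- by move=> i; rewrite -fmapM pi1 fmap1.
- by move=> i j ij; rewrite -fmapM pi0 // fmap0.
move=> n f; rewrite -(adj_rightK ad f); apply: adj_left_fin_sum.
by apply: Kbproj_compact => //; apply/KL/perfect_Kbproj/cell_perfect.
Qed.

End Functors.

(** * Recollements *)

Section ConeOfSum.
Context {k : comPzRingType} {A : kalg k}.
Variables (I : eqType) (X Y : I -> complex A) (u : forall i, chmap (X i) (Y i)).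

Fact cone_in_htpy i n x : dscin Y i (n + 1) (u i (n + 1) x)
  = dscmap u (n + 1) (dscin X i (n + 1) x)
  + (cdiff (dsumc Y) n ((\0 : {linear X i (n + 1) -> dsumc Y n}) x) +
     (\0 : {linear X i (n + 1 + 1) -> dsumc Y (n + 1)}) (cdiff (X i) (n + 1) x)).
Proof. by rewrite dscmap_in linear0 !addr0. Qed.

Fact cone_proj_htpy i n x : dscproj Y i (n + 1) (dscmap u (n + 1) x)
  = u i (n + 1) (dscproj X i (n + 1) x)
  + (cdiff (Y i) n ((\0 : {linear dsumc X (n + 1) -> Y i n}) x) +
     (\0 : {linear dsumc X (n + 1 + 1) -> Y i (n + 1)}) (cdiff (dsumc X) (n + 1) x)).
Proof. by rewrite dscmap_proj linear0 !addr0. Qed.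

Definition cone_sum_in i : chmap (cone (u i)) (cone (dscmap u)) := cone_map (@cone_in_htpy i).
Definition cone_sum_proj i : chmap (cone (dscmap u)) (cone (u i)) :=
  cone_map (@cone_proj_htpy i).

(** The cone of a direct sum of maps has the direct sums of the terms as its
    terms, so the inclusions and projections can be taken componentwise. *)
Lemma cone_sum_coproduct :
  coproduct (C := derived A) (fun i => dmap (cone_sum_in i)).
Proof.
have inE i n p : cone_sum_in i n p = (dscin X i (n + 1) p.1, dscin Y i n p.2).
  by rewrite -[LHS]/(dscin X i (n + 1) p.1, dscin Y i n p.2 + 0) addr0.
have projE i n p : cone_sum_proj i n p = (dscproj X i (n + 1) p.1, dscproj Y i n p.2).
  by rewrite -[LHS]/(dscproj X i (n + 1) p.1, dscproj Y i n p.2 + 0) addr0.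
apply: (chain_coproduct (pi := cone_sum_proj)).
- by move=> i n [x y]; rewrite projE inE !dscproj_in.
- by move=> i j n [x y] ij; rewrite projE inE !dscproj_out.
move=> n [x y]; have [s sx] := supportsP x; have [t ty] := supportsP y.
have uu := undup_uniq (s ++ t); exists (undup (s ++ t)).
have /dsum_decomp xE : supports (undup (s ++ t)) x.
  by apply: supports_sub sx uu _ => i si; rewrite mem_undup mem_cat si.
have /dsum_decomp yE : supports (undup (s ++ t)) y.
  by apply: supports_sub ty uu _ => i ti; rewrite mem_undup mem_cat ti orbT.
transitivity ((\sum_(i <- undup (s ++ t)) dscin X i (n + 1) (dscproj X i (n + 1) x),
   \sum_(i <- undup (s ++ t)) dscin Y i n (dscproj Y i n y)) : cone (dscmap u) n).
  by congr (_, _).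
elim: (undup (s ++ t)) => [|i r IH]; first by rewrite !big_nil.
by rewrite !big_cons -IH inE projE.
Qed.

End ConeOfSum.

Section Adjoints.
Context {k : comPzRingType}.
Variables (C D : lincat k) (L : linfunctor C D) (R : linfunctor D C).
Variable ad : adjunction L R.

Lemma unit_iso X : fully_faithful L -> is_iso (adj_unit ad X).
Proof.
move=> ff; have [inv _ invK] := ff (R (L X)) X; have [inv' invK' _] := ff X X.
exists (inv (adj_counit ad (L X))); split.
  by rewrite -[LHS]invK' fmapM invK triangleL -(fmap1 L) invK'.
by rewrite unit_nat invK triangleR.
Qed.

Lemma adj_zero X Y (f : hom (L X) Y) : is_zero (R Y) -> f = hzero _ _.
Proof.
move=> RY; rewrite -(adj_leftK ad f) -(comp1m (adj_left ad f)) RY comp0m.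
by rewrite /adj_right fmap0 compm0.
Qed.

End Adjoints.

Section ImageCompact.
Context {k : comPzRingType} {A B C : kalg k}.
Variables (il : trifunctor (derived B) (derived A)) (ish : trifunctor (derived A) (derived B)).
Variables (jl : trifunctor (derived C) (derived A)) (ju : trifunctor (derived A) (derived C)).
Variables (ad_i : adjunction il ish) (ad_j : adjunction ju jl).
Hypotheses (il_ff : fully_faithful il) (is_jl : forall X, is_zero (ish (jl X))).
Hypothesis tri : forall X : derived A, exists h : hom (jl (ju X)) (shift (il (ish X))),
  dist (adj_counit ad_i X) (adj_unit ad_j X) h.
Hypothesis jl_coprod : preserves_coproducts jl.

(** Given [f] from [il Y] to a coproduct of the [Z i], sum the triangles
    [il (ish (Z i)) -> Z i -> jl (ju (Z i))].  The third term of the sum is again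
    in the image of [jl], so it receives no morphism from [il Y], and [f] lifts
    to the coproduct of the [il (ish (Z i))], where compactness of [Y] applies. *)
Lemma image_compact Y : compact Y -> compact (il Y).
Proof.
move=> cY I Zi Z iota cZ f.
have il_coprod := left_adjoint_coproducts ad_i.
pose Q i := resolution (Zi i : complex A); pose V i := resolution (il (ish (Zi i)) : complex A).
have model i : exists v : chmap (V i) (Q i), isomorphic (cone v : derived A) (jl (ju (Zi i))).
  have [h hD] := tri (Zi i).
  have [v [_ vZ]] := dist_model hD (@res_cofibrant _ _ (Zi i)) (eps_iso (Zi i)).
  by exists v.
pose v i := sval (cid (model i)).
have vZ i : exists t : hom (cone (v i) : derived A) (jl (ju (Zi i))), is_iso t.
  by rewrite /v; case: cid.
pose t i := sval (cid (vZ i)).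
have iso_t i : is_iso (t i) by rewrite /t; case: cid.
have cQ := dsumc_coproduct (X := Q); have cV := dsumc_coproduct (X := V).
have [e [[e' [e'e ee']] eE]] := coprod_unique cQ cZ (fun i => eps_iso (Zi i)).
pose U := dsumc (fun i => ju (Zi i) : complex C).
have cU : coproduct (fun i => fmap jl (dsum_in (fun i => ju (Zi i) : complex C) i)).
  exact: jl_coprod (dsumc_coproduct (X := fun i => ju (Zi i))).
have [eT [iso_eT _]] := coprod_unique (cone_sum_coproduct (u := v)) cU iso_t.
have f0 : dmap (cone_inl (dscmap v)) ∘ (e' ∘ f) = hzero _ _.
  apply: (iso_mono iso_eT); rewrite compm0; apply: (adj_zero ad_i); exact: is_jl.
have [f' fE] := cone_lift f0.
have cE : coproduct (fun i => fmap il (dsum_in (fun i => ish (Zi i) : complex B) i)).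
  exact: il_coprod (dsumc_coproduct (X := fun i => ish (Zi i))).
have [d [[d' [d'd dd']] dE]] := coprod_unique cV cE (fun i => eps_iso (il (ish (Zi i)))).
have [inv _ invK] := il_ff Y (dsumc (fun i => ish (Zi i) : complex B)).
have fin_d : fin_sum (fun i => fmap il (dsum_in (fun i => ish (Zi i) : complex B) i)) (d ∘ f').
  rewrite -(invK (d ∘ f')); apply: fin_sum_fmap; apply: cY.
  exact: dsumc_coproduct.
have fin_f' : fin_sum (dsum_in V) f'.
  rewrite -(comp1m f') -d'd -compA; apply: fin_sum_compl fin_d => i.
  have [q [_ eq1]] := eps_iso (il (ish (Zi i))).
  have -> : d' ∘ fmap il (dsum_in (fun i => ish (Zi i) : complex B) i) = dsum_in V i ∘ q.
    rewrite -[X in _ = X ∘ _](comp1m (dsum_in V i)) -d'd -(compA _ _ d') dE.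
    by rewrite -!compA eq1 compm1.
  exact: fin_sum1.
rewrite -(comp1m f) -ee' -compA; apply: (fin_sum_compl (iota := dsum_in Q)).
  by move=> i; rewrite eE; apply: fin_sum1.
rewrite fE; apply: fin_sum_compl fin_f' => i.
have -> : dmap (dscmap v) ∘ dsum_in V i = dsum_in Q i ∘ dmap (v i).
  by rewrite /dsum_in -!dmap_comp; apply: dmap_ext => n x; apply: dscmap_in.
exact: fin_sum1.
Qed.

End ImageCompact.

(** ** Restriction of recollements to full subcategories *)

Section Restriction.
Context {k : comPzRingType}.

Section Adj.
Variables (S T : tricat k) (P : S -> Prop) (Q : T -> Prop).
Hypothesis Pshift : forall X, P X -> P (shift X).
Hypothesis Qshift : forall X, Q X -> Q (shift X).
Variables (L : trifunctor S T) (R : trifunctor T S).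
Hypotheses (LPQ : preserves P Q L) (RQP : preserves Q P R).
Variable ad : adjunction L R.

Definition full_adjunction :
    adjunction (full_trifunctor Pshift Qshift LPQ) (full_trifunctor Qshift Pshift RQP) :=
  @Adjunction k (full_tricat Pshift) (full_tricat Qshift)
    (full_trifunctor Pshift Qshift LPQ) (full_trifunctor Qshift Pshift RQP)
    (fun X => adj_unit ad (sval X)) (fun Y => adj_counit ad (sval Y))
    (fun X X' f => @unit_nat _ _ _ _ _ ad (sval X) (sval X') f)
    (fun Y Y' g => @counit_nat _ _ _ _ _ ad (sval Y) (sval Y') g)
    (fun X => triangleL ad (sval X)) (fun Y => triangleR ad (sval Y)).

Lemma full_trifunctor_ff :
  fully_faithful L -> fully_faithful (full_trifunctor Pshift Qshift LPQ).
Proof. by move=> ff X Y; apply: (ff (sval X) (sval Y)). Qed.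
End Adj.

Lemma recollement_restricts (T' T T'' : tricat k) (P' : T' -> Prop) (P : T -> Prop)
    (P'' : T'' -> Prop) (Ps' : forall X, P' X -> P' (shift X))
    (Ps : forall X, P X -> P (shift X)) (Ps'' : forall X, P'' X -> P'' (shift X))
    (R : six_functors T' T T'') :
  is_recollement R ->
  preserves P P' (i_up R) -> preserves P' P (i_low R) -> preserves P P' (i_shriek R) ->
  preserves P'' P (j_shriek R) -> preserves P P'' (j_up R) -> preserves P'' P (j_low R) ->
  restricts Ps' Ps Ps'' R.
Proof.
move=> [a1 [a2 [a3 [a4 [[f1 f2 f3] z t1 t2]]]]] p1 p2 p3 p4 p5 p6.
exists p1, p2, p3, p4, p5, p6.
exists (full_adjunction Ps Ps' p1 p2 a1), (full_adjunction Ps' Ps p2 p3 a2),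
  (full_adjunction Ps'' Ps p4 p5 a3), (full_adjunction Ps Ps'' p5 p6 a4).
split.
- by split; apply: full_trifunctor_ff.
- by move=> X; apply: (z (sval X)).
- by move=> X; have [h hD] := t1 (sval X); exists h.
- by move=> X; have [h hD] := t2 (sval X); exists h.
Qed.

End Restriction.

Theorem theorem4p4 (k : comPzRingType) (A B C : kalg k)
    (R : six_functors (derived B) (derived A) (derived C))
    (HR : is_recollement R) :
  let restr := restricts (@Kbproj_shift k B) (@Kbproj_shift k A)
                         (@Kbproj_shift k C) R in
  let cond_i := Kbproj (i_low R (regular B)) /\
                Kbproj (i_shriek R (regular A)) in
  let cond_j := Kbproj (j_up R (regular A)) /\
                Kbproj (j_low R (regular C)) in
  (restr <-> cond_i) /\ (restr <-> cond_j).
Proof.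
move=> restr cond_i cond_j.
have [a1 [a2 [a3 [a4 [[il_ff jl_ff js_ff] z t1 t2]]]]] := HR.
have il_coprod := left_adjoint_coproducts a2.
have js_coprod := left_adjoint_coproducts a3.
have ju_coprod := left_adjoint_coproducts a4.
have Kiu X : Kbproj X -> Kbproj (i_up R X).
  by move=> KX; apply/compact_Kbproj/(compact_left_adjoint a1)/Kbproj_compact.
have Kjs X : Kbproj X -> Kbproj (j_shriek R X).
  by move=> KX; apply/compact_Kbproj/(compact_left_adjoint a3)/Kbproj_compact.
have restr_i : restr -> cond_i.
  by move=> [_ [p2 [p3 _]]]; split; [apply: p2 | apply: p3]; apply: regular_perfect.
have restr_j : restr -> cond_j.
  move=> [_ [_ [_ [_ [p5 [p6 _]]]]]].
  by split; [apply: p5 | apply: p6]; apply: regular_perfect.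
split; split=> //.
- move=> [KiB KiA].
  have Kil := trifunctor_Kbproj KiB; have Kis := trifunctor_Kbproj KiA.
  have Kju X : Kbproj X -> Kbproj (j_up R X).
    (* j_! reflects compactness, and j_! j^* X is the fibre of X -> i_* i^* X. *)
    move=> KX; apply: compact_Kbproj; apply: (compact_reflect js_ff js_coprod).
    have [h hD] := t2 X; apply: Kbproj_compact.
    by apply: (Kbproj_dist1 hD) => //; apply/Kil/Kiu.
  have Kjl X : Kbproj X -> Kbproj (j_low R X).
    (* X is j^* of the compact object j_! X, whose i_* i^! is compact. *)
    move=> /Kjs KX; have [h hD] := t1 (j_shriek R X).
    have XX : isomorphic X (j_up R (j_shriek R X)).
      by exists (adj_unit a3 X); apply: unit_iso.
    apply: (Kbproj_iso (isomorphic_fmap (j_low R) (isomorphic_sym XX))).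
    by apply: (Kbproj_dist3 hD) => //; apply/Kil/Kis.
  exact: recollement_restricts.
move=> [KjA KjC].
have Kju := trifunctor_Kbproj KjA; have Kjl := trifunctor_Kbproj KjC.
have jl_coprod := right_adjoint_coproducts a4 Kju.
have Kil X : Kbproj X -> Kbproj (i_low R X).
  move=> KX; apply: compact_Kbproj; apply: (image_compact il_ff z t1 jl_coprod).
  exact: Kbproj_compact.
have Kis X : Kbproj X -> Kbproj (i_shriek R X).
  (* i_* reflects compactness, and i_* i^! X is the fibre of X -> j_* j^* X. *)
  move=> KX; apply: compact_Kbproj; apply: (compact_reflect il_ff il_coprod).
  have [h hD] := t1 X; apply: Kbproj_compact.
  by apply: (Kbproj_dist1 hD) => //; apply/Kjl/Kju.
exact: recollement_restricts.
Qed.
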